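(* Let $q\ge1$ be an integer. For $u\in[0,1]$ and $1\le j\le q+1$ let $\zeta_j(u)$ be a probability distribution on the nonnegative integers $\mathbb{N}$, and for $1\le j\le q$ let $\alpha_j(u)$ be the mean of $\zeta_j(u)$. Assume that $\sup_{u\in[0,1]}\sum_{j=1}^q\alpha_j(u)<1$, that $\zeta_{q+1}(u)$ has a finite first moment for all $u\in[0,1]$, and that there exist $C_0>0$ and $\kappa\in(0,1)$ such that $W_1(\zeta_j(u),\zeta_j(v))\le C_0|u-v|^\kappa$ for all $u,v\in[0,1]$ and $1\le j\le q+1$. Consider the time-varying INAR process $$X_{n,k}=\sum_{j=1}^q\sum_{i=1}^{X_{n,k-j}}Y^{(n,k)}_{j,i}+\eta^{(n)}_k,\qquad k\le n,$$ and the $\mathbb{N}^q$-valued Markov chains $\mathbf{X}_{n,k}=(X_{n,k-q+1},\ldots,X_{n,k})$. Then each kernel $Q_u$ (the transition kernel of the vectorized process with parameters frozen at $u$) has a unique invariant probability $\pi_u$, the triangular array $\{\mathbf{X}_{n,k}:n\ge1,k\le n\}$ is locally stationary, for every integer $j\ge1$ there exists $C>0$ such that for all $u\in[0,1]$, $n\ge1$ and $k$ with $k+j-1\le n$, $$W_1(\pi^{(n)}_{k,j},\pi_{u,j})\le C\left[\sum_{s=k}^{k+j-1}\left|u-\frac sn\right|^\kappa+\frac1{n^\kappa}\right],$$ and there exist $C'>0$ and $\rho\in(0,1)$ such that $\tau_n(j)\le C'\rho^j$ for all integers $n\ge1$, $j\ge1$.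
   Context: For each $n\ge1$ the variables $Y^{(n,k)}_{j,i}$, $\eta^{(n)}_k$ are all independent, $Y^{(n,k)}_{j,i}$ has law $\zeta_j(k/n)$ ($1\le j\le q$), $\eta^{(n)}_k$ has law $\zeta_{q+1}(k/n)$, with the convention $\zeta_j(u)=\zeta_j(0)$ for $u<0$, and the variables with upper/lower index $k$ are independent of $(X_{n,l})_{l<k}$. For $u\in[0,1]$, $\mathbf{x}\in\mathbb{N}^q$, let $S_u(\mathbf{x},\cdot)$ be the law of $\sum_{j=1}^q\sum_{i=1}^{x_{q-j+1}}Y_{j,i}+\eta$ with independent $Y_{j,i}\sim\zeta_j(u)$, $\eta\sim\zeta_{q+1}(u)$, and $Q_u(\mathbf{x},d\mathbf{y})=S_u(\mathbf{x},dy_q)\otimes\delta_{x_2}(dy_1)\otimes\cdots\otimes\delta_{x_q}(dy_{q-1})$, a Markov kernel on $\mathbb{N}^q$; $Q_u=Q_0$ for $u<0$. Thus $(\mathbf{X}_{n,k})_{k\le n}$ is a Markov chain with transition $Q_{k/n}$ at time $k$; $(\mathbf{X}_{n,k})_{k\le0}$ is taken stationary (kernel $Q_0$, marginal $\pi_0$); by convention $\mathbf{X}_{n,k}$ is a fixed constant for $k>n$. $\pi^{(n)}_{k,j}$ is the law of $(\mathbf{X}_{n,k},\ldots,\mathbf{X}_{n,k+j-1})$ and $\pi_{u,j}$ the law of $j$ consecutive coordinates of a stationary chain with kernel $Q_u$ (for $u<0$, that of $Q_0$). $W_1(\mu,\nu)=\inf_\gamma\int \mathrm{dist}(x,y)\,d\gamma(x,y)$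 over couplings, where dist is the usual distance on $\mathbb{R}$ for laws on $\mathbb{N}$, and the sum of coordinatewise absolute differences on $\mathbb{N}^q$ and on $(\mathbb{N}^q)^j$. The array is locally stationary if for every integer $j\ge1$ there exists a metric $\vartheta_j$ on the set of probability measures on $(\mathbb{N}^q)^j$, metrizing the topology of weak convergence, such that (1) $u\mapsto\pi_{u,j}$ is continuous on $[0,1]$; (2) $\lim_{n\to\infty}\sup_{k\le n-j+1}\vartheta_j(\pi^{(n)}_{k,j},\pi_{k/n,j})=0$. Let $\Lambda_1(F)$ be the set of $1$-Lipschitz real functions on a metric space $F$, $\mathcal{F}^{(n)}_i=\sigma(\mathbf{X}_{n,j}:j\le i)$, $U(\mathcal{F}^{(n)}_i,Y)=\sup_{g\in\Lambda_1(\mathbb{R})}|\mathbb{E}[g(Y)\mid\mathcal{F}^{(n)}_i]-\mathbb{E}[g(Y)]|$, and $\tau_n(j)=\sup_{f\in\Lambda_1(\mathbb{N}^q)}\sup_{i\in\mathbb{Z}}\mathbb{E}[U(\mathcal{F}^{(n)}_i,f(\mathbf{X}_{n,i+j}))]$. *)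

(* Defs.v *)
From HB Require Import structures.
From mathcomp Require Import all_boot all_order all_algebra.
From mathcomp Require Import finmap.
From mathcomp Require Import all_classical all_reals all_analysis.
From mathcomp Require Import measurable_realfun giry.

Set Implicit Arguments.
Unset Strict Implicit.
Unset Printing Implicit Defensive.

Import Order.TTheory GRing.Theory Num.Theory.
Import numFieldNormedType.Exports.

Local Open Scope classical_set_scope.
Local Open Scope ring_scope.

Section discrete_spaces.

Lemma countable_discrete d (T : measurableType d) :
  countable [set: T] -> (forall x : T, measurable [set x]) ->
  forall A : set T, measurable A.
Proof.
move=> /countable_injP[g ginj] m1 A.
rewrite (_ : A = \bigcup_n [set x | A x /\ g x = n]); last first.
  by apply/seteqP; split=> [x Ax|x [n _ [Ax _]]//]; exists (g x).
apply: bigcup_measurable => n _.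
have [->|/set0P[x [Ax gx]]] := eqVneq [set x | A x /\ g x = n] set0.
  exact: measurable0.
rewrite (_ : [set y | A y /\ g y = n] = [set x]); first exact: m1.
apply/seteqP; split=> [y [Ay gy]|y ->] //=.
by apply: ginj; rewrite ?inE// gy gx.
Qed.

Lemma measurable_nat2 (A : set (nat * nat)) : measurable A.
Proof.
apply: countable_discrete => [|[x y]]; first exact: countableP.
rewrite (_ : [set (x, y)] = [set x] `*` [set y]); last first.
  by apply/seteqP; split=> [[a b] [-> ->]|[a b] /= [-> ->]].
exact: measurableX.
Qed.

Lemma measurable_tuple_discrete d (T : measurableType d) (q : nat) :
  countable [set: q.-tuple T] -> (forall A : set T, measurable A) ->
  forall A : set (q.-tuple T), measurable A.
Proof.
move=> cT mT; apply: countable_discrete => // t.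
rewrite (_ : [set t] = \big[setI/setT]_(i < q)
    ((fun s : q.-tuple T => tnth s i) @^-1` [set tnth t i])).
  apply: bigsetI_measurable => i _; rewrite -[X in measurable X]setTI.
  exact: measurable_tnth.
apply/seteqP; split=> [s ->|s].
  by rewrite -bigcap_seq => i _.
rewrite -bigcap_seq => h; apply: eq_from_tnth => i.
by apply: h; rewrite /= mem_index_enum.
Qed.

Lemma measurable_state q (A : set (q.-tuple nat)) : measurable A.
Proof. by apply: measurable_tuple_discrete => //; exact: countableP. Qed.

Lemma measurable_path q j (A : set (j.-tuple (q.-tuple nat))) : measurable A.
Proof.
by apply: measurable_tuple_discrete; [exact: countableP|exact: measurable_state].
Qed.

Lemma measurable_fun_discrete d d' (S : measurableType d)
    (T : measurableType d') (f : S -> T) :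
  (forall A : set S, measurable A) -> measurable_fun [set: S] f.
Proof. by move=> mS _ A _; exact: mS. Qed.

End discrete_spaces.

Section mixture.
Local Open Scope ereal_scope.
Context d d' (S : measurableType d) (T : measurableType d') (R : realType).
Context (mS : forall A : set S, measurable A).
Context (mu : probability S R) (K : S -> probability T R).

Definition mixture_fun (A : set T) : \bar R := \int[mu]_x K x A.

Let mixture0 : mixture_fun set0 = 0.
Proof. by rewrite /mixture_fun integral0_eq. Qed.

Let mixture_ge0 A : 0 <= mixture_fun A.
Proof. exact: integral_ge0. Qed.

Let mixture_sigma_additive : semi_sigma_additive mixture_fun.
Proof.
move=> F mF tF mUF.
rewrite [X in _ --> X](_ : _ = \sum_(n <oo) mixture_fun (F n)).
  by apply/cvg_closeP; split; [exact: is_cvg_nneseries|rewrite closeE].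
rewrite /mixture_fun -integral_nneseries//; last first.
  by move=> n; exact: measurable_fun_discrete.
apply: eq_integral => x _; apply/esym/cvg_lim => //=.
exact: measure_semi_sigma_additive.
Qed.

(* [mS] is a phantom argument so that the measure structure below can be
   found by unification. *)
Definition mixture_meas of (forall A : set S, measurable A) := mixture_fun.

HB.instance Definition _ := isMeasure.Build _ _ _ (mixture_meas mS)
  mixture0 mixture_ge0 mixture_sigma_additive.

Let mixture_setT : mixture_meas mS setT = 1.
Proof.
rewrite /mixture_meas /mixture_fun.
rewrite (eq_integral (cst 1)) => [|x _]; last exact: probability_setT.
by rewrite integral_cst// mul1e; exact: probability_setT.
Qed.

HB.instance Definition _ :=
  Measure_isProbability.Build _ _ _ (mixture_meas mS) mixture_setT.

Definition mixture : probability T R := mixture_meas mS.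

End mixture.

Section laws_on_nat.
Context (R : realType).

Definition add_pair (p : nat * nat) : nat := (p.1 + p.2)%N.

HB.instance Definition _ := isMeasurableFun.Build _ _ _ _ add_pair
  (measurable_fun_discrete add_pair measurable_nat2).

Definition conv (mu nu : probability nat R) : probability nat R :=
  distribution (mu \x nu)%E add_pair.

Definition delta0 : probability nat R := \d_(0%N : nat).

Definition mean (mu : probability nat R) : \bar R :=
  (\int[mu]_x (x%:R)%:E)%E.

End laws_on_nat.

Section wasserstein.
Context d (E : measurableType d) (R : realType) (dist : E -> E -> R).
Implicit Types mu nu : probability E R.

Definition coupling mu nu (g : probability (E * E)%type R) : Prop :=
  (forall A, measurable A -> g (fst @^-1` A) = mu A) /\
  (forall A, measurable A -> g (snd @^-1` A) = nu A).

Definition W1 mu nu : \bar R :=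
  ereal_inf [set (\int[g]_z (dist z.1 z.2)%:E)%E | g in coupling mu nu].

Definition bounded_continuous (f : E -> R) : Prop :=
  (exists M, forall x, `|f x| <= M) /\
  (forall x e, 0 < e -> exists2 r, 0 < r &
    forall y, dist x y < r -> `|f x - f y| < e).

Definition integrals mu : {ptws {f : E -> R | bounded_continuous f} -> R} :=
  fun f => (\int[mu]_x sval f x)%R.

Definition weak_convergence : topologicalType := initial_topology integrals.

(* Laws are compared on measurable sets: the values of a [probability] on
   other sets are irrelevant. *)
Definition is_metric (theta : probability E R -> probability E R -> R) : Prop :=
  [/\ forall mu nu, 0 <= theta mu nu,
      forall mu nu, theta mu nu = 0 <-> mu ≡μ nu,
      forall mu nu, theta mu nu = theta nu mu &
      forall mu nu la, theta mu la <= theta mu nu + theta nu la].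

Definition metrizes_weak (theta : probability E R -> probability E R -> R) :=
  forall (mu : weak_convergence) (U : set weak_convergence),
    nbhs mu U <-> exists2 e, 0 < e & [set nu | theta mu nu < e] `<=` U.

Definition lipschitz1 (f : E -> R) : Prop :=
  forall x y, `|f x - f y| <= dist x y.

End wasserstein.

Section distances.
Context (R : realType).

Definition dist_nat (x y : nat) : R := `|x%:R - y%:R|.

Definition dist_state q (x y : q.-tuple nat) : R :=
  \sum_(i < q) dist_nat (tnth x i) (tnth y i).

Definition dist_path j q (x y : j.-tuple (q.-tuple nat)) : R :=
  \sum_(s < j) dist_state (tnth x s) (tnth y s).

Definition dist_real (x y : R) : R := `|x - y|.

End distances.

Section markov_chains.
Context d (S : measurableType d) (R : realType).
Context (mS : forall A : set S, measurable A).
Context (K : S -> probability S R).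

Definition invariant_law (mu : probability S R) : Prop :=
  forall A, measurable A -> (\int[mu]_x K x A)%E = mu A.

Definition cons_path j (x : S) (t : j.-tuple S) : j.+1.-tuple S :=
  [tuple of x :: t].

Lemma measurable_cons_path j x : measurable_fun setT (@cons_path j x).
Proof. by apply: measurable_cons => //; exact: measurable_cst. Qed.

HB.instance Definition _ j x := isMeasurableFun.Build _ _ _ _
  (@cons_path j x) (@measurable_cons_path j x).

(* Law of the first [j] states of the chain with initial law [mu] and
   kernel [K]. *)
Fixpoint chain_law (mu : probability S R) (j : nat) :
    probability (j.-tuple S) R :=
  match j with
  | 0 => \d_([tuple] : 0.-tuple S)
  | j'.+1 => mixture mS mu (fun x =>
      distribution (chain_law (K x) j') (@cons_path j' x))
  end.

End markov_chains.

Section inar_kernel.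
Context (R : realType) (q : nat).

(* [zeta j u] is used for 1 <= j <= q + 1 and 0 <= u <= 1 only; index q + 1 is
   the law of the immigration. *)
Context (zeta : nat -> R -> probability nat R).

Definition frozen (u : R) : R := Num.max 0 u.

(* The coordinates x_1, ..., x_q of a state [x] are [nth 0 x 0], ...,
   [nth 0 x q.-1]; hence x_(q - j + 1) is [nth 0 x (q - j)]. *)
Definition S_law (u : R) (x : q.-tuple nat) : probability nat R :=
  conv (\big[@conv R / delta0 R]_(1 <= j < q.+1)
          iter (nth 0%N x (q - j)) (conv (zeta j (frozen u))) (delta0 R))
       (zeta q.+1 (frozen u)).

(* (x_1, ..., x_q) and y give (x_2, ..., x_q, y): [behead x] has q - 1 entries,
   so the default value y is read exactly at the last position. *)
Definition shift_in (x : q.-tuple nat) (y : nat) : q.-tuple nat :=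
  [tuple nth y (behead x) i | i < q].

HB.instance Definition _ x := isMeasurableFun.Build _ _ _ _ (shift_in x)
  (measurable_fun_discrete (shift_in x) (fun _ => I)).

Definition Q_kernel (u : R) (x : q.-tuple nat) : probability (q.-tuple nat) R :=
  distribution (S_law u x) (shift_in x).

Definition stationary_law (pi : R -> probability (q.-tuple nat) R) (u : R)
    (j : nat) : probability (j.-tuple (q.-tuple nat)) R :=
  chain_law (@measurable_state q) (Q_kernel u) (pi (frozen u)) j.

End inar_kernel.

Section independence.
Context d (T : measurableType d) (R : realType) (P : probability T R).

Definition mutually_independent (I : choiceType) (D : set I)
    (V : I -> T -> nat) : Prop :=
  forall (J : {fset I}) (B : I -> set nat), [set` J] `<=` D ->
    P (\bigcap_(a in [set` J]) (V a @^-1` B a)) =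
    (\prod_(a <- J) P (V a @^-1` B a))%E.

Definition independent_sigma (F G : set (set T)) : Prop :=
  forall A B, F A -> G B -> P (A `&` B) = (P A * P B)%E.

Definition sigma_gen (I : Type) d' (E : measurableType d') (D : set I)
    (V : I -> T -> E) : set (set T) :=
  <<s \bigcup_(a in D) preimage_set_system setT (V a) measurable >>.

End independence.

Section conditional_expectation.
Context d (T : measurableType d) (R : realType) (P : probability T R).

Definition cond_exp_version (G : set (set T)) (Z : T -> R)
    (W : T -> \bar R) : Prop :=
  [/\ P.-integrable setT W,
      forall B, measurable B -> G (W @^-1` B) &
      forall A, G A -> (\int[P]_(w in A) W w = \int[P]_(w in A) (Z w)%:E)%E].

(* A chosen version of E[Z | G]; the default value +oo only occurs when there is
   none. *)
Definition cond_exp (G : set (set T)) (Z : T -> R) : T -> \bar R :=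
  xget (cst +oo%E) (cond_exp_version G Z).

Definition is_ess_sup (Zs : set (T -> \bar R)) (U : T -> \bar R) : Prop :=
  [/\ measurable_fun setT U,
      forall Z, Zs Z -> {ae P, forall w, (Z w <= U w)%E} &
      forall V, measurable_fun setT V ->
        (forall Z, Zs Z -> {ae P, forall w, (Z w <= V w)%E}) ->
        {ae P, forall w, (U w <= V w)%E}].

(* Supremum of a possibly uncountable family of random variables, each of which
   is defined up to a null set. *)
Definition ess_sup_family (Zs : set (T -> \bar R)) : T -> \bar R :=
  xget (cst +oo%E) (is_ess_sup Zs).

Definition dependence (G : set (set T)) (Y : T -> R) : T -> \bar R :=
  ess_sup_family
    [set (fun w => `|cond_exp G (g \o Y) w - 'E_P[g \o Y]|%E)
       | g in lipschitz1 (@dist_real R)].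

End conditional_expectation.

Section arrays.
Context d (T : measurableType d) (R : realType) (P : probability T R) (q : nat).
Context (X : nat -> int -> {RV P >-> nat}) (c : q.-tuple nat).

Definition state (n : nat) (k : int) (w : T) : q.-tuple nat :=
  if k <= n%:Z then [tuple X n (k - q%:Z + 1 + (i : nat)%:Z) w | i < q] else c.

Lemma measurable_fun_state n k : measurable_fun setT (state n k).
Proof.
rewrite /state; case: (k <= n%:Z); last exact: measurable_cst.
apply/measurable_fun_tnthP => i.
apply: (eq_measurable_fun (X n (k - q%:Z + 1 + (i : nat)%:Z))) => [w _|].
  by rewrite /= tnth_mktuple.
exact: measurable_funP.
Qed.

HB.instance Definition _ n k := isMeasurableFun.Build _ _ _ _ (state n k)
  (@measurable_fun_state n k).

Definition block (n : nat) (k : int) (j : nat) (w : T) :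
    j.-tuple (q.-tuple nat) :=
  [tuple state n (k + (s : nat)%:Z) w | s < j].

Lemma measurable_fun_block n k j : measurable_fun setT (@block n k j).
Proof.
apply/measurable_fun_tnthP => s.
apply: (eq_measurable_fun (state n (k + (s : nat)%:Z))) => [w _|].
  by rewrite /= tnth_mktuple.
exact: measurable_fun_state.
Qed.

HB.instance Definition _ n k j := isMeasurableFun.Build _ _ _ _ (@block n k j)
  (@measurable_fun_block n k j).

Definition block_law (n : nat) (k : int) (j : nat) :
    probability (j.-tuple (q.-tuple nat)) R :=
  distribution P (@block n k j).

Definition past (n : nat) (i : int) : set (set T) :=
  sigma_gen [set l : int | l <= i] (state n).

Definition tau (n j : nat) : \bar R :=
  ereal_sup [set x | exists (f : q.-tuple nat -> R) (i : int),
    lipschitz1 (@dist_state R q) f /\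
    x = (\int[P]_w
           dependence P (past n i) (f \o state n (i + j%:Z)) w)%E].

End arrays.

Section inar_array.
Context d (T : measurableType d) (R : realType) (P : probability T R) (q : nat).
Context (zeta : nat -> R -> probability nat R)
  (pi0 : probability (q.-tuple nat) R).
Context (X : nat -> int -> {RV P >-> nat})
  (Y : nat -> int -> nat -> nat -> {RV P >-> nat})
  (eta : nat -> int -> {RV P >-> nat}) (c : q.-tuple nat).

Definition time (n : nat) (k : int) : R := k%:~R / n%:R.

(* Index [(k, Some (j, i))] stands for Y^(n,k)_(j,i), and [(k, None)] for
   eta^(n)_k. *)
Definition noise (n : nat) (a : int * option (nat * nat)) : T -> nat :=
  match a.2 with
  | Some ji => Y n a.1 ji.1 ji.2
  | None => eta n a.1
  end.

Definition noise_index (a : int * option (nat * nat)) : Prop :=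
  match a.2 with
  | Some ji => (1 <= ji.1 <= q)%N /\ (1 <= ji.2)%N
  | None => True
  end.

Record tv_inar : Prop := TvInar {
  noise_indep : forall n, (0 < n)%N ->
    mutually_independent P [set a | a.1 <= n%:Z /\ noise_index a] (noise n);
  Y_law : forall n k j i, (0 < n)%N -> k <= n%:Z -> (1 <= j <= q)%N ->
    (1 <= i)%N -> distribution P (Y n k j i) ≡μ zeta j (frozen (time n k));
  eta_law : forall n k, (0 < n)%N -> k <= n%:Z ->
    distribution P (eta n k) ≡μ zeta q.+1 (frozen (time n k));
  noise_indep_past : forall n (k : int), (0 < n)%N -> k <= n%:Z ->
    independent_sigma P
      (sigma_gen [set a | a.1 = k /\ noise_index a] (noise n))
      (sigma_gen [set l : int | l < k] (fun l => X n l : T -> nat));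
  inar_rec : forall n k, (0 < n)%N -> k <= n%:Z ->
    {ae P, forall w, X n k w =
      (\sum_(1 <= j < q.+1) \sum_(1 <= i < (X n (k - j%:Z) w).+1) Y n k j i w
       + eta n k w)%N};
  stationary_start : forall n (k : int) j, (0 < n)%N -> k + j%:Z - 1 <= 0 ->
    block_law X c n k j ≡μ
      chain_law (@measurable_state q) (@Q_kernel R q zeta 0) pi0 j }.

End inar_array.

Section local_stationarity.
Context (R : realType) (q : nat).

Definition locally_stationary
    (pin : nat -> int -> forall j : nat, probability (j.-tuple (q.-tuple nat)) R)
    (pis : R -> forall j : nat, probability (j.-tuple (q.-tuple nat)) R) : Prop :=
  forall j : nat, (0 < j)%N ->
  exists theta : probability (j.-tuple (q.-tuple nat)) R ->
                 probability (j.-tuple (q.-tuple nat)) R -> R,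
  [/\ is_metric theta,
      metrizes_weak (@dist_path R j q) theta,
      {within `[0, 1]%classic,
        continuous (fun u : R => pis u j : weak_convergence (@dist_path R j q))} &
      ereal_sup [set (theta (pin n k j) (pis (time R n k) j))%:E
                   | k in [set k : int | k <= n%:Z - j%:Z + 1]]
        @[n --> \oo] --> 0%E].

End local_stationarity.

(* Main.v *)
Require Import Defs.
From HB Require Import structures.
From mathcomp Require Import all_boot all_order all_algebra.
From mathcomp Require Import finmap.
From mathcomp Require Import all_classical all_reals all_analysis.
From mathcomp Require Import measurable_realfun giry.
From mathcomp Require Import ring lra zify.

Set Implicit Arguments.
Unset Strict Implicit.
Unset Printing Implicit Defensive.

Import Order.TTheory GRing.Theory Num.Theory.
Import numFieldNormedType.Exports.

Local Open Scope classical_set_scope.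
Local Open Scope ring_scope.

(* Two copies of the chain started at different states are coupled through optimal
   couplings of the offspring and immigration laws. If e_k denotes the expected
   distance of the last coordinates at time k, then e_k is at most
   sum_j alpha_j e_(k-j) plus the distance of the parameters, whose weight is
   controlled by the uniformly bounded first moments. Since the sum of the alpha_j
   stays below 1, differences of initial laws are forgotten geometrically. This
   yields a Cauchy sequence whose limit is the invariant law, its uniqueness, and
   its Hoelder continuity in u. Comparing the array, whose parameters at times
   k, k - 1, k - 2, ... differ from u by at most |u - k/n| + i/n after i steps back,
   with the stationary chain with parameter u gives the bound on the marginals;
   running both chains for j further steps gives the bound on paths.
   Conditionally on the past up to time i, X_(n,i+j) has the law of the chain run
   for j steps from X_(n,i), which by contraction depends on X_(n,i) only up to
   a factor rho^j: this bounds tau_n(j). Local stationarity follows from the bound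
   on paths, because total variation is dominated by W_1 on a discrete space. *)

(** * Measures on countable spaces *)

(** A bound on an infimum does not provide an optimal coupling; near-optimal ones are used instead,
    at the price of doubling the Hoelder constant. All state and path spaces are countable with
    every subset measurable: integrals are countable series, couplings chosen separately for each
    pair of states glue without measurable selection, and conditioning reduces to events of the form
    state = x. A step of the chain renews a single coordinate, so the distance of states need not
    decrease in one step; the recursion of lag q still contracts, up to a factor 1 / rho^q. The
    inequality (p/n)^kappa <= p / n^kappa makes the parameter mismatch affine in the number p of
    steps back, and the geometric weights sum it to order 1 / n^kappa. Uniqueness must cover
    invariant laws without moments, out of reach of a contraction in W_1: there the convergence from
    each fixed state is integrated by dominated convergence. *)

Section discrete_integrals.
Local Open Scope ereal_scope.

Definition discrete d (S : measurableType d) : Prop :=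
  countable [set: S] /\ forall A : set S, measurable A.

Lemma discrete_nat : discrete nat.
Proof. by split => //; exact: countableP. Qed.

Lemma discrete_state q : discrete (q.-tuple nat).
Proof. by split; [exact: countableP|exact: measurable_state]. Qed.

Lemma discrete_path j q : discrete (j.-tuple (q.-tuple nat)).
Proof. by split; [exact: countableP|exact: measurable_path]. Qed.

Lemma discrete_pair d d' (S : measurableType d) (T : measurableType d') :
  discrete S -> discrete T -> discrete (S * T)%type.
Proof.
move=> [cS mS] [cT mT].
have cST : countable [set: S * T].
  by rewrite -setXTT; exact: countableX.
split=> //; apply: countable_discrete => // -[x y].
rewrite (_ : [set (x, y)] = [set x] `*` [set y]); last first.
  by apply/seteqP; split=> [[a b] [-> ->]|[a b] /= [-> ->]].
exact: measurableX.
Qed.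

Context (R : realType).

(** The pieces are the fibres of an injection into [nat], each empty or a singleton; an empty fibre
    gets coefficient 0. They are fixed before [f] and [mu], so a truncation index chosen for one
    measure serves all functions and all measures. *)
Lemma discrete_enumeration d (S : measurableType d) : discrete S ->
  exists F : nat -> set S, [/\ trivIset setT F, \bigcup_n F n = setT &
    forall f : S -> \bar R, (forall x, 0 <= f x) ->
    exists c : nat -> \bar R, [/\ forall n, 0 <= c n,
      forall n, c n = 0 \/ exists x, c n = f x &
      forall mu : {measure set S -> \bar R},
        \int[mu]_x f x = \sum_(n <oo) c n * mu (F n)]].
Proof.
move=> [/countable_injP[g ginj] mS]; pose F n := [set x | g x = n].
have tF : trivIset setT F.
  by move=> i j _ _ [x [/= gi gj]]; rewrite -gi -gj.
have UF : \bigcup_n F n = setT.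
  by apply/seteqP; split => // x _; exists (g x).
exists F; split => // f f0.
pose c n := if pselect (exists x, g x = n) is left h then f (projT1 (cid h)) else 0.
exists c; split => [n|n|mu].
- by rewrite /c; case: pselect.
- by rewrite /c; case: pselect => [h|_]; [right; eexists|left].
rewrite -UF ge0_integral_bigcup//.
apply: eq_eseriesr => n _.
rewrite -integral_cst; last exact: mS.
apply: eq_integral => x; rewrite inE /F /= => gx.
rewrite /c; case: pselect => [h|[]]; last by exists x.
by congr f; apply: ginj; rewrite ?inE// (projT2 (cid h)).
Qed.

Lemma discrete_integral_series d (S : measurableType d) (f : S -> \bar R) :
  discrete S -> (forall x, 0 <= f x) ->
  exists (c : nat -> \bar R) (F : nat -> set S), [/\ forall n, 0 <= c n,
    forall n, c n = 0 \/ exists x, c n = f x &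
    forall mu : {measure set S -> \bar R},
      \int[mu]_x f x = \sum_(n <oo) c n * mu (F n)].
Proof.
by move=> /discrete_enumeration[F [_ _ Ff]] /Ff[c ?]; exists c, F.
Qed.

Lemma discrete_ge0_integralD d (S : measurableType d)
    (mu : {measure set S -> \bar R}) (f g : S -> \bar R) :
  discrete S -> (forall x, 0 <= f x) -> (forall x, 0 <= g x) ->
  \int[mu]_x (f x + g x) = \int[mu]_x f x + \int[mu]_x g x.
Proof.
by move=> [_ mS] f0 g0; rewrite ge0_integralD//; exact: measurable_fun_discrete.
Qed.

Lemma discrete_ge0_le_integral d (S : measurableType d)
    (mu : {measure set S -> \bar R}) (f g : S -> \bar R) :
  discrete S -> (forall x, 0 <= f x) -> (forall x, f x <= g x) ->
  \int[mu]_x f x <= \int[mu]_x g x.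
Proof.
move=> [_ mS] f0 fg; apply: ge0_le_integral => //; try exact: measurable_fun_discrete.
Qed.

(** Holds for indicators by hypothesis and passes to [f] through its series, sum and integral being
    exchanged by nonnegativity. [nu] is any measure, so that it can be a law restricted to an
    event. *)
Lemma integral_disintegration d d0 (T : measurableType d0)
    (S : measurableType d) (m : {measure set T -> \bar R}) (D : set T)
    (nu : {measure set S -> \bar R}) (K : T -> {measure set S -> \bar R})
    (f : S -> \bar R) :
  discrete S -> measurable D ->
  (forall B, measurable_fun D (fun w => K w B)) ->
  (forall B, nu B = \int[m]_(w in D) K w B) ->
  (forall x, 0 <= f x) ->
  \int[nu]_x f x = \int[m]_(w in D) \int[K w]_x f x.
Proof.
move=> dS mD mK nuE f0.
have [c [F [c0 _ fE]]] := discrete_integral_series dS f0.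
rewrite fE.
under [RHS]eq_integral do rewrite fE.
rewrite integral_nneseries//; last first.
- by move=> n w _; rewrite mule_ge0.
- by move=> n; apply: emeasurable_funM => //; exact: measurable_cst.
by apply: eq_eseriesr => n _; rewrite nuE -ge0_integralZl.
Qed.

Lemma integral_mixture d d' (S : measurableType d) (T : measurableType d')
    (mS : forall A : set S, measurable A) (mu : probability S R)
    (K : S -> probability T R) (f : T -> \bar R) :
  discrete T -> (forall x, 0 <= f x) ->
  \int[mixture mS mu K]_y f y = \int[mu]_x \int[K x]_y f y.
Proof.
move=> dT f0.
apply: (integral_disintegration (K := fun x => K x)) => // B.
exact: measurable_fun_discrete.
Qed.

(** The proof argument is a phantom, the key under which the measurable-function structure is found:
    any map from a discrete space can then be used to take image laws. *)
Definition dfun d d' (S : measurableType d) (T : measurableType d')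
  of (forall A : set S, measurable A) := fun f : S -> T => f.

HB.instance Definition _ d d' (S : measurableType d) (T : measurableType d')
    (mS : forall A : set S, measurable A) (f : S -> T) :=
  isMeasurableFun.Build _ _ _ _ (dfun mS f) (measurable_fun_discrete f mS).

Lemma integral_law d d' (S : measurableType d) (T : measurableType d')
    (P : probability S R) (X : {mfun S >-> T}) (f : T -> \bar R) :
  discrete T -> (forall x, 0 <= f x) ->
  \int[distribution P X]_y f y = \int[P]_x f (X x).
Proof.
by move=> [_ mT] f0; rewrite (ge0_integral_distribution X).
Qed.

Lemma integral_eq_measure d (S : measurableType d)
    (mu nu : {measure set S -> \bar R}) (f : S -> \bar R) :
  (forall A, measurable A -> mu A = nu A) -> \int[mu]_x f x = \int[nu]_x f x.
Proof. by move=> h; apply: eq_measure_integral => A mA _; exact: h. Qed.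

Lemma integral_diracT d (S : measurableType d) (f : S -> \bar R) (a : S) :
  discrete S -> \int[\d_a]_x f x = f a.
Proof.
move=> [_ mS]; rewrite integral_dirac//.
by rewrite diracT mul1e.
Qed.

(** Fatou's lemma for setwise convergence: a partial sum of the series converges term by term and
    stays below the full integral. Finite values of [f] let each coefficient pass through the
    limit. *)
Lemma integral_liminf d (S : measurableType d)
    (mu : nat -> probability S R) (nu : probability S R) (f : S -> \bar R)
    (b : nat -> \bar R) (B : \bar R) :
  discrete S -> (forall x, 0 <= f x) ->
  (forall A, (fun n => mu n A) @ \oo --> nu A) ->
  (forall n, \int[mu n]_x f x <= b n) -> b @ \oo --> B ->
  (forall x, f x \is a fin_num) ->
  \int[nu]_x f x <= B.
Proof.
move=> dS f0 munu fb bB ffin.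
have [c [F [c0 cf fE]]] := discrete_integral_series dS f0.
have cfin n : c n \is a fin_num by case: (cf n) => [->|[x ->]].
rewrite fE; apply: lime_le; first by apply: is_cvg_nneseries => *; rewrite mule_ge0.
apply: nearW => N.
have h : (fun k => \sum_(0 <= i < N) c i * mu k (F i)) @ \oo -->
    \sum_(0 <= i < N) c i * nu (F i).
  apply: cvg_nnesum => [i _|i _]; first by apply: nearW => k; rewrite mule_ge0.
  by apply: cvgeZl => //; exact: munu.
apply: (lee_cvg_to h bB); apply: nearW => k.
rewrite (le_trans _ (fb k))// fE; apply: nneseries_lim_ge => i _.
by rewrite mule_ge0.
Qed.

End discrete_integrals.

(** * Couplings and transport cost *)

Section couplings.
Local Open Scope ereal_scope.
Context (R : realType).

Lemma integral_probability_cst d (E : measurableType d)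
  (mu : probability E R) (c : \bar R) : \int[mu]_x c = c.
Proof. rewrite integral_cst// -[RHS]mule1; congr (_ * _); exact: probability_setT. Qed.

Lemma coupling_fst d (E : measurableType d) (mu nu : probability E R)
    (g : probability (E * E)%type R) (f : E -> \bar R) :
  discrete E -> coupling mu nu g -> (forall x, 0 <= f x) ->
  \int[g]_z f z.1 = \int[mu]_x f x.
Proof.
move=> dE [g1 _] f0; have [_ mEE] := discrete_pair dE dE.
rewrite -(integral_law g (dfun mEE fst) dE f0).
by apply: integral_eq_measure => A mA; exact: g1.
Qed.

Lemma coupling_snd d (E : measurableType d) (mu nu : probability E R)
    (g : probability (E * E)%type R) (f : E -> \bar R) :
  discrete E -> coupling mu nu g -> (forall x, 0 <= f x) ->
  \int[g]_z f z.2 = \int[nu]_x f x.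
Proof.
move=> dE [_ g2] f0; have [_ mEE] := discrete_pair dE dE.
rewrite -(integral_law g (dfun mEE snd) dE f0).
by apply: integral_eq_measure => A mA; exact: g2.
Qed.

(** The couplings [G z] may be picked arbitrarily, one for each pair: on a discrete space every
    family of laws is a kernel. *)
Lemma coupling_mixture d d' (S : measurableType d) (E : measurableType d')
    (mS : forall A : set S, measurable A)
    (mSS : forall A : set (S * S), measurable A)
    (mu nu : probability S R) (g : probability (S * S)%type R)
    (K L : S -> probability E R) (G : S * S -> probability (E * E)%type R) :
  discrete S -> coupling mu nu g ->
  (forall z, coupling (K z.1) (L z.2) (G z)) ->
  coupling (mixture mS mu K) (mixture mS nu L) (mixture mSS g G).
Proof.
move=> dS cg cG; split=> A mA.
  transitivity (\int[g]_z K z.1 A).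
    by apply: eq_integral => z _; exact: (cG z).1.
  by rewrite (coupling_fst (f := fun x => K x A) dS cg).
transitivity (\int[g]_z L z.2 A).
  by apply: eq_integral => z _; exact: (cG z).2.
by rewrite (coupling_snd (f := fun x => L x A) dS cg).
Qed.

Lemma coupling_image d d' (S : measurableType d) (E : measurableType d')
    (mSS : forall A : set (S * S), measurable A)
    (mu nu : probability S R) (g : probability (S * S)%type R)
    (X Y : {mfun S >-> E}) :
  coupling mu nu g ->
  coupling (distribution mu X) (distribution nu Y)
    (distribution g (dfun mSS (fun z => (X z.1, Y z.2)))).
Proof.
move=> [g1 g2]; split=> A mA.
  apply: (g1 (X @^-1` A)).
  by rewrite -[X in measurable X]setTI; exact: measurable_funP.
apply: (g2 (Y @^-1` A)).
by rewrite -[X in measurable X]setTI; exact: measurable_funP.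
Qed.

Lemma coupling_eq d (E : measurableType d) (mu nu mu' nu' : probability E R)
    (g : probability (E * E)%type R) :
  (forall A, measurable A -> mu A = mu' A) ->
  (forall A, measurable A -> nu A = nu' A) ->
  coupling mu nu g -> coupling mu' nu' g.
Proof. by move=> h1 h2 [g1 g2]; split=> A mA; [rewrite g1 ?h1|rewrite g2 ?h2]. Qed.

Lemma coupling_diag d (E : measurableType d)
    (mE : forall A : set E, measurable A) (mu : probability E R) :
  coupling mu mu (distribution mu (dfun mE (fun x => (x, x)))).
Proof. by split. Qed.

Lemma coupling_independent d (E : measurableType d)
    (mE : forall A : set E, measurable A) (mu nu : probability E R) :
  coupling mu nu (mixture mE mu (fun x => distribution nu (dfun mE (pair x)))).
Proof.
split=> A mA.
  transitivity (\int[mu]_x (\1_A x)%:E); last by rewrite integral_indic// setIT.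
  apply: eq_integral => x _.
  transitivity (nu [set y | A x]) => //; rewrite /indic.
  have [xA|xA] := boolP (x \in A).
    rewrite (_ : [set _ | _] = setT); first by rewrite probability_setT.
    by apply/seteqP; split=> // y _; exact/set_mem.
  rewrite (_ : [set _ | _] = set0).
  by rewrite measure0.
  by apply/seteqP; split=> // y /= Ax; rewrite mem_set in xA.
transitivity (\int[mu]_x nu A); first exact: eq_integral.
exact: integral_probability_cst.
Qed.

(** A bound certified by an actual coupling: unlike a bound on [W1], it composes without handling
    the infimum. It implies [W1 <= c] and follows from [W1 < c]. *)
Definition coupled d (E : measurableType d) (dist : E -> E -> R)
    (mu nu : probability E R) (c : R) : Prop :=
  exists2 g, coupling mu nu g & \int[g]_z (dist z.1 z.2)%:E <= c%:E.

Lemma coupled_W1 d (E : measurableType d) (dist : E -> E -> R)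
    (mu nu : probability E R) (c : R) :
  coupled dist mu nu c -> W1 dist mu nu <= c%:E.
Proof.
by move=> [g cg gc]; apply: le_trans gc; apply: ereal_inf_lbound; exists g.
Qed.

Lemma W1_coupled d (E : measurableType d) (dist : E -> E -> R)
    (mu nu : probability E R) (c : R) :
  W1 dist mu nu < c%:E -> coupled dist mu nu c.
Proof.
by move=> /ereal_inf_lt[_ [g cg <-]] gc; exists g => //; exact: ltW.
Qed.

Lemma coupled_le d (E : measurableType d) (dist : E -> E -> R)
    (mu nu : probability E R) (c c' : R) :
  (c <= c')%R -> coupled dist mu nu c -> coupled dist mu nu c'.
Proof.
by move=> cc' [g cg gc]; exists g => //; apply: le_trans gc _; rewrite lee_fin.
Qed.

Lemma coupled_eq d (E : measurableType d) (dist : E -> E -> R)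
    (mu nu mu' nu' : probability E R) (c : R) :
  (forall A, measurable A -> mu A = mu' A) ->
  (forall A, measurable A -> nu A = nu' A) ->
  coupled dist mu nu c -> coupled dist mu' nu' c.
Proof. by move=> h1 h2 [g cg gc]; exists g => //; exact: coupling_eq cg. Qed.

Lemma coupled_refl d (E : measurableType d) (dist : E -> E -> R)
    (mu : probability E R) :
  discrete E -> (forall x y, 0 <= dist x y)%R -> (forall x, dist x x = 0)%R ->
  coupled dist mu mu 0.
Proof.
move=> dE d0 dxx; exists (distribution mu (dfun dE.2 (fun x => (x, x)))).
  exact: coupling_diag.
rewrite (integral_law _ _ (f := fun z => (dist z.1 z.2)%:E))//.
- by rewrite integral0_eq// => x _ /=; rewrite /dfun/= dxx.
- exact: discrete_pair.
- by move=> z; rewrite lee_fin.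
Qed.

Lemma coupled_sym d (E : measurableType d) (dist : E -> E -> R)
    (mu nu : probability E R) (c : R) :
  discrete E -> (forall x y, 0 <= dist x y)%R ->
  (forall x y, dist x y = dist y x) ->
  coupled dist mu nu c -> coupled dist nu mu c.
Proof.
move=> dE d0 dC [g [g1 g2] gc]; have [cEE mEE] := discrete_pair dE dE.
exists (distribution g (dfun mEE (fun z => (z.2, z.1)))).
  by split=> A mA; [exact: g2|exact: g1].
rewrite (integral_law _ _ (f := fun z => (dist z.1 z.2)%:E))//; last first.
  by move=> z; rewrite lee_fin.
by apply: le_trans gc; under eq_integral do rewrite dC.
Qed.

End couplings.

(** * Couplings of convolutions on the integers *)

Section convolution.
Local Open Scope ereal_scope.
Context (R : realType).

Local Notation distn := (@dist_nat R).
Local Notation mN := discrete_nat.2.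
Local Notation mNN := (discrete_pair discrete_nat discrete_nat).2.

Lemma dist_nat_ge0 x y : (0 <= distn x y)%R. Proof. exact: normr_ge0. Qed.

Lemma dist_natC x y : distn x y = distn y x. Proof. exact: distrC. Qed.

(** Turns the image of a product law into a mixture, the form to which the gluing of couplings
    applies. *)
Lemma convE (mu nu : probability nat R) A :
  Defs.conv mu nu A = mixture mN mu (fun a => distribution nu (dfun mN (addn a))) A.
Proof.
apply: eq_integral => a _ /=; congr (nu _).
by apply/seteqP; split=> b /=; rewrite /xsection/= inE.
Qed.

Lemma integral_conv (mu nu : probability nat R) (f : nat -> \bar R) :
  (forall x, 0 <= f x) ->
  \int[Defs.conv mu nu]_s f s = \int[mu]_a \int[nu]_b f (a + b)%N.
Proof.
move=> f0; rewrite (integral_eq_measure _ (fun A _ => convE mu nu A)).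
rewrite integral_mixture//; last exact: discrete_nat.
by apply: eq_integral => a _; rewrite integral_law//; exact: discrete_nat.
Qed.

Lemma coupled_conv (mu1 nu1 mu2 nu2 : probability nat R) (c1 c2 : R) :
  coupled distn mu1 nu1 c1 -> coupled distn mu2 nu2 c2 ->
  coupled distn (Defs.conv mu1 mu2) (Defs.conv nu1 nu2) (c1 + c2).
Proof.
move=> [g1 cg1 gc1] [g2 cg2 gc2].
have dN := discrete_nat; have dNN := discrete_pair dN dN.
pose G (z : nat * nat) := distribution g2
  (dfun mNN (fun w => (dfun mN (addn z.1) w.1, dfun mN (addn z.2) w.2))).
apply: (coupled_eq (fun A _ => esym (convE mu1 mu2 A))
                   (fun A _ => esym (convE nu1 nu2 A))).
exists (mixture mNN g1 G).
  by apply: coupling_mixture => // z; exact: coupling_image.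
rewrite (integral_mixture _ _ _ (f := fun z => (distn z.1 z.2)%:E))//; last first.
  by move=> z; rewrite lee_fin dist_nat_ge0.
apply: (@le_trans _ _ (\int[g1]_z ((distn z.1 z.2)%:E + c2%:E))); last first.
  rewrite discrete_ge0_integralD//.
  - by rewrite integral_probability_cst EFinD leeD2r.
  - by move=> z; rewrite lee_fin dist_nat_ge0.
  - move=> _; apply: le_trans gc2; apply: integral_ge0 => z _.
    by rewrite lee_fin dist_nat_ge0.
apply: discrete_ge0_le_integral => // z.
  by apply: integral_ge0 => w _; rewrite lee_fin dist_nat_ge0.
rewrite (integral_law _ _ (f := fun z => (distn z.1 z.2)%:E))//; last first.
  by move=> w; rewrite lee_fin dist_nat_ge0.
apply: (@le_trans _ _ (\int[g2]_w ((distn z.1 z.2)%:E + (distn w.1 w.2)%:E))).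
  apply: discrete_ge0_le_integral => // w; first by rewrite lee_fin dist_nat_ge0.
  rewrite -EFinD lee_fin /dfun /dist_nat /= !natrD opprD addrACA.
  exact: ler_normD.
rewrite discrete_ge0_integralD//; try by move=> w; rewrite lee_fin dist_nat_ge0.
by rewrite integral_probability_cst leeD2l.
Qed.

Lemma integral_delta0 (f : nat -> \bar R) : \int[delta0 R]_x f x = f 0%N.
Proof. exact: integral_diracT discrete_nat. Qed.

Lemma conv0 (mu : probability nat R) A : Defs.conv (delta0 R) mu A = mu A.
Proof.
by rewrite convE; exact: integral_delta0.
Qed.

Lemma mean_ge0 (mu : probability nat R) : 0 <= mean mu.
Proof. by apply: integral_ge0 => x _; rewrite lee_fin. Qed.

Lemma mean_conv (mu nu : probability nat R) :
  mean (Defs.conv mu nu) = mean mu + mean nu.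
Proof.
rewrite /mean integral_conv; last by move=> x; rewrite lee_fin.
have dN := discrete_nat.
transitivity (\int[mu]_a ((a%:R)%:E + mean nu)).
  apply: eq_integral => a _.
  under eq_integral do rewrite natrD EFinD.
  rewrite discrete_ge0_integralD//; try by move=> w; rewrite lee_fin.
  by rewrite integral_probability_cst.
rewrite discrete_ge0_integralD//; try by move=> w; rewrite ?lee_fin// mean_ge0.
by rewrite integral_probability_cst.
Qed.

Lemma mean_delta0 : mean (delta0 R) = 0.
Proof. exact: integral_delta0. Qed.

Lemma mean_iter_conv n (mu nu : probability nat R) :
  mean (iter n (Defs.conv mu) nu) = n%:R%:E * mean mu + mean nu.
Proof.
elim: n => [|n IH] /=; first by rewrite mul0e add0e.
rewrite mean_conv IH -natr1 EFinD ge0_muleDl ?lee_fin// mul1e.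
by rewrite addeCA addeA.
Qed.

Lemma mean_big_conv (r : seq nat) (F : nat -> probability nat R) :
  mean (\big[@Defs.conv R/delta0 R]_(j <- r) F j) = \sum_(j <- r) mean (F j).
Proof.
elim: r => [|j r IH]; first by rewrite !big_nil mean_delta0.
by rewrite !big_cons mean_conv IH.
Qed.

Lemma coupled_mean (mu nu : probability nat R) (c : R) :
  coupled distn mu nu c -> mean nu <= mean mu + c%:E.
Proof.
have dN := discrete_nat; have dNN := discrete_pair dN dN.
move=> [g cg gc]; have f0 (x : nat) : 0 <= (x%:R : R)%:E by rewrite lee_fin.
rewrite /mean -(coupling_snd dN cg f0) -(coupling_fst dN cg f0).
apply: (@le_trans _ _ (\int[g]_z ((z.1%:R)%:E + (distn z.1 z.2)%:E))); last first.
  rewrite discrete_ge0_integralD//; first by rewrite leeD2l.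
  by move=> w; rewrite lee_fin dist_nat_ge0.
apply: discrete_ge0_le_integral => // z; rewrite -EFinD lee_fin -lerBlDl.
by rewrite (le_trans (ler_norm _))// distrC.
Qed.

Lemma coupled_delta0 (mu : probability nat R) (a : R) :
  mean mu <= a%:E -> coupled distn mu (delta0 R) a.
Proof.
have dN := discrete_nat; have dNN := discrete_pair dN dN.
move=> ma; eexists; first exact: (coupling_independent mN).
rewrite integral_mixture//; last by move=> z; rewrite lee_fin dist_nat_ge0.
apply: le_trans ma; apply: discrete_ge0_le_integral => // x.
  by apply: integral_ge0 => z _; rewrite lee_fin dist_nat_ge0.
rewrite (integral_law _ _ (f := fun z => (distn z.1 z.2)%:E))//; last first.
  by move=> z; rewrite lee_fin dist_nat_ge0.
by rewrite integral_delta0 lee_fin /dist_nat /dfun /= subr0 ger0_norm.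
Qed.

Lemma coupled_iter_conv n (mu nu m1 m2 : probability nat R) (a c : R) :
  coupled distn mu nu a -> coupled distn m1 m2 c ->
  coupled distn (iter n (Defs.conv mu) m1) (iter n (Defs.conv nu) m2) (n%:R * a + c).
Proof.
move=> ca cc; elim: n => [|n IH]; first by rewrite mul0r add0r.
by rewrite -natr1 mulrDl mul1r addrAC addrC; exact: coupled_conv.
Qed.

(** Each of the [n] extra summands is paired with 0, which costs its mean. *)
Lemma coupled_iter_convl n (mu m1 m2 : probability nat R) (a c : R) :
  mean mu <= a%:E -> coupled distn m1 m2 c ->
  coupled distn (iter n (Defs.conv mu) m1) m2 (n%:R * a + c).
Proof.
move=> ca cc; elim: n => [|n IH]; first by rewrite mul0r add0r.
rewrite -natr1 mulrDl mul1r addrAC addrC.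
apply: (coupled_eq (fun _ _ => erefl) (fun A _ => conv0 m2 A)).
exact: coupled_conv (coupled_delta0 ca) IH.
Qed.

Lemma coupled_nat_sym (mu nu : probability nat R) (c : R) :
  coupled distn mu nu c -> coupled distn nu mu c.
Proof.
by apply: coupled_sym; [exact: discrete_nat|exact: dist_nat_ge0|exact: dist_natC].
Qed.

Lemma coupled_nat_refl (mu : probability nat R) : coupled distn mu mu 0.
Proof.
apply: coupled_refl; [exact: discrete_nat|exact: dist_nat_ge0|].
by move=> x; rewrite /dist_nat subrr normr0.
Qed.

(** Pair the first min(m, n) summands at cost [c] each, and the other |m - n| with 0. If these
    belong to [nu], their mean is only known to be at most [a + c]; this surplus is why the error
    counts all [n] summands. *)
Lemma coupled_iter_conv2 m n (mu nu : probability nat R) (a c : R) :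
  (0 <= c)%R -> mean mu <= a%:E -> coupled distn mu nu c ->
  coupled distn (iter m (Defs.conv mu) (delta0 R)) (iter n (Defs.conv nu) (delta0 R))
    (a * distn m n + c * n%:R).
Proof.
move=> c0 ma cmn.
have c00 := coupled_nat_refl (delta0 R).
have [mn|nm] := leP m n.
  apply: coupled_nat_sym.
  rewrite -(subnK mn) iterD.
  have -> : (a * distn m (n - m + m) + c * (n - m + m)%:R
             = (n - m)%:R * (a + c) + (m%:R * c + 0))%R.
    by rewrite /dist_nat natrD distrC addrK ger0_norm//; ring.
  apply: coupled_iter_convl.
    by rewrite EFinD; apply: le_trans (coupled_mean cmn) _; rewrite leeD2r.
  apply: coupled_iter_conv => //.
  exact: coupled_nat_sym.
rewrite -(subnK (ltnW nm)) iterD.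
have -> : (a * distn (m - n + n) n + c * n%:R
             = (m - n)%:R * a + (n%:R * c + 0))%R.
  by rewrite /dist_nat natrD addrK ger0_norm//; ring.
apply: coupled_iter_convl => //; exact: coupled_iter_conv.
Qed.

Lemma coupled_big_conv (r : seq nat) (F G : nat -> probability nat R)
    (c : nat -> R) :
  (forall j, j \in r -> coupled distn (F j) (G j) (c j)) ->
  coupled distn (\big[@Defs.conv R/delta0 R]_(j <- r) F j)
    (\big[@Defs.conv R/delta0 R]_(j <- r) G j) (\sum_(j <- r) c j)%R.
Proof.
elim: r => [|j r IH] h; rewrite ?big_nil ?big_cons.
  exact: coupled_nat_refl.
apply: coupled_conv; first by apply: h; rewrite mem_head.
by apply: IH => i ir; apply: h; rewrite in_cons ir orbT.
Qed.

Lemma coupled_S_law q (zeta : nat -> R -> probability nat R) (u v : R)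
    (x y : q.-tuple nat) (a c : nat -> R) :
  (forall j, (1 <= j <= q)%N -> mean (zeta j (frozen u)) <= (a j)%:E) ->
  (forall j, (1 <= j <= q.+1)%N -> (0 <= c j)%R /\
     coupled distn (zeta j (frozen u)) (zeta j (frozen v)) (c j)) ->
  coupled distn (S_law zeta u x) (S_law zeta v y)
    (\sum_(1 <= j < q.+1) (a j * distn (nth 0%N x (q - j)) (nth 0%N y (q - j))
        + c j * (nth 0%N y (q - j))%:R) + c q.+1)%R.
Proof.
move=> ha hc; apply: coupled_conv; last by apply: (hc _ _).2; rewrite ltnSn.
apply: coupled_big_conv => j; rewrite mem_index_iota => /andP[j1 jq].
have [cj0 cj] : (0 <= c j)%R /\
     coupled distn (zeta j (frozen u)) (zeta j (frozen v)) (c j).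
  by apply: hc; rewrite j1 ltnW.
by apply: coupled_iter_conv2 => //; apply: ha; rewrite j1.
Qed.

Lemma mean_S_law q (zeta : nat -> R -> probability nat R) (u : R)
    (x : q.-tuple nat) :
  mean (S_law zeta u x) =
  \sum_(1 <= j < q.+1) (nth 0%N x (q - j))%:R%:E * mean (zeta j (frozen u))
  + mean (zeta q.+1 (frozen u)).
Proof.
rewrite mean_conv mean_big_conv; congr (_ + _).
by apply: eq_bigr => j _; rewrite mean_iter_conv mean_delta0 adde0.
Qed.

End convolution.

(** * Contraction of the INAR chains *)

Section state_chains.
Local Open Scope ereal_scope.
Context (R : realType) (q : nat) (hq : (0 < q)%N).
Context (zeta : nat -> R -> probability nat R).

Local Notation distn := (@dist_nat R).
Local Notation state := (q.-tuple nat).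
Local Notation mS := (@measurable_state q).
Local Notation dS := (@discrete_state q).
Local Notation Q := (Q_kernel zeta).
Local Notation mNN := (discrete_pair discrete_nat discrete_nat).2.

Definition omega (kappa u v : R) : R := (`|frozen u - frozen v| `^ kappa)%R.

(** The hypotheses in the form used from here on: real bounds uniform in the parameter, valid for
    every [u <= 1] because negative parameters are frozen, and couplings in place of [W1]. *)
Record regular (kappa r b L : R) (a : R -> nat -> R) : Prop := Regular {
  reg_kappa : (0 < kappa < 1)%R;
  reg_r : (0 < r < 1)%R;
  reg_L : (0 <= L)%R;
  reg_b : (0 <= b)%R;
  reg_a0 : forall u j, (0 <= a u j)%R;
  reg_a : forall u j, (u <= 1)%R -> (1 <= j <= q)%N ->
    mean (zeta j (frozen u)) <= (a u j)%:E;
  reg_sum : forall u, (u <= 1)%R -> (\sum_(1 <= j < q.+1) a u j <= r)%R;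
  reg_immig : forall u, (u <= 1)%R -> mean (zeta q.+1 (frozen u)) <= b%:E;
  reg_coupled : forall u v j, (u <= 1)%R -> (v <= 1)%R -> (1 <= j <= q.+1)%N ->
    coupled distn (zeta j (frozen u)) (zeta j (frozen v)) (L * omega kappa u v) }.

Lemma omega_ge0 kappa u v : (0 <= omega kappa u v)%R.
Proof. exact: powR_ge0. Qed.

Lemma nth_shift_in (x : state) y i : (i < q)%N ->
  nth 0%N (shift_in x y) i = if (i.+1 < q)%N then nth 0%N x i.+1 else y.
Proof.
move=> iq; rewrite -[i in LHS]/(nat_of_ord (Ordinal iq)) -tnth_nth tnth_mktuple /=.
rewrite nth_behead; case: ltnP => iq'.
  by apply: set_nth_default; rewrite size_tuple.
by rewrite nth_default// size_tuple.
Qed.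

Definition cdist i (z : state * state) : \bar R :=
  (distn (nth 0%N z.1 i) (nth 0%N z.2 i))%:E.

Definition cmean (mu : probability state R) i : \bar R :=
  \int[mu]_x (nth 0%N x i)%:R%:E.

Definition mean_bound (mu : probability state R) (M : R) : Prop :=
  forall i, (i < q)%N -> cmean mu i <= M%:E.

(* A single coupling whose cost is controlled coordinate by coordinate: a step of
   the chain shifts the coordinates, so the vector of costs is what contracts. *)
Definition vcoupled (mu nu : probability state R) (D : nat -> R) : Prop :=
  exists2 g, coupling mu nu g &
    forall i, (i < q)%N -> \int[g]_z cdist i z <= (D i)%:E.

Lemma cdist_ge0 i z : 0 <= cdist i z.
Proof. by rewrite lee_fin dist_nat_ge0. Qed.

Lemma cmean_ge0 mu i : 0 <= cmean mu i.
Proof. by apply: integral_ge0 => x _; rewrite lee_fin. Qed.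

Lemma integral_affine d (S : measurableType d) (g : probability S R)
    (f : nat -> S -> R) (A : nat -> R) (C : R) (F : nat -> R) (s : seq nat) :
  discrete S -> (forall j x, 0 <= f j x)%R -> (forall j, 0 <= A j)%R ->
  (0 <= C)%R ->
  (forall j, j \in s -> \int[g]_x (f j x)%:E <= (F j)%:E) ->
  \int[g]_x (\sum_(j <- s) A j * f j x + C)%R%:E
    <= (\sum_(j <- s) A j * F j + C)%R%:E.
Proof.
move=> dS' f0 A0 C0 fF.
rewrite (eq_integral (fun x => \sum_(j <- s) (A j)%:E * (f j x)%:E + C%:E)); last first.
  by move=> x _; rewrite EFinD -sumEFin.
rewrite discrete_ge0_integralD//; last by move=> x; apply: sume_ge0 => j _; rewrite mule_ge0 ?lee_fin.
rewrite integral_probability_cst EFinD leeD2r// -sumEFin.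
rewrite ge0_integral_sum//; last 2 first.
- by move=> j _; apply: measurable_fun_discrete; exact: dS'.2.
- by move=> j x _; rewrite mule_ge0 ?lee_fin.
rewrite big_seq [leRHS]big_seq; apply: lee_sum => j js.
rewrite ge0_integralZl_EFin//.
- by rewrite EFinM lee_wpmul2l ?lee_fin// fF.
- by move=> x _; rewrite lee_fin.
- by apply: measurable_fun_discrete; exact: dS'.2.
Qed.

Lemma integral_Q (u : R) (x : state) (f : state -> \bar R) :
  (forall y, 0 <= f y) ->
  \int[Q u x]_y f y = \int[S_law zeta u x]_s f (shift_in x s).
Proof. by move=> f0; rewrite integral_law//; exact: dS. Qed.

Lemma cmean_mixture mu u i : (i < q)%N ->
  cmean (mixture mS mu (Q u)) i =
  if (i.+1 < q)%N then cmean mu i.+1 else \int[mu]_x mean (S_law zeta u x).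
Proof.
move=> iq; rewrite /cmean integral_mixture//; last exact: dS.
case: ltnP => iq'; apply: eq_integral => x _; rewrite integral_Q//.
  under eq_integral do rewrite nth_shift_in// iq'.
  by rewrite integral_probability_cst.
by apply: eq_integral => s _; rewrite nth_shift_in// ltnNge iq'.
Qed.

Lemma vcoupled_coupled mu nu D : vcoupled mu nu D ->
  coupled (@dist_state R q) mu nu (\sum_(i < q) D i)%R.
Proof.
move=> [g cg gD]; exists g => //.
have [_ mSS] := discrete_pair dS dS.
rewrite (eq_integral (fun z => \sum_(i < q) cdist i z)); last first.
  by move=> z _; rewrite sumEFin; congr EFin; apply: eq_bigr => i _;
     rewrite !(tnth_nth 0%N).
rewrite ge0_integral_sum//; first by rewrite -sumEFin; apply: lee_sum => i _; exact: gD.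
- by move=> i; exact: measurable_fun_discrete.
- by move=> i z _; exact: cdist_ge0.
Qed.

Context (kappa r b L : R) (a : R -> nat -> R) (H : regular kappa r b L a).

Let r01 : (0 < r < 1)%R := reg_r H.

Lemma mean_bound_step mu u M : (u <= 1)%R -> (r * M + b <= M)%R ->
  mean_bound mu M -> mean_bound (mixture mS mu (Q u)) M.
Proof.
move=> u1 rM muM i iq; rewrite cmean_mixture//; case: ltnP => [|_]; first exact: muM.
have M0 : (0 <= M)%R by rewrite -lee_fin (le_trans (cmean_ge0 mu i))// muM.
apply: (@le_trans _ _ (\int[mu]_x
   (\sum_(1 <= j < q.+1) a u j * (nth 0%N x (q - j))%:R + b)%R%:E)).
  apply: discrete_ge0_le_integral => [|x|x]; [exact: dS|exact: mean_ge0|].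
  rewrite mean_S_law EFinD leeD ?(reg_immig H)// -sumEFin.
  rewrite big_nat [leRHS]big_nat; apply: lee_sum => j /andP[j1 jq].
  by rewrite EFinM muleC lee_wpmul2r ?lee_fin// (reg_a H)// j1.
apply: (le_trans (integral_affine (F := fun=> M) _ _ _ _ _)) => //.
- exact: dS.
- exact: reg_a0 H _.
- exact: reg_b H.
- by move=> j; rewrite mem_index_iota => /andP[j1 jq]; apply: muM; rewrite ltn_subrL hq (leq_trans _ j1).
rewrite lee_fin (le_trans _ rM)// lerD2r -mulr_suml.
by rewrite ler_wpM2r// (reg_sum H).
Qed.

(** [e] lists q + 1 bounds: indices below q for the current coordinates, index q for the value
    produced by the step; the shift turns [e i] into [e i.+1]. Given a pair of states, the new
    values are coupled through [S_law]. Only [nu] carries a mean bound, since the parameter error is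
    weighted by the second population. *)
Lemma vcoupled_step mu nu u v M e : (u <= 1)%R -> (v <= 1)%R ->
  mean_bound nu M -> vcoupled mu nu e ->
  (\sum_(1 <= j < q.+1) a u j * e (q - j)%N
     + L * omega kappa u v * (q%:R * M + 1) <= e q)%R ->
  vcoupled (mixture mS mu (Q u)) (mixture mS nu (Q v)) (fun i => e i.+1).
Proof.
move=> u1 v1 nuM [g cg ge] he.
have [_ mSS] := discrete_pair dS dS.
set w := (L * omega kappa u v)%R in he.
have w0 : (0 <= w)%R by rewrite mulr_ge0 ?(reg_L H) ?omega_ge0.
pose cost (z : state * state) : R := (\sum_(1 <= j < q.+1)
  (a u j * distn (nth 0%N z.1 (q - j)) (nth 0%N z.2 (q - j))
     + w * (nth 0%N z.2 (q - j))%:R) + w)%R.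
have /choice[G cG] : forall z, exists h,
    coupling (S_law zeta u z.1) (S_law zeta v z.2) h /\
    \int[h]_s (distn s.1 s.2)%:E <= (cost z)%:E.
  move=> z; have [h h1 h2] : coupled distn (S_law zeta u z.1) (S_law zeta v z.2) (cost z).
    apply: (@coupled_S_law R q zeta u v z.1 z.2 (a u) (fun=> w)) => [j jq|j jq]; first exact: (reg_a H).
    by split => //; exact: (reg_coupled H).
  by exists h.
pose G' z := distribution (G z) (dfun mNN (fun s =>
  (shift_in z.1 s.1, shift_in z.2 s.2))).
exists (mixture mSS g G').
  by apply: coupling_mixture => // [|z]; [exact: dS|apply: coupling_image; exact: (cG z).1].
move=> i iq; rewrite integral_mixture//; [|exact: (discrete_pair dS dS)|exact: cdist_ge0].
have E z : \int[G' z]_y cdist i y = \int[G z]_s cdist i (shift_in z.1 s.1, shift_in z.2 s.2).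
  rewrite integral_law//; [exact: (discrete_pair dS dS)|exact: cdist_ge0].
under eq_integral do rewrite E.
have [iq'|iq'] := ltnP i.+1 q.
  (* Before the last position the shifted coordinate is a function of the old pair, so its cost is
     the old cost at [i.+1]. *)
  apply: le_trans (ge _ iq'); rewrite le_eqVlt; apply/orP; left; apply/eqP.
  apply: eq_integral => z _; rewrite -[RHS](integral_probability_cst (G z)).
  by apply: eq_integral => s _; rewrite /cdist/= !nth_shift_in// iq'.
have -> : i.+1 = q by apply/eqP; rewrite eqn_leq iq.
rewrite -lee_fin in he; apply: le_trans he.
apply: (@le_trans _ _ (\int[g]_z (cost z)%:E)).
  apply: discrete_ge0_le_integral => [|z|z]; first exact: (discrete_pair dS dS).
    by apply: integral_ge0 => s _; exact: cdist_ge0.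
  apply: le_trans (cG z).2; rewrite le_eqVlt; apply/orP; left; apply/eqP.
  by apply: eq_integral => s _; rewrite /cdist/= !nth_shift_in// ltnNge iq'.
rewrite /cost.
have idx j : j \in index_iota 1 q.+1 -> (q - j < q)%N.
  by rewrite mem_index_iota => /andP[j1 jq]; rewrite ltn_subrL hq (leq_trans _ j1).
under eq_integral do rewrite big_split/= -addrA EFinD.
rewrite discrete_ge0_integralD; first last.
- move=> z; rewrite lee_fin addr_ge0// sumr_ge0// => j _; exact: mulr_ge0.
- by move=> z; rewrite lee_fin sumr_ge0// => j _; rewrite mulr_ge0 ?(reg_a0 H) ?dist_nat_ge0.
- exact: (discrete_pair dS dS).
rewrite EFinD leeD//.
  under eq_integral do rewrite -[X in X%:E]addr0.
  rewrite -[X in _ <= X%:E]addr0.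
  apply: integral_affine => //.
  - exact: (discrete_pair dS dS).
  - by move=> j z; exact: dist_nat_ge0.
  - exact: reg_a0 H _.
  - by move=> j js; exact: ge (idx _ js).
apply: (le_trans (integral_affine (A := fun=> w) (F := fun=> M) _ _ _ _ _)) => //.
- exact: (discrete_pair dS dS).
- move=> j js; rewrite (coupling_snd (f := fun x : state => (nth 0%N x (q - j))%:R%:E) dS cg)//.
  exact: nuM (idx _ js).
rewrite lee_fin big_const_nat iter_addr_0 subSS subn0 mulrDr mulr1 lerD2r.
by rewrite -[leLHS]mulr_natl mulrCA.
Qed.

Fixpoint run (us : nat -> R) (mu : probability state R) (m : nat) :
    probability state R :=
  if m is m'.+1 then mixture mS (run us mu m') (Q (us m')) else mu.

Lemma mean_bound_run us mu M m : (forall t, us t <= 1)%R -> (r * M + b <= M)%R ->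
  mean_bound mu M -> mean_bound (run us mu m) M.
Proof.
by move=> us1 rM muM; elim: m => //= m IH; exact: mean_bound_step.
Qed.

(** Coordinate [i] after [m] steps is the process at index [m + i], so one sequence [e] bounds all
    times as soon as it is a supersolution of the recursion of lag q. *)
Lemma vcoupled_run us vs mu nu M e m :
  (forall t, us t <= 1)%R -> (forall t, vs t <= 1)%R -> (r * M + b <= M)%R ->
  mean_bound nu M -> vcoupled mu nu e ->
  (forall t, (t < m)%N -> \sum_(1 <= j < q.+1) a (us t) j * e (t + (q - j))%N
     + L * omega kappa (us t) (vs t) * (q%:R * M + 1) <= e (t + q)%N)%R ->
  vcoupled (run us mu m) (run vs nu m) (fun i => e (m + i)%N).
Proof.
move=> us1 vs1 rM nuM emn; elim: m => [|m IH] he //=.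
have {}IH := IH (fun t tm => he t (ltnW tm)).
have := vcoupled_step (us1 m) (vs1 m) (mean_bound_run m vs1 rM nuM) IH (he m (ltnSn m)).
by move=> [g cg gD]; exists g => // i iq; rewrite addSnnS; exact: gD.
Qed.

(* By Bernoulli's inequality [r <= decay ^+ q]: a recursion of lag [q] with total
   weight [r] contracts by [decay] at each step. *)
Definition decay : R := (1 - (1 - r) / q%:R)%R.

Lemma decay01 : (0 < decay < 1)%R.
Proof.
have q0 : (0 < q%:R :> R)%R by rewrite ltr0n.
have q1 : (1 <= q%:R :> R)%R by rewrite ler1n.
have [r0 r1] := andP r01.
apply/andP; split.
  by rewrite /decay subr_gt0 ltr_pdivrMr// mul1r (lt_le_trans _ q1)// ltrBlDr ltrDl.
by rewrite /decay ltrBlDr ltrDl divr_gt0 ?subr_gt0.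
Qed.

Lemma decay_exp : (r <= decay ^+ q)%R.
Proof.
have bern (x : R) n : (0 <= x <= 1 -> 1 - n%:R * x <= (1 - x) ^+ n)%R.
  move=> /andP[x0 x1]; elim: n => [|n IH]; first by rewrite mul0r subr0 expr0.
  rewrite exprSr; apply: le_trans (ler_wpM2r _ IH); last by rewrite subr_ge0.
  rewrite -natr1; have : (0 <= n%:R * x * x)%R by rewrite !mulr_ge0.
  by nra.
have q0 : (0 < q%:R :> R)%R by rewrite ltr0n.
have /andP[d0 d1] := decay01.
have := bern ((1 - r) / q%:R)%R q; rewrite -/decay mulrCA divff ?gt_eqF// mulr1 opprB addrCA subrr addr0; apply.
have [_ r1] := andP r01.
rewrite divr_ge0 ?subr_ge0 ?(ltW r1)//=.
by move: d0; rewrite /decay subr_gt0 => /ltW.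
Qed.

(* The supersolution of the recursion e_k <= r max_(j <= q) e_(k-j) + error_k
   is the sum of a geometric term (initial error) and a term affine
   in the remaining time (perturbation of the parameters). *)
Lemma vcoupled_drift us vs mu nu M D0 a0 b0 m :
  (forall t, us t <= 1)%R -> (forall t, vs t <= 1)%R ->
  (0 <= M)%R -> (r * M + b <= M)%R -> (0 <= D0)%R -> (0 <= a0)%R -> (0 <= b0)%R ->
  mean_bound nu M -> vcoupled mu nu (fun=> D0) ->
  (forall t, (t < m)%N -> omega kappa (us t) (vs t) <= a0 + (m - t.+1)%:R * b0)%R ->
  vcoupled (run us mu m) (run vs nu m) (fun=>
    L * (q%:R * M + 1) / (1 - r) * (a0 + (q%:R + r * q%:R / (1 - r)) * b0)
    + D0 / decay ^+ q * decay ^+ m)%R.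
Proof.
move=> us1 vs1 M0 rM D00 a00 b00 nuM cmn hw.
have [r0 r1] := andP r01; have [d0 d1] := andP decay01.
(* [K] absorbs the source term, as [A = K (1 - r)]. [M1] is the fixed point of x |-> r (q + x): it
   absorbs the growth of the affine term over a lag of up to q indices. *)
set A := (L * (q%:R * M + 1))%R; set K := (A / (1 - r))%R.
set M1 := (r * q%:R / (1 - r))%R.
have s0 : (0 < 1 - r)%R by rewrite subr_gt0.
have A0 : (0 <= A)%R by rewrite mulr_ge0 ?(reg_L H)// addr_ge0// mulr_ge0.
have K0 : (0 <= K)%R by rewrite divr_ge0// ltW.
have AK : (A = K * (1 - r))%R by rewrite /K divfK// gt_eqF.
have M10 : (0 <= M1)%R by rewrite divr_ge0 ?ltW// mulr_gt0// ltr0n.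
have M1E : (r * (q%:R + M1) = M1)%R.
  by rewrite /M1; field; rewrite gt_eqF.
(* At index t + q, the value produced by step t, the weight of [b0] is the number m - t - 1 of
   remaining steps plus [M1]. On the initial window t < q the geometric term is at least [D0]. *)
pose e (t : nat) : R := (K * (a0 + ((m + q)%:R - t%:R - 1 + M1) * b0)
   + D0 / decay ^+ q * decay ^+ t)%R.
have qn1 : (1 <= q%:R :> R)%R by rewrite ler1n.
have [g cg gD] : vcoupled (run us mu m) (run vs nu m) (fun i => e (m + i)%N).
  apply: (vcoupled_run (M := M)) => //.
    move: cmn => [g cg gD]; exists g => // i iq; apply: le_trans (gD i iq) _.
    rewrite lee_fin /e ler_wpDl//.
      rewrite mulr_ge0// addr_ge0// mulr_ge0// addr_ge0//.
      by rewrite -addrA -opprD subr_ge0 natr1 ler_nat (leq_trans iq)// leq_addl.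
    rewrite -mulrA ler_peMr// ler_pdivlMl ?exprn_gt0// mulr1.
    by rewrite ler_wiXn2l ?(ltW d0) ?(ltW d1) ?(ltnW iq).
  move=> t tm; rewrite {1}/e.
  set T := (m - t.+1)%:R : R.
  have mE : (m%:R = T + t%:R + 1 :> R)%R.
    by rewrite /T -addrA natr1 -natrD subnK.
  have T0 : (0 <= T)%R by rewrite /T.
  set G := (D0 / decay ^+ q * decay ^+ t)%R.
  have G0 : (0 <= G)%R by rewrite mulr_ge0 ?exprn_ge0 ?divr_ge0 ?exprn_ge0// ltW.
  (* [B] is [e t], the value at the oldest index of the window; it is the largest there because [e]
     decreases. *)
  set B := (K * (a0 + (T + q%:R + M1) * b0) + G)%R.
  have B0 : (0 <= B)%R.
    by rewrite addr_ge0// mulr_ge0// addr_ge0// mulr_ge0// !addr_ge0.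
  apply: (@le_trans _ _ (r * B + A * (a0 + T * b0))%R).
    rewrite lerD//; last first.
      rewrite mulrAC -/A ler_wpM2l//; exact: hw.
    apply: (@le_trans _ _ (\sum_(1 <= j < q.+1) a (us t) j * B)%R); last first.
      by rewrite -mulr_suml ler_wpM2r// (reg_sum H).
    rewrite big_nat [leRHS]big_nat; apply: ler_sum => j /andP[j1 jq].
    rewrite ler_wpM2l ?(reg_a0 H)// lerD//.
      rewrite ler_wpM2l// lerD2l ler_wpM2r// lerD2r.
      rewrite !natrD mE natrB//; have : (j%:R <= q%:R :> R)%R by rewrite ler_nat.
      by lra.
    rewrite /G ler_wpM2l ?divr_ge0 ?exprn_ge0 ?(ltW d0)//.
    by rewrite ler_wiXn2l ?(ltW d0) ?(ltW d1)// leq_addr.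
  rewrite /e !natrD mE exprD.
  have Gq : (r * G <= D0 / decay ^+ q * (decay ^+ t * decay ^+ q))%R.
    rewrite [leRHS]mulrA -/G [leLHS]mulrC; apply: ler_wpM2l => //; exact: decay_exp.
  have -> : (T + t%:R + 1 + q%:R - (t%:R + q%:R) - 1 + M1 = T + M1)%R by ring.
  rewrite AK /B mulrDr.
  have : (r * (K * (a0 + (T + q%:R + M1) * b0)) + K * (1 - r) * (a0 + T * b0)
    = K * (a0 + (T + r * (q%:R + M1)) * b0))%R by ring.
  by rewrite M1E; lra.
exists g => // i iq; apply: le_trans (gD i iq) _; rewrite lee_fin lerD//.
  rewrite ler_wpM2l// lerD2l ler_wpM2r// lerD2r !natrD.
  by have : (0 <= i%:R :> R)%R by []; lra.
rewrite ler_wpM2l ?divr_ge0 ?exprn_ge0 ?(ltW d0)//.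
by rewrite ler_wiXn2l ?(ltW d0) ?(ltW d1)// leq_addr.
Qed.

End state_chains.

Section coupled_functions.
Local Open Scope ereal_scope.
Context (R : realType) (d : measure_display) (E : measurableType d).
Context (dist : E -> E -> R) (dE : discrete E) (dist0 : forall x y, (0 <= dist x y)%R).

Lemma coupled_lipschitz (mu nu : probability E R) (c C : R) (f : E -> R) :
  coupled dist mu nu c -> (0 <= C)%R -> (forall x, 0 <= f x)%R ->
  (forall x y, f x <= f y + C * dist x y)%R ->
  \int[mu]_x (f x)%:E <= \int[nu]_x (f x)%:E + (C * c)%:E.
Proof.
move=> [g cg gc] C0 f0 fC; have dEE := discrete_pair dE dE.
have f0' x : 0 <= (f x)%:E by rewrite lee_fin.
rewrite -(coupling_fst dE cg f0') -(coupling_snd dE cg f0').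
apply: (@le_trans _ _ (\int[g]_z ((f z.2)%:E + (C * dist z.1 z.2)%:E))).
  by apply: discrete_ge0_le_integral => // z; rewrite -EFinD lee_fin.
rewrite discrete_ge0_integralD//; last by move=> z; rewrite lee_fin mulr_ge0.
rewrite leeD2l// EFinM; under eq_integral do rewrite EFinM.
rewrite ge0_integralZl_EFin//; first by rewrite lee_wpmul2l.
- by move=> z _; rewrite lee_fin.
- by apply: measurable_fun_discrete; exact: dEE.2.
Qed.

(** Indicators are 1-Lipschitz when distinct points are at distance at least 1, so transport cost
    dominates total variation. *)
Lemma coupled_measure (mu nu : probability E R) (c : R) (A : set E) :
  (forall x y, x <> y -> 1 <= dist x y)%R ->
  coupled dist mu nu c -> mu A <= nu A + c%:E.
Proof.
move=> d1 cc; rewrite -(setIT A) -!(integral_indic _ measurableT (dE.2 A)) -[c]mul1r.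
apply: (coupled_lipschitz cc) => // x y; rewrite mul1r !indicE.
have [->|/eqP/d1 xy] := eqVneq x y; first by rewrite lerDl.
by case: (x \in A); case: (y \in A); rewrite /= ?add0r ?addr0 ?lerDl// addr_ge0.
Qed.

End coupled_functions.

(** * Stationary laws *)

Section limit_law.
Context (R : realType) (d : measure_display) (S : measurableType d).
Context (dS : discrete S) (mu : nat -> probability S R) (l : set S -> R).
Context (hl : forall e : R, 0 < e ->
  \forall n \near \oo, forall A, `|l A - fine (mu n A)| <= e).

Let mS (A : set S) : measurable A := dS.2 A.

Let fmu n A : (fine (mu n A))%:E = mu n A.
Proof. by rewrite fineK// fin_num_measure. Qed.

Let lcvg A : (fun n => fine (mu n A)) @ \oo --> l A.
Proof.
apply/cvgrPdist_le => e e0; near=> n.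
by move: A; near: n; exact: hl.
Unshelve. all: by end_near. Qed.

Let l_unique A (f : nat -> R) x : (forall n, mu n A = (f n)%:E) ->
  f @ \oo --> x -> l A = x.
Proof.
move=> fE fx; have := @lcvg A.
rewrite (_ : (fun n => _) = f); last by apply/funext => n; rewrite fE.
by move/norm_cvg_unique; apply.
Qed.

Let lU (A B : set S) : A `&` B = set0 -> l (A `|` B) = l A + l B.
Proof.
move=> AB; apply: (l_unique (f := fun n => fine (mu n A) + fine (mu n B))).
  by move=> n; rewrite EFinD !fmu measureU.
by apply: cvgD; exact: lcvg.
Qed.

Let l0 : l set0 = 0.
Proof. by apply: (l_unique (f := cst 0)) => [n|]; [rewrite measure0|exact: cvg_cst]. Qed.

Let l_ge0 A : 0 <= l A.
Proof.
by apply: (ler_cvg_to (cvg_cst 0) (@lcvg A)); apply: nearW => n; rewrite fine_ge0.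
Qed.

Definition limit_fun (A : set S) : \bar R := (l A)%:E.

Let limit0 : limit_fun set0 = 0%E.
Proof. by rewrite /limit_fun l0. Qed.

Let limit_ge0 A : (0 <= limit_fun A)%E.
Proof. by rewrite lee_fin l_ge0. Qed.

(** Convergence uniform over all sets lets a single [mu k] stand for the limit on the union and on
    all partial unions at once; its own sigma-additivity then passes to [l]. *)
Let limit_sigma_additive : semi_sigma_additive limit_fun.
Proof.
move=> F mF tF _; rewrite /limit_fun.
have fin N : \sum_(0 <= i < N) l (F i) = l (\big[setU/set0]_(i < N) F i).
  elim: N => [|N IH]; first by rewrite big_geq// big_ord0 l0.
  rewrite big_nat_recr//= IH big_ord_recr/= lU//.
  rewrite setIC big_distrr/= big1// => i _.
  by move/trivIsetP: tF; apply => //; rewrite neq_ltn ltn_ord ?orbT.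
under eq_fun do rewrite sumEFin fin.
apply: cvg_EFin; first by exact: nearW.
apply/cvgrPdist_le => e e0.
have e30 : 0 < e / 3 by rewrite divr_gt0.
have [k _ /(_ k (leqnn k)) hk] := hl e30.
have : (fun N => fine (mu k (\big[setU/set0]_(i < N) F i))) @ \oo -->
    fine (mu k (\bigcup_i F i)).
  apply: fine_cvg; rewrite fmu.
  rewrite (_ : (fun N => _) = (fun N => \sum_(0 <= i < N) mu k (F i))%E).
    exact: measure_semi_sigma_additive.
  by apply/funext => N; rewrite big_mkord measure_bigsetU.
move=> /cvgrPdist_le/(_ _ e30); apply: filterS => N hN.
have := hk (\bigcup_i F i); have := hk (\big[setU/set0]_(i < N) F i).
move: hN; rewrite !ler_distl => /andP[? ?] /andP[? ?] /andP[? ?].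
by move=> /=; apply/andP; split; lra.
Qed.

HB.instance Definition _ := isMeasure.Build _ _ _ limit_fun
  limit0 limit_ge0 limit_sigma_additive.

Let limit_setT : limit_fun setT = 1%E.
Proof.
congr EFin; apply: (l_unique (f := cst 1)) => [n|]; last exact: cvg_cst.
by rewrite probability_setT.
Qed.

HB.instance Definition _ :=
  Measure_isProbability.Build _ _ _ limit_fun limit_setT.

Lemma limit_law : exists pi : probability S R, forall A, pi A = (l A)%:E.
Proof. by exists limit_fun. Qed.

End limit_law.

Lemma geometric_cauchy (R : realType) (x : nat -> R) (C rho : R) :
  0 <= C -> 0 < rho < 1 -> (forall n, `|x n.+1 - x n| <= C * rho ^+ n) ->
  forall n, `|limn x - x n| <= C / (1 - rho) * rho ^+ n.
Proof.
move=> C0 /andP[r0 r1] hx n.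
have r10 : 0 < 1 - rho by rewrite subr_gt0.
have cx : cvgn x.
  rewrite (_ : x = (fun n => x 0%N + series (telescope x) n)); last first.
    by apply/funext => m; exact: eq_sum_telescope.
  apply: is_cvgD; first exact: is_cvg_cst.
  apply: normed_cvg; apply: (@series_le_cvg _ _ (geometric C rho)) => //.
  - by move=> m; exact: normr_ge0.
  - by move=> m; exact: (geometric_ge0 _ C0 (ltW r0)).
  - by apply: is_cvg_geometric_series; rewrite ger0_norm// ltW.
(* The factor [1 - rho ^+ m] is the exact geometric sum, which makes the induction step an
   equality. *)
have hb m : `|x (n + m)%N - x n| <= C / (1 - rho) * rho ^+ n * (1 - rho ^+ m).
  elim: m => [|m IH]; first by rewrite addn0 subrr normr0 expr0 subrr mulr0.
  rewrite -(subrKA (x (n + m)%N)); apply: le_trans (ler_normD _ _) _.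
  rewrite addnS; apply: le_trans (lerD (hx _) IH) _.
  rewrite exprD exprSr; rewrite le_eqVlt; apply/orP; left; apply/eqP; field; by rewrite gt_eqF.
have cn : (fun m => `|x (m + n)%N - x n|) @ \oo --> `|limn x - x n|.
  apply: cvg_norm; apply: cvgB; last exact: cvg_cst.
  by rewrite cvg_shiftn.
apply: (ler_cvg_to cn (cvg_cst _)); apply: nearW => m.
rewrite addnC (le_trans (hb m))// ler_piMr//; last by rewrite gerBl exprn_ge0// ltW.
by rewrite mulr_ge0 ?divr_ge0 ?exprn_ge0 ?(ltW r10) ?(ltW r0).
Qed.

(** Applied to the complement, the inequality gives its converse, the total masses being equal. *)
Lemma probability_le_eq (R : realType) d (S : measurableType d)
    (mu nu : probability S R) :
  (forall A, measurable A -> mu A <= nu A)%E ->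
  forall A, measurable A -> mu A = nu A.
Proof.
move=> h A mA; apply/eqP; rewrite eq_le h//=.
have := h _ (measurableC mA); rewrite !probability_setC//.
rewrite -[mu A]fineK ?fin_num_measure// -[nu A]fineK ?fin_num_measure//.
by rewrite -!EFinB !lee_fin lerD2l lerN2.
Qed.

Section state_distance.
Context (R : realType) (q : nat).
Local Notation dists := (@dist_state R q).

Lemma dist_state_ge0 x y : 0 <= dists x y.
Proof. by apply: sumr_ge0 => i _; exact: dist_nat_ge0. Qed.

Lemma dist_stateC x y : dists x y = dists y x.
Proof. by apply: eq_bigr => i _; exact: dist_natC. Qed.

Lemma dist_statexx x : dists x x = 0.
Proof. by rewrite /dist_state big1// => i _; rewrite /dist_nat subrr normr0. Qed.

Lemma dist_nat_ge1 x y : x <> y -> 1 <= @dist_nat R x y.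
Proof.
rewrite /dist_nat; wlog xy : x y / (x < y)%N => [h /eqP|_].
  by rewrite neq_ltn => /orP[|] xy; [|rewrite distrC]; apply: h => // e; rewrite e ltnn in xy.
rewrite distrC ger0_norm; last by rewrite subr_ge0 ler_nat ltnW.
by rewrite -natrB ?(ltnW xy)// ler1n subn_gt0.
Qed.

Lemma dist_state_ge1 x y : x <> y -> 1 <= dists x y.
Proof.
move=> xy; have [i xyi] : exists i, tnth x i <> tnth y i.
  by apply: contrapT => h; apply: xy; apply: eq_from_tnth => i;
     apply: contrapT => ?; apply: h; exists i.
rewrite /dist_state (bigD1 i)//= -[leLHS]addr0 lerD ?dist_nat_ge1//.
by apply: sumr_ge0 => j _; exact: dist_nat_ge0.
Qed.

End state_distance.

(** * Existence and uniqueness of the invariant law *)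

Section stationary.
Local Open Scope ereal_scope.
Context (R : realType) (q : nat) (hq : (0 < q)%N).
Context (zeta : nat -> R -> probability nat R).
Context (kappa r b L : R) (a : R -> nat -> R) (H : regular q zeta kappa r b L a).

Local Notation dists := (@dist_state R q).
Local Notation state := (q.-tuple nat).
Local Notation mS := (@measurable_state q).
Local Notation dS := (@discrete_state q).
Local Notation Q := (Q_kernel zeta).
Local Notation run := (@run R q zeta).
Local Notation rho := (decay q r).

Let r01 : (0 < r < 1)%R := reg_r H.
Let rho01 : (0 < rho < 1)%R := decay01 hq H.

(** The fixed point of [M |-> r * M + b], hence a mean bound preserved by every step and inherited
    by the stationary laws. *)
Definition mean_cap : R := (b / (1 - r))%R.

Lemma mean_cap_ge0 : (0 <= mean_cap)%R.
Proof. by have [_ r1] := andP r01; rewrite divr_ge0 ?(reg_b H) ?subr_ge0 ?ltW. Qed.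

Lemma mean_capE : (r * mean_cap + b = mean_cap)%R.
Proof. by have [_ r1] := andP r01; rewrite /mean_cap; field; rewrite gt_eqF// subr_gt0. Qed.

Lemma mean_cap_le M : (mean_cap <= M)%R -> (r * M + b <= M)%R.
Proof. have := mean_capE; have [_ r1] := andP r01; by nra. Qed.

Lemma mean_bound_le mu M M' : (M <= M')%R ->
  @mean_bound R q mu M -> mean_bound mu M'.
Proof. by move=> MM h i iq; apply: (le_trans (h i iq)); rewrite lee_fin. Qed.

Lemma mean_bound_dirac (x : state) :
  mean_bound (\d_x : probability state R) (\sum_(i < q) (nth 0%N x i)%:R)%R.
Proof.
move=> i iq; rewrite /cmean integral_diracT; last exact: dS.
rewrite lee_fin (bigD1 (Ordinal iq))//= lerDl.
by apply: sumr_ge0.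
Qed.

Lemma vcoupled_independent (mu nu : probability state R) M1 M2 :
  mean_bound mu M1 -> mean_bound nu M2 -> vcoupled mu nu (fun=> M1 + M2)%R.
Proof.
move=> h1 h2; eexists; first exact: (coupling_independent mS).
move=> i iq; set g := mixture _ _ _.
have cg : coupling mu nu g := coupling_independent mS mu nu.
apply: (@le_trans _ _ (\int[g]_z ((nth 0%N z.1 i)%:R%:E + (nth 0%N z.2 i)%:R%:E))).
  apply: discrete_ge0_le_integral => [|z|z]; first exact: (discrete_pair dS dS).
    exact: cdist_ge0.
  by rewrite -EFinD lee_fin (le_trans (ler_normB _ _))// !ger0_norm.
rewrite discrete_ge0_integralD//; last exact: (discrete_pair dS dS).
rewrite (coupling_fst (f := fun x : state => (nth 0%N x i)%:R%:E) dS cg)//.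
rewrite (coupling_snd (f := fun x : state => (nth 0%N x i)%:R%:E) dS cg)//.
by rewrite EFinD leeD ?h1 ?h2.
Qed.

Lemma vcoupled_const_coupled (mu nu : probability state R) D :
  vcoupled mu nu (fun=> D) -> coupled dists mu nu (q%:R * D)%R.
Proof.
by move=> /vcoupled_coupled; rewrite sumr_const card_ord mulr_natl.
Qed.

Lemma coupled_state_sym (mu nu : probability state R) c :
  coupled dists mu nu c -> coupled dists nu mu c.
Proof.
by apply: coupled_sym; [exact: dS|exact: dist_state_ge0|exact: dist_stateC].
Qed.

Lemma coupled_state_fine (mu nu : probability state R) c A :
  coupled dists mu nu c -> (`|fine (mu A) - fine (nu A)| <= c)%R.
Proof.
move=> cc; have mA := mS A.
have h1 := coupled_measure dS (@dist_state_ge0 R q) A (@dist_state_ge1 R q) cc.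
have h2 := coupled_measure dS (@dist_state_ge0 R q) A (@dist_state_ge1 R q)
  (coupled_state_sym cc).
move: h1 h2; rewrite -[mu A]fineK ?fin_num_measure// -[nu A]fineK ?fin_num_measure//.
by rewrite -!EFinD !lee_fin ler_distl => ? ?; apply/andP; split; lra.
Qed.

Lemma run_const_shift u mu m :
  run (fun=> u) (mixture mS mu (Q u)) m = run (fun=> u) mu m.+1.
Proof. by elim: m => //= m ->. Qed.

Lemma omegaxx u : omega kappa u u = 0%R.
Proof.
have /andP[k0 _] := reg_kappa H.
by rewrite /omega subrr normr0 powR0// gt_eqF.
Qed.

(** Equal parameters have zero drift, so only the geometric term is left. Enlarging [M] by
    [mean_cap] meets the stability condition and does not show in the bound, where [M] multiplies
    the drift only. *)
Lemma run_contraction us mu nu M D0 m :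
  (forall t, us t <= 1)%R -> mean_bound nu M -> (0 <= M)%R -> (0 <= D0)%R ->
  vcoupled mu nu (fun=> D0) ->
  vcoupled (run us mu m) (run us nu m) (fun=> D0 / rho ^+ q * rho ^+ m)%R.
Proof.
move=> us1 nuM M0 D00 cmn.
have M'0 : (0 <= M + mean_cap)%R by rewrite addr_ge0// mean_cap_ge0.
have h1 : mean_bound nu (M + mean_cap)%R.
  by apply: mean_bound_le nuM; rewrite lerDl mean_cap_ge0.
have h2 : (r * (M + mean_cap) + b <= M + mean_cap)%R.
  by apply: mean_cap_le; rewrite lerDr.
have := @vcoupled_drift _ _ hq _ _ _ _ _ _ H us us mu nu _ D0 0%R 0%R m
  us1 us1 M'0 h2 D00 (lexx _) (lexx _) h1 cmn.
rewrite !mulr0 !addr0 mulr0 add0r; apply.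
by move=> t _; rewrite omegaxx mulr0 addr0.
Qed.

Lemma stationary_exists u : (u <= 1)%R ->
  exists pi : probability state R,
    invariant_law (Q u) pi /\ mean_bound pi mean_cap.
Proof.
move=> u1; pose x0 : state := [tuple of nseq q 0%N].
pose mu n := run (fun=> u) (\d_x0 : probability state R) n.
have u1' (t : nat) : (u <= 1)%R by [].
have mu0 : mean_bound (mu 0%N) mean_cap.
  move=> i iq; rewrite /cmean integral_diracT; last exact: dS.
  by rewrite nth_nseq if_same lee_fin mean_cap_ge0.
have muM n : mean_bound (mu n) mean_cap.
  by apply: (mean_bound_run hq H (us := fun=> u)) => //; exact: mean_cap_le.
(* [mu n.+1] is also the run of [n] steps from [mu 1], so successive laws are two runs of equal
   length from the initial laws [mu 0] and [mu 1]. *)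
have muS n : coupled dists (mu n.+1) (mu n)
    (q%:R * ((mean_cap + mean_cap) / rho ^+ q * rho ^+ n))%R.
  apply: coupled_state_sym; apply: vcoupled_const_coupled.
  rewrite {2}/mu -run_const_shift; apply: (run_contraction _ _ (M := mean_cap)) => //.
  - exact: (muM 1%N).
  - exact: mean_cap_ge0.
  - by rewrite addr_ge0// mean_cap_ge0.
  - by apply: vcoupled_independent; [exact: muM 0%N|exact: muM 1%N].
have [d0 d1] := andP rho01.
set C := (q%:R * ((mean_cap + mean_cap) / rho ^+ q))%R.
have C0 : (0 <= C)%R.
  by rewrite mulr_ge0// divr_ge0//; [rewrite addr_ge0// mean_cap_ge0|rewrite exprn_ge0// ltW].
pose l A := limn (fun n => fine (mu n A)).
have hl n A : (`|l A - fine (mu n A)| <= C / (1 - rho) * rho ^+ n)%R.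
  apply: (@geometric_cauchy _ (fun n => fine (mu n A))) => // k.
  by rewrite /C -mulrA; exact: coupled_state_fine (muS k).
have hl' (e : R) : (0 < e)%R ->
    \forall n \near \oo, forall A, (`|l A - fine (mu n A)| <= e)%R.
  move=> e0; have := @cvg_geometric R (C / (1 - rho)) rho.
  rewrite ger0_norm ?(ltW d0)// => /(_ d1)/cvgrPdist_le/(_ _ e0).
  apply: filterS => n /= hn A; apply: le_trans (hl n A) _.
  apply: le_trans hn; rewrite sub0r normrN; exact: ler_norm.
have [pi piE] := limit_law dS hl'.
have cvg_pi A : (fun n => mu n A) @ \oo --> pi A.
  rewrite piE; rewrite (_ : (fun n => mu n A) = (fun n => (fine (mu n A))%:E)).
    apply: cvg_EFin; first exact: nearW.
    by apply/cvgrPdist_le => e /hl'; apply: filterS => n h; exact: h.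
  by apply/funext => n; rewrite fineK// fin_num_measure//; exact: mS.
(* The limit yields only an inequality; between probabilities it is an equality. *)
have sub A : \int[pi]_x Q u x A <= pi A.
  apply: (integral_liminf (mu := mu) (b := fun n => mu n.+1 A)) => //.
  - exact: dS.
  - by have := @cvg_pi A; rewrite -(cvg_shiftS (fun n => mu n A)).
  - by move=> x; rewrite fin_num_measure//; exact: mS.
exists pi; split => [A mA|i iq]; last first.
  apply: (integral_liminf (mu := mu) (b := fun=> mean_cap%:E)) => //.
  - exact: dS.
  - by move=> n; exact: muM.
  - exact: cvg_cst.
exact: (probability_le_eq (mu := mixture mS pi (Q u))) (fun A _ => sub A) _ mA.
Qed.

Lemma run_invariant u (nu : probability state R) m A :
  invariant_law (Q u) nu -> run (fun=> u) nu m A = nu A.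
Proof.
move=> inv; elim: m A => //= m IH A.
rewrite -[RHS](inv _ (mS A)); apply: integral_eq_measure => B _; exact: IH.
Qed.

Lemma stationary_drift us v mu nu M a0 b0 m :
  (forall t, us t <= 1)%R -> (v <= 1)%R -> invariant_law (Q v) nu ->
  (mean_cap <= M)%R -> mean_bound mu M -> mean_bound nu M ->
  (0 <= a0)%R -> (0 <= b0)%R ->
  (forall t, (t < m)%N -> omega kappa (us t) v <= a0 + (m - t.+1)%:R * b0)%R ->
  coupled dists (run us mu m) nu
    (q%:R * (L * (q%:R * M + 1) / (1 - r) * (a0 + (q%:R + r * q%:R / (1 - r)) * b0)
    + (M + M) / rho ^+ q * rho ^+ m))%R.
Proof.
move=> us1 v1 inv cM muM nuM a00 b00 hw.
have M0 : (0 <= M)%R := le_trans mean_cap_ge0 cM.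
apply: (coupled_eq (fun _ _ => erefl) (fun A _ => run_invariant m A inv)).
apply: vcoupled_const_coupled.
apply: (vcoupled_drift hq H (vs := fun=> v)) => //.
- exact: mean_cap_le.
- exact: addr_ge0.
- exact: vcoupled_independent.
Qed.

Lemma mixture_run_dirac us (nu : probability state R) m A :
  \int[nu]_x run us (\d_x : probability state R) m A = run us nu m A.
Proof.
elim: m A => [|m IH] A /=.
  transitivity (\int[nu]_x (\1_A x)%:E).
    by apply: eq_integral => x _; rewrite -diracE.
  by rewrite integral_indic ?setIT//; exact: mS.
apply/esym; apply: integral_disintegration => //.
- exact: dS.
- by move=> B; apply: measurable_fun_discrete; exact: mS.
- by move=> B; rewrite IH.
Qed.

Lemma run_cvg u (nu : probability state R) x A : (u <= 1)%R ->
  invariant_law (Q u) nu -> mean_bound nu mean_cap ->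
  (fun n => run (fun=> u) (\d_x : probability state R) n A) @ \oo --> nu A.
Proof.
move=> u1 inu nuM; have [d0 d1] := andP rho01.
pose M : R := (\sum_(i < q) (nth 0%N x i)%:R)%R.
have M0 : (0 <= M)%R by apply: sumr_ge0.
set C := (q%:R * ((M + mean_cap) / rho ^+ q))%R.
have h n : (`|fine (run (fun=> u) (\d_x : probability state R) n A) - fine (nu A)|
    <= C * rho ^+ n)%R.
  rewrite /C -mulrA; apply: coupled_state_fine.
  apply: (coupled_eq (fun _ _ => erefl) (fun B _ => run_invariant n B inu)).
  apply: vcoupled_const_coupled.
  apply: (run_contraction _ (us := fun=> u) (M := mean_cap)) => //.
  - exact: mean_cap_ge0.
  - by rewrite addr_ge0// mean_cap_ge0.
  - by apply: vcoupled_independent => //; exact: mean_bound_dirac.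
rewrite -[nu A]fineK ?fin_num_measure//; last exact: mS.
rewrite (_ : (fun n => _) = (fun n =>
  (fine (run (fun=> u) (\d_x : probability state R) n A))%:E)); last first.
  by apply/funext => n; rewrite fineK// fin_num_measure//; exact: mS.
apply: cvg_EFin; first exact: nearW.
apply/cvgrPdist_le => e e0; have := @cvg_geometric R C rho.
rewrite ger0_norm ?(ltW d0)// => /(_ d1)/cvgrPdist_le/(_ _ e0).
apply: filterS => n /= hn; rewrite distrC; apply: le_trans (h n) _.
by apply: le_trans hn; rewrite sub0r normrN; exact: ler_norm.
Qed.

(** [mu] may have infinite means, so a coupling of finite cost is not at hand. From each fixed
    state, a point mass with finite means, the run converges to [nu]; the mixture of these runs
    under [mu] is [mu] itself, and dominated convergence identifies the two. *)
Lemma invariant_unique u (nu mu : probability state R) : (u <= 1)%R ->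
  invariant_law (Q u) nu -> mean_bound nu mean_cap ->
  invariant_law (Q u) mu -> mu ≡μ nu.
Proof.
move=> u1 inu nuM imu A mA.
have mf (f : state -> \bar R) : measurable_fun setT f.
  by apply: measurable_fun_discrete; exact: mS.
have i1 : mu.-integrable setT (cst 1%E : state -> \bar R).
  exact: finite_measure_integrable_cst.
have h1 : {ae mu, forall x n, setT x ->
    `|run (fun=> u) (\d_x : probability state R) n A| <= 1}.
  apply: aeW => x n _; rewrite gee0_abs//; exact: probability_le1.
have h2 : {ae mu, forall x, setT x ->
    (fun n => run (fun=> u) (\d_x : probability state R) n A) @ \oo --> nu A}.
  by apply: aeW => x _; exact: run_cvg.
have [_ _] := dominated_convergence measurableT
  (fun n => mf (fun x => run (fun=> u) (\d_x : probability state R) n A))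
  (mf (fun=> nu A)) h2 i1 h1.
rewrite integral_probability_cst => h.
apply: (cvg_unique _ _ h) => //.
rewrite (_ : [sequence _]_n = cst (mu A)); first exact: cvg_cst.
apply/funext => n /=; rewrite mixture_run_dirac; exact: run_invariant.
Qed.

End stationary.

(** * Laws of paths *)

Section coupled_mixtures.
Local Open Scope ereal_scope.
Context (R : realType).

Lemma coupled_mixture d d' (S : measurableType d) (E : measurableType d')
    (mS : forall A : set S, measurable A) (dist : E -> E -> R)
    (mu nu : probability S R) (g : probability (S * S)%type R)
    (K K' : S -> probability E R) (cost : S * S -> R) (c : R) :
  discrete S -> discrete E -> (forall x y, 0 <= dist x y)%R ->
  coupling mu nu g -> \int[g]_z (cost z)%:E <= c%:E ->
  (forall z, coupled dist (K z.1) (K' z.2) (cost z)) ->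
  coupled dist (mixture mS mu K) (mixture mS nu K') c.
Proof.
move=> dS dE dist0 cg gc cK; have dSS := discrete_pair dS dS.
have dEE := discrete_pair dE dE.
have /choice[G cG] : forall z, exists h, coupling (K z.1) (K' z.2) h /\
    \int[h]_s (dist s.1 s.2)%:E <= (cost z)%:E.
  by move=> z; have [h h1 h2] := cK z; exists h.
exists (mixture dSS.2 g G).
  by apply: coupling_mixture => // z; exact: (cG z).1.
rewrite (integral_mixture _ _ _ (f := fun z => (dist z.1 z.2)%:E))//; last first.
  by move=> z; rewrite lee_fin.
apply: le_trans gc; apply: discrete_ge0_le_integral => // z; last exact: (cG z).2.
by apply: integral_ge0 => s _; rewrite lee_fin.
Qed.

(** [k] is what the maps add to the cost: the distance of the heads, when paths are extended by
    [cons_path]. *)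
Lemma coupled_image d d' (S : measurableType d) (E : measurableType d')
    (dist : S -> S -> R) (dist' : E -> E -> R) (mu nu : probability S R)
    (X Y : {mfun S >-> E}) (k c : R) :
  discrete S -> discrete E -> (forall x y, 0 <= dist x y)%R ->
  (forall x y, 0 <= dist' x y)%R -> (0 <= k)%R ->
  (forall s t, dist' (X s) (Y t) <= k + dist s t)%R ->
  coupled dist mu nu c ->
  coupled dist' (distribution mu X) (distribution nu Y) (k + c).
Proof.
move=> dS dE dist0 dist'0 k0 h [g cg gc]; have dSS := discrete_pair dS dS.
have dEE := discrete_pair dE dE.
exists (distribution g (dfun dSS.2 (fun z => (X z.1, Y z.2)))).
  exact: coupling_image.
rewrite (integral_law _ _ (f := fun z => (dist' z.1 z.2)%:E))//; last first.
  by move=> z; rewrite lee_fin.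
apply: (@le_trans _ _ (\int[g]_z (k%:E + (dist z.1 z.2)%:E))).
  apply: discrete_ge0_le_integral => // z; first by rewrite lee_fin.
  by rewrite -EFinD lee_fin; exact: h.
rewrite discrete_ge0_integralD//; last by move=> z; rewrite lee_fin.
by rewrite integral_probability_cst EFinD leeD2l.
Qed.

End coupled_mixtures.

Section path_laws.
Context d (S : measurableType d) (R : realType).
Context (mS : forall A : set S, measurable A).

(** The time-inhomogeneous version of [chain_law]: [Ks s] leads from state [s] to state [s + 1].
    Blocks of the array and of stationary chains become instances of one object. *)
Fixpoint path_law (Ks : nat -> S -> probability S R) (mu : probability S R)
    (j : nat) : probability (j.-tuple S) R :=
  match j with
  | 0 => \d_([tuple] : 0.-tuple S)
  | j'.+1 => mixture mS mu (fun x =>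
      distribution (path_law (fun s => Ks s.+1) (Ks 0 x) j') (@cons_path _ S j' x))
  end.

Lemma chain_law_path K mu j : chain_law mS K mu j = path_law (fun=> K) mu j.
Proof.
elim: j mu => //= j IH mu; congr (mixture mS mu _); apply/funext => x.
by rewrite IH.
Qed.

End path_laws.

(** * Stability of path laws over a fixed number of steps *)

Section path_coupling.
Local Open Scope ereal_scope.
Context (R : realType) (q : nat) (hq : (0 < q)%N).
Context (zeta : nat -> R -> probability nat R).
Context (kappa r b L : R) (a : R -> nat -> R) (H : regular q zeta kappa r b L a).

Local Notation dists := (@dist_state R q).
Local Notation state := (q.-tuple nat).
Local Notation mS := (@measurable_state q).
Local Notation dS := (@discrete_state q).
Local Notation Q := (Q_kernel zeta).
Local Notation cap := (mean_cap r b).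

Definition total (x : state) : R := (\sum_(i < q) (nth 0%N x i)%:R)%R.

Lemma total_ge0 (x : state) : (0 <= total x)%R.
Proof. exact: sumr_ge0. Qed.

Lemma dist_path_ge0 j x y : (0 <= @dist_path R j q x y)%R.
Proof. by apply: sumr_ge0 => s _; exact: dist_state_ge0. Qed.

Lemma dist_path_cons j (x y : state) (s t : j.-tuple state) :
  @dist_path R j.+1 q (cons_path x s) (cons_path y t)
  = (dists x y + dist_path R s t)%R.
Proof.
rewrite /dist_path big_ord_recl; congr (_ + _)%R.
by apply: eq_bigr => i _; rewrite /cons_path !tnthS.
Qed.

Lemma mixture_dirac (K : state -> probability state R) x A :
  mixture mS (\d_x : probability state R) K A = K x A.
Proof. exact: integral_diracT dS. Qed.

Lemma Q_mean_bound v x : (v <= 1)%R -> mean_bound (Q v x) (total x + cap)%R.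
Proof.
move=> v1 i iq.
have h : mean_bound (mixture mS (\d_x : probability state R) (Q v)) (total x + cap)%R.
  apply: (mean_bound_step hq H v1).
    by apply: (mean_cap_le H); rewrite lerDr total_ge0.
  apply: mean_bound_le (mean_bound_dirac R x); rewrite lerDl; exact: mean_cap_ge0 H.
apply: le_trans (h i iq); rewrite le_eqVlt; apply/orP; left; apply/eqP.
by apply: integral_eq_measure => A _; exact/esym/mixture_dirac.
Qed.

(** The surviving coordinates cost at most [dists x y], and so does the new one apart from the
    parameter error, since the weights sum to at most [r < 1]. The resulting factor 2 is harmless
    for paths of fixed length. *)
Lemma Q_coupled u v x y e : (u <= 1)%R -> (v <= 1)%R ->
  (L * omega kappa u v <= e)%R ->
  coupled dists (Q u x) (Q v y) (2 * dists x y + e * q%:R * (1 + total y))%R.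
Proof.
move=> u1 v1 we.
have w0 : (0 <= L * omega kappa u v)%R by rewrite mulr_ge0 ?(reg_L H) ?omega_ge0.
have e0 := le_trans w0 we.
apply: (coupled_eq (fun A _ => mixture_dirac (Q u) x A)
                   (fun A _ => mixture_dirac (Q v) y A)).
have [r0 r1] := andP (reg_r H).
pose D : R := dists x y.
(* Entries below q are the actual distances of coordinates; entry q is the bound for the new
   value. *)
pose ee i : R := if (i < q)%N then dist_nat R (nth 0%N x i) (nth 0%N y i)
  else (D + L * omega kappa u v * (q%:R * total y + 1))%R.
have leD i : (i < q)%N -> (dist_nat R (nth 0%N x i) (nth 0%N y i) <= D)%R.
  move=> iq; rewrite /D /dist_state (bigD1 (Ordinal iq))//= !(tnth_nth 0%N) lerDl.
  by apply: sumr_ge0 => k _; exact: dist_nat_ge0.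
have D0 : (0 <= D)%R := dist_state_ge0 _ _ _.
have cd : vcoupled (\d_x : probability state R) \d_y ee.
  eexists; first exact: (coupling_independent mS).
  move=> i iq; rewrite integral_mixture; [|exact: (discrete_pair dS dS)|exact: cdist_ge0].
  rewrite integral_diracT; last exact: dS.
  rewrite integral_law; [|exact: (discrete_pair dS dS)|exact: cdist_ge0].
  by rewrite integral_diracT /ee ?iq//; exact: dS.
have /vcoupled_coupled : vcoupled (mixture mS (\d_x : probability state R) (Q u))
    (mixture mS (\d_y : probability state R) (Q v)) (fun i => ee i.+1).
  apply: (vcoupled_step hq H u1 v1 _ cd); first exact: mean_bound_dirac.
  rewrite {2}/ee ltnn lerD2r.
  apply: (@le_trans _ _ (\sum_(1 <= j < q.+1) a u j * D)%R).
    rewrite big_nat [leRHS]big_nat; apply: ler_sum => j /andP[j1 jq].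
    have qj : (q - j < q)%N by rewrite ltn_subrL hq (leq_trans _ j1).
    by rewrite ler_wpM2l ?(reg_a0 H)// /ee qj leD.
  rewrite -mulr_suml ler_piMl// (le_trans (reg_sum H u1))// ltW//.
apply: coupled_le.
have De : (\sum_(i < q) ee i = D)%R.
  by apply: eq_bigr => i _; rewrite /ee ltn_ord !(tnth_nth 0%N).
have : (ee 0%N + \sum_(i < q) ee i.+1 = D + ee q)%R.
  by rewrite -De -(big_ord_recr q ee) big_ord_recl.
have e00 : (0 <= ee 0%N)%R by rewrite /ee hq dist_nat_ge0.
rewrite [ee q]/ee ltnn => E.
apply: (@le_trans _ _ (D + (D + L * omega kappa u v * (q%:R * total y + 1)))%R).
  by rewrite -E lerDr.
rewrite -mulrA.
have h1 : (1 <= q%:R :> R)%R by rewrite ler1n.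
have := total_ge0 y; rewrite -/D => t0.
have : (L * omega kappa u v * (q%:R * total y + 1) <= e * (q%:R * (1 + total y)))%R.
  apply: ler_pM => //; first by rewrite addr_ge0// mulr_ge0.
  by rewrite mulrDr mulr1 addrC lerD2r.
by lra.
Qed.

Lemma integral_affine2 d (S : measurableType d) (g : probability S R)
    (f h : S -> R) (A B C F G : R) :
  discrete S -> (forall x, 0 <= f x)%R -> (forall x, 0 <= h x)%R ->
  (0 <= A)%R -> (0 <= B)%R -> (0 <= C)%R ->
  \int[g]_x (f x)%:E <= F%:E -> \int[g]_x (h x)%:E <= G%:E ->
  \int[g]_x (A * f x + B * h x + C)%R%:E <= (A * F + B * G + C)%R%:E.
Proof.
move=> dS' f0 h0 A0 B0 C0 fF hG.
pose pk (X : Type) (x y : X) (j : nat) : X := if j is 0 then x else y.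
have := @integral_affine _ _ _ g (pk _ f h) (pk _ A B) C (pk _ F G) [:: 0%N; 1%N] dS'.
rewrite !big_cons big_nil /= addr0; under eq_integral do rewrite !big_cons big_nil /= addr0.
apply => //; first by case.
- by case.
- by move=> j; rewrite !inE => /orP[|] /eqP ->.
Qed.

(** Induction on the length: the heads are coupled at cost [D]; given the pair of heads, the tails
    start from one-step laws, to which [Q_coupled] and the induction hypothesis apply. [A] and [B]
    are fixed before laws and parameters. [us] is constrained only at steps inside the path, because
    later times of the array may lie beyond 1. *)
Lemma path_coupled j : exists A B : R, [/\ (0 <= A)%R, (0 <= B)%R &
  forall (us vs : nat -> R) (mu nu : probability state R) (e D M : R),
  (forall t, (t.+1 < j)%N -> us t <= 1)%R -> (forall t, vs t <= 1)%R ->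
  (forall t, (t.+1 < j)%N -> L * omega kappa (us t) (vs t) <= e)%R ->
  (0 <= e)%R -> (0 <= D)%R ->
  coupled dists mu nu D -> mean_bound nu M ->
  coupled (@dist_path R j q)
    (path_law mS (fun t => Q (us t)) mu j) (path_law mS (fun t => Q (vs t)) nu j)
    (A * D + e * B * (1 + M))%R].
Proof.
elim: j => [|j [A [B [A0 B0 IH]]]].
  exists 0%R, 0%R; split => // us vs mu nu e D M *; rewrite mul0r mulr0 mul0r add0r.
  apply: coupled_refl; first exact: discrete_path.
    exact: dist_path_ge0.
  by move=> x; rewrite /dist_path big1// => i _; exact: dist_statexx.
have q1 : (1 <= q%:R :> R)%R by rewrite ler1n.
have q0 : (0 <= q%:R :> R)%R by [].
have c0 := mean_cap_ge0 H.
exists (1 + 2 * A)%R, ((A * q%:R + B * (1 + cap)) * q%:R)%R; split.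
- by rewrite addr_ge0// mulr_ge0.
- by rewrite mulr_ge0// addr_ge0// mulr_ge0// addr_ge0.
move=> us vs mu nu e D M us1 vs1 he e0 D0 [g cg gD] nuM.
have M0 : (0 <= M)%R by rewrite -lee_fin (le_trans (cmean_ge0 nu 0)) ?nuM.
have e'0 : (0 <= e * A * q%:R)%R by rewrite !mulr_ge0.
have e'1 : (0 <= e * B)%R by rewrite mulr_ge0.
(* The distance of the heads plus the bound for the tails, expanded to be affine in [dists z.1 z.2]
   and [total z.2]. *)
pose cost (z : state * state) : R := ((1 + 2 * A) * dists z.1 z.2 +
  (e * A * q%:R + e * B) * total z.2 + (e * A * q%:R + e * B * (1 + cap)))%R.
have dSS := discrete_pair dS dS.
have total_int : \int[g]_z (total z.2)%:E <= (q%:R * M)%:E.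
  rewrite (coupling_snd (f := fun x => (total x)%:E) dS cg); last first.
    by move=> x; rewrite lee_fin total_ge0.
  under eq_integral do rewrite -sumEFin.
  rewrite ge0_integral_sum//.
  - apply: (@le_trans _ _ (\sum_(i < q) M%:E)); first by apply: lee_sum => i _; exact: nuM.
    by rewrite sumEFin sumr_const card_ord mulr_natl.
  - by move=> i; apply: measurable_fun_discrete; exact: mS.
have cost_int : \int[g]_z (cost z)%:E <= ((1 + 2 * A) * D
    + e * ((A * q%:R + B * (1 + cap)) * q%:R) * (1 + M))%R%:E.
  have A1 : (0 <= 1 + 2 * A)%R by rewrite addr_ge0// mulr_ge0.
  have B1 : (0 <= e * A * q%:R + e * B)%R by exact: addr_ge0.
  have C1 : (0 <= e * A * q%:R + e * B * (1 + cap))%R.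
    by rewrite addr_ge0// mulr_ge0// addr_ge0.
  apply: (le_trans (integral_affine2 dSS (fun z => dist_state_ge0 _ z.1 z.2)
    (fun z => total_ge0 z.2) A1 B1 C1 gD total_int)).
  rewrite lee_fin -addrA lerD2l.
  have /ler_wpM2l : (0 <= e * A * q%:R + e * B * (1 + cap))%R.
    by rewrite addr_ge0// mulr_ge0// addr_ge0.
  move=> /(_ _ _ q1).
  have := mulr_ge0 (mulr_ge0 e'1 c0) (mulr_ge0 q0 M0).
  by lra.
pose K (ws : nat -> R) (x : state) : probability (j.+1.-tuple state) R :=
  distribution (path_law mS (fun s => Q (ws s.+1)) (Q (ws 0%N) x) j)
    (@cons_path _ state j x).
apply: (@coupled_mixture R _ _ _ _ mS (@dist_path R j.+1 q) mu nu g (K us) (K vs)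
  cost _ dS _ _ cg cost_int).
- exact: discrete_path.
- exact: dist_path_ge0.
move=> z.
have [k [k0 kle kc]] : exists k, [/\ (0 <= k)%R,
    (dists z.1 z.2 + k <= cost z)%R &
    coupled (@dist_path R j q)
      (path_law mS (fun s => Q (us s.+1)) (Q (us 0%N) z.1) j)
      (path_law mS (fun s => Q (vs s.+1)) (Q (vs 0%N) z.2) j) k].
  have d0 : (0 <= dists z.1 z.2)%R := dist_state_ge0 _ _ _.
  have t0 := total_ge0 z.2.
  have X0 : (0 <= 2 * dists z.1 z.2 + e * q%:R * (1 + total z.2))%R.
    by rewrite addr_ge0 ?mulr_ge0 ?addr_ge0.
  have k0 := addr_ge0 (mulr_ge0 A0 X0) (mulr_ge0 e'1 (addr_ge0 ler01 (addr_ge0 t0 c0))).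
  exists (A * (2 * dists z.1 z.2 + e * q%:R * (1 + total z.2))
          + e * B * (1 + (total z.2 + cap)))%R; split.
  - exact: k0.
  - by rewrite /cost le_eqVlt; apply/orP; left; apply/eqP; ring.
  (* A path with a single state has an empty tail, which costs nothing; [us 0 <= 1] is available
     only when there is a step to make. *)
  case: j IH us1 he {cost cost_int K} => [|j] IH us1 he.
    apply: (coupled_le k0).
    apply: coupled_refl; [exact: discrete_path|exact: dist_path_ge0|].
    by move=> x; rewrite /dist_path big_ord0.
  apply: IH => //.
  - by move=> t tj; exact: us1.
  - by move=> t tj; exact: he.
  - by apply: Q_coupled => //; [exact: us1|exact: he].
  - exact: Q_mean_bound.
apply: coupled_le kle _.
apply: (coupled_image (dist := @dist_path R j q)) => //.
- exact: discrete_path.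
- exact: discrete_path.
- exact: dist_path_ge0.
- exact: dist_path_ge0.
- exact: dist_state_ge0.
- by move=> s t; rewrite dist_path_cons.
Qed.

End path_coupling.

(** * Independence and the Markov property *)

Section events.
Local Open Scope ereal_scope.
Context d (T : measurableType d) (R : realType) (P : probability T R).

Lemma restricted_law d' (S : measurableType d') (Z : {mfun T >-> S}) (A : set T) :
  discrete S -> measurable A ->
  exists nu : {measure set S -> \bar R}, forall B, nu B = P (A `&` Z @^-1` B).
Proof.
move=> dS mA.
pose m : {measure set T -> \bar R} := mrestr P mA.
pose nu : {measure set S -> \bar R} := pushforward m Z.
exists (nu (@measurable_funPT _ _ _ _ Z)) => B.
by rewrite /pushforward /mrestr setIC.
Qed.

Lemma measurable_preimage d' (S : measurableType d') (Z : {mfun T >-> S}) B :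
  discrete S -> measurable (Z @^-1` B).
Proof. by move=> [_ mS]; rewrite -[X in measurable X]setTI; exact: measurable_funP. Qed.

Lemma integral_comp_discrete d' (S : measurableType d') (Z : {mfun T >-> S})
    (A : set T) (nu : {measure set S -> \bar R}) (f : S -> \bar R) :
  discrete S -> measurable A -> (forall x, 0 <= f x) ->
  (forall B, nu B = P (A `&` Z @^-1` B)) ->
  \int[nu]_x f x = \int[P]_(w in A) f (Z w).
Proof.
move=> dS mA f0 nuE.
rewrite (integral_disintegration (m := P) (D := A) (K := fun w => \d_(Z w)) dS mA)//.
- by apply: eq_integral => w _; rewrite integral_diracT.
- move=> B; have mB : measurable (Z @^-1` B) by exact: measurable_preimage.
  apply: (eq_measurable_fun (fun w => (\1_(Z @^-1` B) w)%:E)) => //.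
  by apply/measurable_EFinP; exact: measurable_indic.
- move=> B; have mB : measurable (Z @^-1` B) by exact: measurable_preimage.
  by rewrite nuE setIC -integral_indic//; apply: eq_integral.
Qed.

Lemma integral_comp_kernel d' (S : measurableType d') (Z : {mfun T >-> S})
    (A : set T) (K : T -> {measure set S -> \bar R}) (f : S -> \bar R) :
  discrete S -> measurable A -> (forall x, 0 <= f x) ->
  (forall B, measurable_fun A (fun w => K w B)) ->
  (forall B, P (A `&` Z @^-1` B) = \int[P]_(w in A) K w B) ->
  \int[P]_(w in A) f (Z w) = \int[P]_(w in A) \int[K w]_x f x.
Proof.
move=> dS mA f0 mK PK; have [nu nuE] := restricted_law Z dS mA.
rewrite -(integral_comp_discrete dS mA f0 nuE).
by apply: integral_disintegration => // B; rewrite nuE.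
Qed.

Lemma measurable_comp_discrete d' (S : measurableType d') (Z : {mfun T >-> S})
    (A : set T) (f : S -> \bar R) : discrete S -> measurable_fun A (f \o Z).
Proof.
move=> dS; apply: (measurable_funS measurableT) => //.
by apply: measurableT_comp => //; apply: measurable_fun_discrete; exact: dS.2.
Qed.

(** [h x] is the conditional probability of [W] given [Z = x] inside [A]; the values of [Z] split
    [A] into countably many pieces on which [h] is constant. *)
Lemma discrete_total_probability d' (S : measurableType d') (Z : {mfun T >-> S})
    (A W : set T) (h : S -> \bar R) :
  discrete S -> measurable A -> measurable W -> (forall x, 0 <= h x) ->
  (forall x, P (A `&` Z @^-1` [set x] `&` W) = P (A `&` Z @^-1` [set x]) * h x) ->
  P (A `&` W) = \int[P]_(w in A) h (Z w).
Proof.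
move=> dS mA mW h0 PhE; have [/countable_injP[g ginj] mS] := dS.
pose F n := A `&` Z @^-1` [set x | g x = n].
have mF n : measurable (F n) by apply: measurableI => //; exact: measurable_preimage.
have UF : \bigcup_n F n = A.
  by apply/seteqP; split => [w [n _ []]//|w Aw]; exists (g (Z w)).
have tF : trivIset setT F.
  by move=> i j _ _ [w [[_ /= gi] [_ /= gj]]]; rewrite -gi -gj.
transitivity (\int[P]_(w in A) (\1_W w)%:E).
  by rewrite integral_indic// setIC.
rewrite -UF !ge0_integral_bigcup//; first last.
- by rewrite UF; apply/measurable_EFinP; exact: measurable_indic.
- by rewrite UF; exact: (measurable_comp_discrete Z h dS).
apply: eq_eseriesr => n _.
have [[x gx]|nx] := pselect (exists x, g x = n); last first.
  rewrite (_ : F n = set0) ?integral_set0//.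
  by apply/seteqP; split => // w [_ /= gw]; apply: nx; exists (Z w).
have Fx : F n = A `&` Z @^-1` [set x].
  apply/seteqP; split => w [Aw /= gw]; split => //=; last by rewrite gw.
  by apply: ginj; rewrite ?inE// gx.
rewrite integral_indic// Fx.
transitivity (P (A `&` Z @^-1` [set x] `&` W)); first by rewrite setIC.
rewrite PhE muleC -integral_cst//; last by rewrite -Fx.
by apply: eq_integral => w; rewrite inE => -[_ /= ->].
Qed.

End events.

(** * Laws of sums of independent variables *)

Section independent_sums.
Local Open Scope ereal_scope.
Context d (T : measurableType d) (R : realType) (P : probability T R).
Context (I : choiceType) (D : set I) (V : I -> {mfun T >-> nat}).
Context (iV : mutually_independent P D (fun a => V a : T -> nat)).

Let event (F : {fset I}) (B : I -> set nat) : set T :=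
  \bigcap_(a in [set` F]) (V a @^-1` B a).

(** [J] records the indices already consumed by [U]: besides having law [mu], [U] is independent of
    the remaining variables. Finite cylinders are what mutual independence speaks of, and testing
    against them keeps the property stable when one more variable is added. *)
Definition indep_law (J : set I) (U : T -> nat) (mu : probability nat R) :=
  measurable_fun setT U /\
  forall (F : {fset I}) (B : I -> set nat) C, [set` F] `<=` D `\` J ->
    P (event F B `&` U @^-1` C) = P (event F B) * mu C.

Let measurable_event F B : measurable (event F B).
Proof.
apply: fin_bigcap_measurable => [|a _]; first exact: finite_fset.
exact: measurable_preimage discrete_nat.
Qed.

Let event1 F B a C : a \notin F ->
  event F B `&` V a @^-1` C = event (a |` F)%fset (fun b => if b == a then C else B b).
Proof.
move=> aF; apply/seteqP; split=> [w [h wC] b /=|w h].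
  rewrite in_fset1U => /orP[/eqP ->|bF]; first by rewrite eqxx.
  by case: eqP => [ba|_]; [rewrite -ba bF in aF|exact: h].
split=> [b /= bF|]; last by have := h a; rewrite /= fset1U1 eqxx; apply.
have := h b; rewrite /= in_fset1U bF orbT => /(_ isT).
by case: eqP => // ba; rewrite -ba bF in aF.
Qed.

Let event_indep F B a C : D a -> [set` F] `<=` D `\` [set a] ->
  P (event F B `&` V a @^-1` C) = P (event F B) * P (V a @^-1` C).
Proof.
move=> Da FD; have aF : a \notin F.
  by apply/negP => aF; have [_ /=] := FD _ aF; apply.
rewrite event1// iV; last first.
  by move=> b /=; rewrite in_fset1U => /orP[/eqP ->//|/FD[]].
rewrite big_fsetU1//= eqxx muleC iV; last by move=> b /FD[].
congr (_ * _); apply: eq_big_seq => b bF.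
by case: eqP => // ba; rewrite -ba bF in aF.
Qed.

Lemma indep_law_sub J J' U mu : J `<=` J' -> indep_law J U mu -> indep_law J' U mu.
Proof.
move=> JJ [mU h]; split => // F B C FD; apply: h => b /FD[Db nJb]; split => //.
by move=> /JJ.
Qed.

Lemma indep_law_eq J U U' (mu mu' : probability nat R) : (forall w, U w = U' w) ->
  (forall A, mu A = mu' A) -> indep_law J U mu -> indep_law J U' mu'.
Proof.
move=> UU mm [mU h]; have <- : U = U' by apply/funext.
by split => // F B C FD; rewrite -mm; exact: h.
Qed.

Lemma indep_law1 a (mu : probability nat R) : D a ->
  (forall A, P (V a @^-1` A) = mu A) -> indep_law [set a] (V a) mu.
Proof.
move=> Da Vmu; split => [|F B C FD]; first exact: measurable_funP.
by rewrite event_indep// Vmu.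
Qed.

(** Condition on the value of [V a]: since [a] lies outside [J], the event [V a = i] joins the
    cylinder, of which [U] is still independent. *)
Lemma indep_law_add a J U mu (nu : probability nat R) : D a -> ~ J a ->
  (forall A, P (V a @^-1` A) = nu A) -> indep_law J U mu ->
  indep_law (a |` J) (fun w => V a w + U w)%N (Defs.conv nu mu).
Proof.
move=> Da nJa Vnu [mU h]; have dN := discrete_nat.
have msum : measurable_fun setT (fun w => (V a w + U w)%N).
  move=> _ C _; rewrite setTI.
  rewrite (_ : _ @^-1` _ = \bigcup_i (V a @^-1` [set i] `&` U @^-1` [set t | C (i + t)%N])).
    apply: bigcup_measurable => i _; apply: measurableI.
      exact: measurable_preimage.
    by rewrite -[X in measurable X]setTI; exact: mU.
  by apply/seteqP; split=> [w /= Cw|w [i _ [/= -> //]]]; exists (V a w).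
split => // F B C FD.
have FDa : [set` F] `<=` D `\` [set a].
  by move=> b /FD[Db nb]; split => // ba; apply: nb; left.
have FJ : [set` F] `<=` D `\` J.
  by move=> b /FD[Db nb]; split => // Jb; apply: nb; right.
have aF : a \notin F.
  by apply/negP => aF; have [_ /=] := FDa _ aF; apply.
pose h' i := mu [set t | C (i + t)%N].
rewrite (discrete_total_probability (Z := V a) (h := h'))//; first last.
- move=> i.
  rewrite (_ : _ `&` _ = event F B `&` V a @^-1` [set i] `&`
      U @^-1` [set t | C (i + t)%N]); last first.
    by apply/seteqP; split=> w [[EF /= Vi] CU]; split => //=; rewrite Vi in CU *.
  rewrite event1// h//; move=> b /=; rewrite in_fset1U => /orP[/eqP ->//|/FJ//].
- by rewrite -[X in measurable X]setTI; exact: msum.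
(* The law of [V a] restricted to the cylinder is [nu] scaled by this number. *)
have PE0 : (0 <= fine (P (event F B)))%R by rewrite fine_ge0.
have PEE : (fine (P (event F B)))%:E = P (event F B).
  by rewrite fineK// fin_num_measure.
rewrite -(integral_comp_discrete (Z := V a) (nu := mscale (NngNum PE0) nu))//.
  by rewrite convE ge0_integral_mscale//; congr (_ * _); exact: PEE.
by move=> A; rewrite event_indep// Vnu; congr (_ * _); exact: PEE.
Qed.

End independent_sums.

Section convolution_assoc.
Local Open Scope ereal_scope.
Context (R : realType).

Lemma conv_eq (mu nu nu' : probability nat R) A :
  (forall B, nu B = nu' B) -> Defs.conv mu nu A = Defs.conv mu nu' A.
Proof. by move=> h; rewrite !convE; apply: eq_integral => x _; exact: h. Qed.

Lemma convA (a b c : probability nat R) A :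
  Defs.conv (Defs.conv a b) c A = Defs.conv a (Defs.conv b c) A.
Proof.
rewrite [LHS]convE [RHS]convE.
transitivity (\int[Defs.conv a b]_s c [set t | A (s + t)%N]) => //.
rewrite integral_conv//.
apply: eq_integral => x _.
transitivity (Defs.conv b c [set t | A (x + t)%N]) => //.
rewrite convE; apply: eq_integral => y _; congr (c _).
by apply/seteqP; split=> z /=; rewrite /dfun /= addnA.
Qed.

(** Reconciles two bracketings: in [S_law] each block of offspring starts from [delta0], while
    summing the noise puts each block on top of the remaining sum. *)
Lemma conv_iter n (mu nu : probability nat R) A :
  Defs.conv (iter n (Defs.conv mu) (delta0 R)) nu A = iter n (Defs.conv mu) nu A.
Proof.
elim: n A => [|n IH] A; first exact: conv0.
by rewrite !iterS convA; apply: conv_eq => B; exact: IH.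
Qed.

End convolution_assoc.

Section generated_sigma.
Context d (T : measurableType d) (I : Type) d' (E : measurableType d').
Context (D : set I) (V : I -> T -> E).

Let G := \bigcup_(a in D) preimage_set_system setT (V a) measurable.

Lemma sigma_genI A B : sigma_gen D V A -> sigma_gen D V B -> sigma_gen D V (A `&` B).
Proof. exact: (@measurableI _ (g_sigma_algebraType G)). Qed.

Lemma sigma_genT : sigma_gen D V setT.
Proof. exact: (@measurableT _ (g_sigma_algebraType G)). Qed.

Lemma sigma_gen_preimage a B : D a -> measurable B -> sigma_gen D V (V a @^-1` B).
Proof.
move=> Da mB; apply: sub_sigma_algebra; exists a => //; exists B => //.
by rewrite setTI.
Qed.

Lemma sigma_gen_measurable A : (forall a, D a -> measurable_fun setT (V a)) ->
  sigma_gen D V A -> measurable A.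
Proof.
move=> mV; apply: smallest_sub; first exact: sigma_algebra_measurable.
by move=> _ [a Da [B mB <-]]; exact: mV.
Qed.

Lemma measurable_sigma_gen a : D a ->
  measurable_fun setT (V a : g_sigma_algebraType G -> E).
Proof.
by move=> Da _ B mB; rewrite setTI; exact: sigma_gen_preimage.
Qed.

End generated_sigma.

Lemma sigma_gen_sub d (T : measurableType d) (I I' : Type)
    d1 (E : measurableType d1) d2 (E' : measurableType d2)
    (D : set I) (V : I -> T -> E) (D' : set I') (V' : I' -> T -> E') :
  (forall a B, D a -> measurable B -> sigma_gen D' V' (V a @^-1` B)) ->
  sigma_gen D V `<=` sigma_gen D' V'.
Proof.
move=> h; apply: smallest_sub; first exact: smallest_sigma_algebra.
by move=> _ [a Da [B mB <-]]; rewrite setTI; exact: h.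
Qed.

Lemma measurable_sumn d (T : measurableType d) (I : eqType) (r : seq I)
    (F : I -> T -> nat) :
  (forall i, i \in r -> measurable_fun setT (F i)) ->
  measurable_fun setT (fun w => \sum_(i <- r) F i w)%N.
Proof.
elim: r => [|i r IH] mF.
  by under eq_fun do rewrite big_nil; exact: measurable_cst.
under eq_fun do rewrite big_cons.
apply: measurable_fun_addn; first by apply: mF; rewrite mem_head.
by apply: IH => j jr; apply: mF; rewrite in_cons jr orbT.
Qed.

Lemma probability_ae_eq d (T : measurableType d) (R : realType)
    (P : probability T R) (A B : set T) : measurable A -> measurable B ->
  {ae P, forall w, A w <-> B w} -> P A = P B.
Proof.
move=> mA mB AB; rewrite -(setIT A) -(setIT B) -!(integral_indic P measurableT)//.
apply: ge0_ae_eq_integral => //.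
- by apply/measurable_EFinP; exact: measurable_indic.
- by apply/measurable_EFinP; exact: measurable_indic.
- apply: filterS AB => w AB _; rewrite /indic; congr ((nat_of_bool _)%:R%:E).
  by apply/idP/idP => /set_mem/AB/mem_set.
Qed.

(** * The Markov property of the array *)

Section tv_inar_markov.
Context (R : realType) (q : nat) (hq : (0 < q)%N).
Context d (T : measurableType d) (P : probability T R).
Context (zeta : nat -> R -> probability nat R) (pi0 : probability (q.-tuple nat) R).
Context (X : nat -> int -> {RV P >-> nat})
  (Y : nat -> int -> nat -> nat -> {RV P >-> nat})
  (eta : nat -> int -> {RV P >-> nat}) (c : q.-tuple nat).
Context (tv : tv_inar zeta pi0 X Y eta c).

Local Notation st := (q.-tuple nat).
Local Notation mS := (@measurable_state q).
Local Notation dS := (@discrete_state q).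
Local Notation Q := (Q_kernel zeta).
Local Notation past := (past X c).
Local Notation state := (state X c).
Local Notation time := (time R).

Definition noise_mfun n (a : int * option (nat * nat)) : {mfun T >-> nat} :=
  match a.2 with
  | Some ji => Y n a.1 ji.1 ji.2
  | None => eta n a.1
  end.

Lemma noise_mfunE n : (fun a => noise_mfun n a : T -> nat) = noise Y eta n.
Proof. by apply/funext => -[k [[j i]|]]. Qed.

(** The recursion with population sizes fixed by [x]: the number of summands is deterministic, and
    the sum is a function of the noise at time [k] alone. *)
Definition step_sum n k (x : st) (w : T) : nat :=
  (\sum_(1 <= j < q.+1) \sum_(1 <= i < (nth 0%N x (q - j)).+1) Y n k j i w
   + eta n k w)%N.

Section at_time.
Context (n : nat) (n0 : (0 < n)%N) (k : int) (kn : k <= n%:Z).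

Let D := [set a : int * option (nat * nat) | a.1 <= n%:Z /\ noise_index q a].

Let indep : mutually_independent P D (fun a => noise_mfun n a : T -> nat).
Proof. by rewrite noise_mfunE; exact: (noise_indep tv). Qed.

Local Notation z j := (zeta j (frozen (time n k))).

Lemma indep_law_block j m J U (mu : probability nat R) : (1 <= j <= q)%N ->
  (forall i, ~ J (k, Some (j, i))) ->
  indep_law P D (noise_mfun n) J U mu ->
  indep_law P D (noise_mfun n)
    (J `|` [set a | exists2 i, (i <= m)%N & a = (k, Some (j, i))])
    (fun w => \sum_(1 <= i < m.+1) Y n k j i w + U w)%N
    (iter m (Defs.conv (z j)) mu).
Proof.
move=> jq nJ hU; elim: m => [|m IH].
  apply: (@indep_law_sub _ _ _ _ _ _ _ J); first by move=> a; left.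
  by apply: indep_law_eq hU => // w; rewrite big_geq.
have Da : D (k, Some (j, m.+1)) by split.
have := indep_law_add indep Da _ _ IH.
move=> /(_ (z j)) h.
apply: (@indep_law_sub _ _ _ _ _ _ _
  ((k, Some (j, m.+1)) |` (J `|` [set a | exists2 i, (i <= m)%N & a = (k, Some (j, i))]))).
  move=> a [->|[Ja|[i im ->]]]; [by right; exists m.+1|by left|].
  by right; exists i => //; exact: leqW.
apply: indep_law_eq (h _ _) => //.
- by move=> w; rewrite [in RHS]big_nat_recr//= /noise_mfun/= addnCA addnA.
- by move=> [|[i im [/eqP]]]; [exact: nJ|rewrite eqn_leq => /andP[mi _]; rewrite leqNgt ltnS im in mi].
- by move=> A; exact: (Y_law tv).
Qed.

(** The immigration comes first and the lags are added one at a time; [uniq] guarantees that a new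
    block of offspring has not been consumed yet. *)
Lemma indep_law_step_sum (x : st) r : uniq r -> (forall j, j \in r -> (1 <= j <= q)%N) ->
  indep_law P D (noise_mfun n)
    [set a | a = (k, None) \/ exists j i, j \in r /\ a = (k, Some (j, i))]
    (fun w => \sum_(j <- r) \sum_(1 <= i < (nth 0%N x (q - j)).+1) Y n k j i w
       + eta n k w)%N
    (Defs.conv (\big[@Defs.conv R/delta0 R]_(j <- r)
        iter (nth 0%N x (q - j)) (Defs.conv (z j)) (delta0 R)) (z q.+1)).
Proof.
elim: r => [|j r IH].
  move=> _ _.
  apply: (@indep_law_sub _ _ _ _ _ _ _ [set (k, None)]); first by move=> a ->; left.
  apply: indep_law_eq (indep_law1 (mu := z q.+1) indep (a := (k, None)) _ _).
  - by move=> w; rewrite big_nil add0n.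
  - by move=> A; rewrite big_nil conv0.
  - by split.
  - by move=> A; exact: (eta_law tv).
move=> /= /andP[jr ur] hr.
have {}IH := IH ur (fun j' h => hr j' (mem_behead (s := j :: r) h)).
have jq : (1 <= j <= q)%N by apply: hr; rewrite mem_head.
have := indep_law_block (nth 0%N x (q - j)) jq _ IH.
move=> h; apply: (@indep_law_sub _ _ _ _ _ _ _ _ _ _ _ _ (indep_law_eq _ _ (h _))).
- move=> a [[->|[j' [i [j'r ->]]]]|[i _ ->]]; [by left| |].
  + by right; exists j', i; rewrite in_cons j'r orbT.
  + by right; exists j, i; rewrite mem_head.
- by move=> w; rewrite big_cons addnA.
- by move=> A; rewrite big_cons convA conv_iter.
- by move=> i [//|[j' [i' [j'r [e _]]]]]; rewrite e j'r in jr.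
Qed.

Lemma step_sum_law x C : P (step_sum n k x @^-1` C) = S_law zeta (time n k) x C.
Proof.
have hr j : j \in index_iota 1 q.+1 -> (1 <= j <= q)%N by rewrite mem_index_iota.
(* The empty cylinder is the whole space, which leaves the law itself. *)
have [_ /(_ fset0 (fun=> setT) C)] := indep_law_step_sum x (iota_uniq _ _) hr.
rewrite (_ : \bigcap_(a in _) _ = setT); last by apply/seteqP; split.
rewrite setTI probability_setT mul1e; apply.
by move=> a.
Qed.

Lemma step_sum_noise x C : sigma_gen [set a | a.1 = k /\ noise_index q a]
  (noise Y eta n) (step_sum n k x @^-1` C).
Proof.
set Dk := [set a | _]; set V := noise Y eta n.
pose G := \bigcup_(a in Dk) preimage_set_system setT (V a) measurable.
have mV a : Dk a -> measurable_fun setT (V a : g_sigma_algebraType G -> nat).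
  exact: measurable_sigma_gen.
suff mstep : measurable_fun setT (step_sum n k x : g_sigma_algebraType G -> nat).
  by have := mstep measurableT C I; rewrite setTI.
apply: measurable_fun_addn; last by apply: (mV (k, None)).
apply: measurable_sumn => j; rewrite mem_index_iota => jq.
apply: measurable_sumn => i; rewrite mem_index_iota => /andP[i1 _].
by apply: (mV (k, Some (j, i))).
Qed.

End at_time.

Lemma past_measurable n k A : past n k A -> measurable A.
Proof.
by apply: sigma_gen_measurable => l _; exact: measurable_funP.
Qed.

Lemma past_mono n k k' : k <= k' -> past n k `<=` past n k'.
Proof.
move=> kk; apply: sigma_gen_sub => l B /= lk mB; apply: sigma_gen_preimage => //=.
exact: le_trans kk.
Qed.

Lemma past_state n k B : past n k (state n k @^-1` B).
Proof. by apply: sigma_gen_preimage => //=; exact: mS. Qed.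

(** Translates the past of the vectors into that of the scalar process, in terms of which the
    independence of the noise is assumed; up to time [n] no vector is replaced by the constant
    [c]. *)
Lemma past_sub_X n k : k <= n%:Z ->
  past n k `<=` sigma_gen [set l : int | l < k + 1] (fun l => X n l : T -> nat).
Proof.
move=> kn; apply: sigma_gen_sub => l B /= lk mB.
set D := [set l : int | _]; set V := (fun l => _).
pose G := \bigcup_(a in D) preimage_set_system setT (V a) measurable.
have ln : l <= n%:Z by exact: le_trans kn.
suff ml : measurable_fun setT (state n l : g_sigma_algebraType G -> st).
  by have := ml measurableT B mB; rewrite setTI.
rewrite /Defs.state ln; apply/measurable_fun_tnthP => i.
apply: (eq_measurable_fun (X n (l - q%:Z + 1 + (i : nat)%:Z) : g_sigma_algebraType G -> nat)).
  by move=> w _; rewrite /= tnth_mktuple.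
apply: (measurable_sigma_gen (V := V)); rewrite /D/=.
have := ltn_ord i; lia.
Qed.

Lemma state_shift n (k : int) x w : k + 1 <= n%:Z -> state n k w = x ->
  state n (k + 1) w = shift_in x (X n (k + 1) w) /\
  forall j, (1 <= j <= q)%N -> X n (k + 1 - j%:Z) w = nth 0%N x (q - j).
Proof.
move=> kn sx; have kn' : k <= n%:Z by lia.
have xE i : (i < q)%N -> nth 0%N x i = X n (k - q%:Z + 1 + i%:Z) w.
  move=> iq; rewrite -sx -[i in LHS]/(nat_of_ord (Ordinal iq)) -tnth_nth.
  by rewrite /Defs.state kn' tnth_mktuple.
split => [|j /andP[j1 jq]]; last first.
  by rewrite xE; [congr (X n _ w); lia|lia].
apply: eq_from_tnth => i; rewrite [RHS](tnth_nth 0%N) nth_shift_in//.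
rewrite /Defs.state kn tnth_mktuple; case: ltnP => iq.
  by rewrite xE//; congr (X n _ w); lia.
by congr (X n _ w); have := ltn_ord i; lia.
Qed.

(** The Markov property. Where the state at [k] is [x], the recursion coincides almost surely with
    [step_sum] at [x], which has law [S_law] and is independent of the past. *)
Lemma one_step n (k : int) A B : (0 < n)%N -> k + 1 <= n%:Z -> past n k A ->
  P (A `&` state n (k + 1) @^-1` B) =
  (\int[P]_(w in A) Q (time n (k + 1)) (state n k w) B)%E.
Proof.
move=> n0 kn pA; have mA := past_measurable pA.
have kn' : k <= n%:Z by lia.
apply: (discrete_total_probability (Z := state n k)
  (h := fun x => Q (time n (k + 1)) x B)) => //; first exact: dS.
  exact: measurable_preimage dS.
move=> x; set A' := A `&` _.
have pA' : past n k A' by apply: sigma_genI => //; exact: past_state.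
have mA' := past_measurable pA'.
have sN := @step_sum_noise n (k + 1) x (shift_in x @^-1` B).

have mN : measurable (step_sum n (k + 1) x @^-1` (shift_in x @^-1` B)).
  apply: (sigma_gen_measurable _ sN) => a _; case: a => [l [[j i]|]]; exact: measurable_funP.
have -> : P (A' `&` state n (k + 1) @^-1` B) =
    P (A' `&` step_sum n (k + 1) x @^-1` (shift_in x @^-1` B)).
  apply: probability_ae_eq; [|exact: measurableI|].
    by apply: measurableI => //; exact: measurable_preimage dS.
  apply: filterS (inar_rec tv n0 kn) => w /= wE.
  suff h : A' w -> state n (k + 1) w = shift_in x (step_sum n (k + 1) x w).
    by split => -[Aw]; rewrite /= => Bw; split => //=; [rewrite -h|rewrite h].
  move=> [_ /= sx]; have [-> xE] := state_shift kn sx.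
  congr (shift_in x _); rewrite wE; congr addn.
  by apply: eq_big_nat => j jq; rewrite xE.
rewrite setIC (noise_indep_past tv n0 kn sN); last exact: (past_sub_X kn').
by rewrite muleC step_sum_law.
Qed.

End tv_inar_markov.

Section tv_inar_laws.
Context (R : realType) (q : nat) (hq : (0 < q)%N).
Context d (T : measurableType d) (P : probability T R).
Context (zeta : nat -> R -> probability nat R) (pi0 : probability (q.-tuple nat) R).
Context (X : nat -> int -> {RV P >-> nat})
  (Y : nat -> int -> nat -> nat -> {RV P >-> nat})
  (eta : nat -> int -> {RV P >-> nat}) (c : q.-tuple nat).
Context (tv : tv_inar zeta pi0 X Y eta c).

Local Notation st := (q.-tuple nat).
Local Notation mS := (@measurable_state q).
Local Notation dS := (@discrete_state q).
Local Notation Q := (Q_kernel zeta).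
Local Notation past := (past X c).
Local Notation state := (state X c).
Local Notation time := (time R).
Local Notation run := (@run R q zeta).

(** The step from k + t to k + t + 1 uses the parameter of its arrival time, hence the shift by
    1. *)
Definition times n (k : int) (t : nat) : R := time n (k + 1 + t%:Z).

Lemma times_succ n k : (fun t => times n k t.+1) = times n (k + 1).
Proof. by apply/funext => t; rewrite /times; congr (time n _); lia. Qed.

Definition law_state n k : probability st R := distribution P (state n k).

Lemma multi_step n (k : int) m A B : (0 < n)%N -> k + m%:Z <= n%:Z -> past n k A ->
  P (A `&` state n (k + m%:Z) @^-1` B) =
  (\int[P]_(w in A) run (times n k) \d_(state n k w) m B)%E.
Proof.
move=> n0 + pA; have mA := past_measurable pA.
elim: m B => [|m IH] B km /=.
  have mB : measurable (state n k @^-1` B) by exact: measurable_preimage dS.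
  by rewrite addr0 setIC -integral_indic//; apply: eq_integral.
have km' : k + m%:Z <= n%:Z by lia.
have -> : k + m.+1%:Z = k + m%:Z + 1 by lia.
rewrite (one_step hq tv)//; [|lia|]; last first.
  by apply: past_mono pA; lia.
pose K (w : T) : probability st R := run (times n k) (\d_(state n k w)) m.
have mK B' : measurable_fun A (fun w => K w B').
  exact: (measurable_comp_discrete (state n k)
    (fun x => run (times n k) (\d_x : probability st R) m B') dS).
have PK B' : P (A `&` state n (k + m%:Z) @^-1` B') = (\int[P]_(w in A) K w B')%E.
  exact: IH.
have f0 x : (0 <= Q (time n (k + m%:Z + 1)) x B)%E by [].
have tE : times n k m = time n (k + m%:Z + 1) by rewrite /times; congr (time n _); lia.
rewrite tE; exact: (integral_comp_kernel (K := K) dS mA f0 mK PK).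
Qed.

Lemma law_state_run n (k : int) m B : (0 < n)%N -> k + m%:Z <= n%:Z ->
  law_state n (k + m%:Z) B = run (times n k) (law_state n k) m B.
Proof.
move=> n0 km; have pT : past n k setT by exact: sigma_genT.
have := multi_step B n0 km pT.
rewrite setTI => E; rewrite [LHS]E -mixture_run_dirac.
by rewrite (integral_law _ _ (f := fun x => run (times n k) (\d_x : probability st R) m B))//; exact: dS.
Qed.

Lemma law_state_stationary n (k : int) B : (0 < n)%N -> k <= 0 ->
  law_state n k B = pi0 B.
Proof.
move=> n0 k0; have k1 : k + 1%:Z - 1 <= 0 by lia.
have := stationary_start tv n0 k1.
pose B1 := [set t : 1.-tuple st | B (thead t)].
move=> /(_ B1 (measurable_path B1)).
move=> h; have <- : block_law X c n k 1 B1 = law_state n k B.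
  congr (P _); apply/seteqP; split=> w /=;
  by rewrite /B1/= /thead tnth_mktuple addr0.
rewrite [LHS]h; transitivity (\int[pi0]_x (\1_B x)%:E)%E; last first.
  by rewrite integral_indic ?setIT//; exact: mS.
by apply: eq_integral => x _; rewrite indicE.
Qed.

Lemma block_cons n k j w :
  block X c n k j.+1 w = cons_path (state n k w) (block X c n (k + 1) j w).
Proof.
apply: eq_from_tnth => s; rewrite /cons_path tnth_mktuple.
case: (unliftP ord0 s) => [s'|] ->; last by rewrite addr0.
rewrite tnthS tnth_mktuple; congr (state n _ w).
by rewrite lift0; lia.
Qed.

(** Condition on the state at k + 1: fixing its value gives an event in the past at k + 1, to which
    the induction hypothesis, general in [k] and [A], applies. *)
Lemma block_path n (k : int) j A B : (0 < n)%N -> k + j%:Z <= n%:Z -> past n k A ->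
  P (A `&` block X c n (k + 1) j @^-1` B) =
  (\int[P]_(w in A) path_law mS (fun t => Q (times n k t.+1))
     (Q (times n k 0) (state n k w)) j B)%E.
Proof.
elim: j k A B => [|j IH] k A B n0 kj pA.
  have mA := past_measurable pA.
  transitivity (\int[P]_(w in A) (\1_B ([tuple] : 0.-tuple st))%:E)%E.
    rewrite integral_cst// indicE; have [Bt|Bt] := boolP (_ \in B).
      rewrite mul1e; congr (P _); apply/seteqP; split=> w; first by case.
      by move=> Aw; split => //=; rewrite tuple0; exact/set_mem.
    rewrite mul0e (_ : _ `&` _ = set0) ?measure0//.
    by apply/seteqP; split=> // w [_ /=]; rewrite tuple0 => /mem_set; rewrite (negbTE Bt).
  by apply: eq_integral => w _; rewrite indicE.
have mA := past_measurable pA.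
pose h y := path_law mS (fun t => Q (times n (k + 1) t.+1)) (Q (times n (k + 1) 0) y) j
   [set t | B (cons_path y t)].
rewrite (discrete_total_probability (Z := state n (k + 1)) (h := h))//; last first.
- move=> y; set A' := A `&` _.
  have pA' : past n (k + 1) A'.
    by apply: sigma_genI; [apply: past_mono pA; lia|exact: past_state].
  have mA' := past_measurable pA'.
  rewrite (_ : _ `&` _ = A' `&` block X c n (k + 1 + 1) j @^-1` [set t | B (cons_path y t)]).
    rewrite IH//; last by lia.
    rewrite muleC -integral_cst//; apply: eq_integral => w; rewrite inE => -[_ /= ->//].
  by apply/seteqP; split=> w [[Aw /= sy] Bw]; split => //; move: Bw; rewrite /= block_cons sy.
- exact: measurable_preimage (@discrete_path _ q).
- exact: dS.
pose K (w : T) : probability st R := Q (times n k 0) (state n k w).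
have mK B' : measurable_fun A (fun w => K w B').
  exact: (measurable_comp_discrete (state n k) (fun x => Q (times n k 0) x B') dS).
have PK B' : P (A `&` state n (k + 1) @^-1` B') = (\int[P]_(w in A) K w B')%E.
  have k1n : k + 1 <= n%:Z by lia.
  have := one_step hq tv B' n0 k1n pA.
  by rewrite /K /times addr0.
have h0 x : (0 <= h x)%E by [].
transitivity (\int[P]_(w in A) \int[K w]_x h x)%E.
  exact: (integral_comp_kernel (K := K) dS mA h0 mK PK).
by apply: eq_integral => w _; rewrite /h -times_succ.
Qed.

Lemma block_law_path n (k : int) j B : (0 < n)%N -> k + j.+1%:Z - 1 <= n%:Z ->
  block_law X c n k j.+1 B =
  path_law mS (fun t => Q (times n k t)) (law_state n k) j.+1 B.
Proof.
move=> n0 kj; have kj' : k + j%:Z <= n%:Z by lia.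
pose h y := path_law mS (fun t => Q (times n k t.+1)) (Q (times n k 0) y) j
   [set t | B (cons_path y t)].
transitivity (\int[P]_w h (state n k w))%E; last first.
  by rewrite [RHS](integral_law P (state n k) (f := h))//; exact: dS.
transitivity (P (setT `&` block X c n k j.+1 @^-1` B)); first by rewrite setTI.
apply: discrete_total_probability => //.
- exact: dS.
- exact: measurable_preimage (@discrete_path _ q).
- move=> y; rewrite setTI; set A' := _ @^-1` [set y].
  have pA' : past n k A' by exact: past_state.
  have mA' := past_measurable pA'.
  rewrite (_ : _ `&` _ = A' `&` block X c n (k + 1) j @^-1` [set t | B (cons_path y t)]).
    rewrite block_path// muleC -integral_cst//.
    by apply: eq_integral => w; rewrite inE => /= ->.
  by apply/seteqP; split=> w [/= sy Bw]; split => //; move: Bw; rewrite /= block_cons sy.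
Qed.

End tv_inar_laws.

(** * Dependence coefficients *)

Section conditional_expectations.
Local Open Scope ereal_scope.
Context d (T : measurableType d) (R : realType) (P : probability T R).
Context (I : Type) d' (E : measurableType d') (D : set I) (V : I -> T -> E).
Context (mV : forall a, D a -> measurable_fun setT (V a)).

Local Notation G := (sigma_gen D V).

(** The set where one version exceeds the other belongs to the generated sigma-algebra; both have
    the same integral over it, so it is null. *)
Let version_lt Z W W' : cond_exp_version P G Z W -> cond_exp_version P G Z W' ->
  {ae P, forall w, ~ W' w < W w}.
Proof.
move=> vW vW'; have [iW WG WE] := vW; have [iW' WG' WE'] := vW'.
pose A := [set w | W' w < W w].
pose G0 := \bigcup_(a in D) preimage_set_system setT (V a) measurable.
have GA : G A.
  have mW : measurable_fun setT (W : g_sigma_algebraType G0 -> \bar R).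
    by move=> _ B mB; rewrite setTI; exact: WG.
  have mW' : measurable_fun setT (W' : g_sigma_algebraType G0 -> \bar R).
    by move=> _ B mB; rewrite setTI; exact: WG'.
  by have := measurable_lte measurableT mW' mW; rewrite setTI.
have mA : measurable A := sigma_gen_measurable mV GA.
have iWA : P.-integrable A W by exact: integrableS iW.
have iWA' : P.-integrable A W' by exact: integrableS iW'.
have : ae_eq P A (W \- W') (cst 0).
  apply/ae_eq_integral_abs => //.
    by apply: emeasurable_funB; [exact: measurable_int iWA|exact: measurable_int iWA'].
  transitivity (\int[P]_(w in A) (W \- W') w).
    apply: eq_integral => w; rewrite inE /A /= => lt.
    by rewrite gee0_abs// ltW// sube_gt0.
  rewrite integralB// WE// WE'// subee//.
  by rewrite -WE//; exact: integrable_fin_num.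
apply: filterS => w /= h Aw; have := h Aw.
by move=> e; have : 0 < W w - W' w; [rewrite sube_gt0|rewrite e ltxx].
Qed.

Lemma cond_exp_version_unique Z W W' : cond_exp_version P G Z W ->
  cond_exp_version P G Z W' -> {ae P, forall w, W w = W' w}.
Proof.
move=> v v'; have h1 := version_lt v v'; have h2 := version_lt v' v.
apply: filterS2 h1 h2 => w /negP; rewrite -leNgt => h1 /negP; rewrite -leNgt => h2.
by apply/eqP; rewrite eq_le h1 h2.
Qed.

Lemma cond_exp_ae Z W : cond_exp_version P G Z W ->
  {ae P, forall w, cond_exp P G Z w = W w}.
Proof.
move=> v; apply: (cond_exp_version_unique _ v).
exact: (@xgetPex _ (cst +oo) (cond_exp_version P G Z)) (ex_intro _ _ v).
Qed.

End conditional_expectations.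

Section essential_supremum.
Local Open Scope ereal_scope.
Context d (T : measurableType d) (R : realType) (P : probability T R).

Lemma ess_sup_familyP Zs U :
  is_ess_sup P Zs U -> is_ess_sup P Zs (ess_sup_family P Zs).
Proof.
by move=> hU; exact: (@xgetPex _ (cst +oo) (is_ess_sup P Zs)) (ex_intro _ _ hU).
Qed.

Lemma ess_sup_family_ae Zs U : is_ess_sup P Zs U ->
  {ae P, forall w, ess_sup_family P Zs w = U w}.
Proof.
move=> hU; have [mU U1 U2] := hU.
have [mE E1 E2] := ess_sup_familyP hU.
apply: filterS2 (E2 _ mU U1) (U2 _ mE E1) => w h1 h2.
by apply/eqP; rewrite eq_le h1 h2.
Qed.

(* Pointwise suprema of families of functions of a discrete variable are
   essential suprema, because at each of the countably many points the
   supremum is the limit of a sequence of members of the family. *)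
Lemma is_ess_sup_discrete d' (S : measurableType d') (X : {mfun T >-> S})
    (J : Type) (A : set J) (h : J -> S -> \bar R) (Z : J -> T -> \bar R) :
  discrete S -> A !=set0 ->
  (forall g, A g -> {ae P, forall w, Z g w = h g (X w)}) ->
  is_ess_sup P [set Z g | g in A]
    (fun w => ereal_sup [set h g (X w) | g in A]).
Proof.
move=> dS [g0 Ag0] Zh; split.
- have := measurable_comp_discrete X (fun x => ereal_sup [set h g x | g in A]) dS.
  by apply.
- move=> _ [g Ag <-]; apply: filterS (Zh g Ag) => w ->.
  by apply: ereal_sup_ubound; exists g.
move=> U mU hU; have [/countable_injP[num numi] mS] := dS.
have /choice[s hs] : forall x, exists s : nat -> J, (forall n, A (s n)) /\
    forall y, (forall n, h (s n) x <= y) -> ereal_sup [set h g x | g in A] <= y.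
  move=> x; have [|u uS ucvg] := @ereal_sup_seq R [set h g x | g in A].
    by apply/set0P; exists (h g0 x), g0.
  have /choice[s hs] : forall n, exists g, A g /\ h g x = u n.
    by move=> n; have [g Ag <-] := uS n; exists g.
  exists s; split => [n|y sy]; first by have [] := hs n.
  apply: (cvge_le _ ucvg); apply: nearW => n.
  by have [_ <-] := hs n.
have : \forall w \ae P, forall m, forall n x, num x = m ->
    Z (s x n) w = h (s x n) (X w) /\ Z (s x n) w <= U w.
  apply/ae_foralln => m; apply/ae_foralln => n.
  have [[x nx]|nex] := pselect (exists x, num x = m); last first.
    by apply: aeW => w x xm; exfalso; apply: nex; exists x.
  have An : A (s x n) by have [] := hs x.
  have hUn : {ae P, forall w, Z (s x n) w <= U w} by apply: hU; exists (s x n).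
  apply: filterS2 (Zh _ An) hUn => w h1 h2 y ny.
  by have -> : y = x by apply: numi; rewrite ?inE// nx.
apply: filterS => w hw; have [_] := hs (X w); apply => n.
by have [<-] := hw _ n (X w) erefl.
Qed.

End essential_supremum.

(** * Dependence on the past through the transition kernel *)

Section dependence_bound.
Local Open Scope ereal_scope.
Context (R : realType) (q : nat).
Context d (T : measurableType d) (P : probability T R).
Context (J : Type) d' (E : measurableType d') (D : set J) (V : J -> T -> E).
Context (mV : forall a, D a -> measurable_fun setT (V a)).

Local Notation st := (q.-tuple nat).
Local Notation dists := (@dist_state R q).
Local Notation dS := (@discrete_state q).
Local Notation G := (sigma_gen D V).

Context (S Z : {mfun T >-> st}) (L : st -> probability st R).
Context (GS : forall B, G (S @^-1` B)).
Context (LE : forall A B, G A -> P (A `&` Z @^-1` B) = \int[P]_(w in A) L (S w) B).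
Context (Lfin : forall x, \int[L x]_y (total R y)%:E < +oo).
Context (Zfin : \int[P]_w (total R (Z w))%:E < +oo).
Context (b : st -> st -> R) (b0 : forall x y, (0 <= b x y)%R)
  (bC : forall x y, b x y = b y x)
  (Lb : forall x y, coupled dists (L x) (L y) (b x y)).

Let mG A : G A -> measurable A.
Proof. exact: sigma_gen_measurable. Qed.

Let GT : G setT.
Proof. exact: sigma_genT. Qed.

Let H (psi : st -> R) (x : st) : \bar R := \int[L x]_y (psi y)%:E.

Let B (x : st) : \bar R := \int[P]_w (b x (S w))%:E.

Let B0 x : 0 <= B x.
Proof. by apply: integral_ge0 => w _; rewrite lee_fin. Qed.

Section nonnegative.
Context (psi : st -> R) (psi0 : forall x, (0 <= psi x)%R).
Context (psiL : forall x y, (psi x <= psi y + dists x y)%R).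

Let psi0' x : 0 <= (psi x)%:E. Proof. by rewrite lee_fin. Qed.

Let H0 x : 0 <= H psi x. Proof. exact: integral_ge0. Qed.

Let x0 : st := [tuple of nseq q 0%N].

(** Linear growth, from the Lipschitz bound at the zero state: the finite mean of [total] then
    controls every test function. *)
Let psi_total y : (psi y <= psi x0 + total R y)%R.
Proof.
apply: le_trans (psiL y x0) _; rewrite lerD2l; apply: ler_sum => i _.
by rewrite /dist_nat !(tnth_nth 0%N) nth_nseq if_same subr0 ger0_norm.
Qed.

Lemma kernel_mean_lty x : H psi x < +oo.
Proof.
apply: (@le_lt_trans _ _ (\int[L x]_y ((psi x0)%:E + (total R y)%:E))).
  by apply: discrete_ge0_le_integral => //; exact: dS.
rewrite discrete_ge0_integralD//.
- by rewrite integral_probability_cst; apply: lte_add_pinfty; [exact: ltry|exact: Lfin].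
- exact: dS.
- by move=> y; rewrite lee_fin total_ge0.
Qed.

Lemma integral_kernel A : G A ->
  \int[P]_(w in A) (psi (Z w))%:E = \int[P]_(w in A) H psi (S w).
Proof.
move=> GA.
have mK B' : measurable_fun A (fun w => L (S w) B').
  exact: (measurable_comp_discrete S (fun x => L x B') dS).
have PK B' : P (A `&` Z @^-1` B') = \int[P]_(w in A) L (S w) B' by exact: LE.
exact: (integral_comp_kernel (K := fun w => L (S w)) dS (mG GA) psi0' mK PK).
Qed.

Lemma integral_Z_lty : \int[P]_w (psi (Z w))%:E < +oo.
Proof.
apply: (@le_lt_trans _ _ (\int[P]_w ((psi x0)%:E + (total R (Z w))%:E))).
  apply: ge0_le_integral => //.
  - exact: (measurable_comp_discrete Z (fun y => (psi y)%:E) dS).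
  - exact: (measurable_comp_discrete Z (fun y => (psi x0)%:E + (total R y)%:E) dS).
  - by move=> w _; rewrite -EFinD lee_fin.
rewrite ge0_integralD//.
- by rewrite integral_probability_cst; apply: lte_add_pinfty; [exact: ltry|exact: Zfin].
- by move=> w _; rewrite lee_fin total_ge0.
- exact: (measurable_comp_discrete Z (fun y => (total R y)%:E) dS).
Qed.

Lemma kernel_mean_le x y : H psi x <= H psi y + (b x y)%:E.
Proof.
rewrite -[b x y]mul1r; apply: (coupled_lipschitz dS _ (Lb x y)) => //.
  exact: dist_state_ge0.
by move=> u v; rewrite mul1r.
Qed.

Let intZ : \int[P]_w (psi (Z w))%:E = \int[P]_w H psi (S w).
Proof. by apply: integral_kernel; exact: sigma_genT. Qed.

Let mH : measurable_fun setT (fun w => H psi (S w)).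
Proof. exact: (measurable_comp_discrete S (H psi) dS). Qed.

Let mb x : measurable_fun setT (fun w => (b x (S w))%:E).
Proof. exact: (measurable_comp_discrete S (fun y => (b x y)%:E) dS). Qed.

Lemma kernel_mean_le_mean x : H psi x <= \int[P]_w (psi (Z w))%:E + B x.
Proof.
rewrite intZ -ge0_integralD//; last by move=> w _; rewrite lee_fin.
rewrite -[leLHS](integral_probability_cst P); apply: ge0_le_integral => //.
- by apply: emeasurable_funD.
- by move=> w _; exact: kernel_mean_le.
Qed.

Lemma mean_le_kernel_mean x : \int[P]_w (psi (Z w))%:E <= H psi x + B x.
Proof.
rewrite intZ -[X in _ <= X + _](integral_probability_cst P) -ge0_integralD//; last first.
  by move=> w _; rewrite lee_fin.
apply: ge0_le_integral => //.
- by apply: emeasurable_funD.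
- by move=> w _; rewrite bC; exact: kernel_mean_le.
Qed.

End nonnegative.

Let abse_diff_le (p m p' m' e : \bar R) :
  p \is a fin_num -> m \is a fin_num -> p' \is a fin_num -> m' \is a fin_num ->
  0 <= e -> p <= p' + e -> p' <= p + e -> m <= m' + e -> m' <= m + e ->
  `|(p - m) - (p' - m')| <= 2%:E * e.
Proof.
case: p m p' m' => [p||] [m||] [p'||] [m'||]//= _ _ _ _.
case: e => [e||]//=; last by move=> *; rewrite gt0_muley ?lte_fin ?leey.
rewrite -?EFinB -?EFinD -?EFinM ?lee_fin ler_norml => *.
by apply/andP; split; lra.
Qed.

Let pos (phi : st -> R) x := Num.max (phi x) 0%R.

Let pos_ge0 phi x : (0 <= pos phi x)%R.
Proof. by rewrite le_max lexx orbT. Qed.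

Let pos_lip (phi : st -> R) : (forall x y, `|phi x - phi y| <= dists x y)%R ->
  forall x y, (pos phi x <= pos phi y + dists x y)%R.
Proof.
move=> phiL x y; have := phiL x y; have := dist_state_ge0 R x y.
rewrite /pos ler_norml => d0 /andP[h1 h2].
by rewrite ge_max; apply/andP; split;
  [have : (phi y <= Num.max (phi y) 0)%R by rewrite le_max lexx|
   have : (0 <= Num.max (phi y) 0)%R by rewrite le_max lexx orbT]; lra.
Qed.

(** The conditional expectation of phi(Z) as a function of the present state; the two parts are
    integrated separately because the kernel identities are stated for nonnegative functions. *)
Let version phi x := H (pos phi) x - H (pos (fun y => - phi y)%R) x.

Let neg_lip (phi : st -> R) : (forall x y, `|phi x - phi y| <= dists x y)%R ->
  (forall x y, `|- phi x - - phi y| <= dists x y)%R.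
Proof. by move=> h x y; rewrite -opprD normrN. Qed.

Let integral_pos_neg (phi : st -> R) A :
  \int[P]_(w in A) (phi (Z w))%:E =
  \int[P]_(w in A) (pos phi (Z w))%:E - \int[P]_(w in A) (pos (fun y => - phi y)%R (Z w))%:E.
Proof.
rewrite integralE; congr (_ - _); apply: eq_integral => w _.
  by rewrite funeposE /pos EFin_max.
by rewrite funenegE /pos EFin_max.
Qed.

Let H_fin (phi : st -> R) x : (forall x y, `|phi x - phi y| <= dists x y)%R ->
  H (pos phi) x \is a fin_num.
Proof.
move=> phiL; rewrite ge0_fin_numE; first exact: (kernel_mean_lty (pos_ge0 phi) (pos_lip phiL)).
by apply: integral_ge0 => y _; rewrite lee_fin.
Qed.

Let H_integrable (phi : st -> R) : (forall x y, `|phi x - phi y| <= dists x y)%R ->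
  P.-integrable setT (fun w => H (pos phi) (S w)).
Proof.
move=> phiL; apply/integrableP; split.
  exact: (measurable_comp_discrete S (H (pos phi)) dS).
have e : \int[P]_w `|H (pos phi) (S w)| = \int[P]_w (pos phi (Z w))%:E.
  rewrite (integral_kernel (pos_ge0 phi) GT).
  by apply: eq_integral => w _; rewrite gee0_abs//; apply: integral_ge0 => y _; rewrite lee_fin.
rewrite e; exact: (integral_Z_lty (pos_ge0 phi) (pos_lip phiL)).
Qed.

Let versionP (phi : st -> R) : (forall x y, `|phi x - phi y| <= dists x y)%R ->
  cond_exp_version P G (phi \o Z) (fun w => version phi (S w)).
Proof.
move=> phiL; have nphiL := neg_lip phiL.
have i1 := H_integrable phiL; have i2 := H_integrable nphiL.
split.
- exact: (integrableB _ i1 i2).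
- by move=> B' _; exact: (GS (version phi @^-1` B')).
move=> A GA; have mA := mG GA.
transitivity (\int[P]_(w in A) H (pos phi) (S w)
    - \int[P]_(w in A) H (pos (fun y => - phi y)%R) (S w)).
  by rewrite -integralB//; [exact: integrableS i1|exact: integrableS i2].
rewrite -(integral_kernel (pos_ge0 _) GA) -(integral_kernel (pos_ge0 _) GA).
by rewrite -integral_pos_neg.
Qed.

(** Conditional and unconditional means compare [L (S w)] with the average of [L (S w')] over an
    independent copy of the present; the cost [b] is the same for all test functions, so the
    supremum stays inside the integral. The positive and negative parts of a test function each pay
    once, whence the factor 2. *)
Lemma dependence_le (f : st -> R) : lipschitz1 dists f ->
  \int[P]_w dependence P G (f \o Z) w <= 2%:E * \int[P]_w \int[P]_w' (b (S w) (S w'))%:E.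
Proof.
move=> fL; pose phi (g : R -> R) y := g (f y).
have phiL g : lipschitz1 (@dist_real R) g ->
    forall x y, (`|phi g x - phi g y| <= dists x y)%R.
  by move=> gL x y; apply: le_trans (gL _ _) (fL _ _).
pose h g x := `|version (phi g) x - 'E_P[g \o (f \o Z)]|.
have hle g x : lipschitz1 (@dist_real R) g -> h g x <= 2%:E * B x.
  move=> gL; have pL := phiL g gL; have nL := neg_lip pL.
  have EE : 'E_P[g \o (f \o Z)] = \int[P]_w (pos (phi g) (Z w))%:E
      - \int[P]_w (pos (fun y => - phi g y)%R (Z w))%:E.
    by rewrite unlock -integral_pos_neg.
  rewrite /h EE.
  apply: abse_diff_le => //.
  - exact: H_fin.
  - exact: H_fin.
  - rewrite ge0_fin_numE; first exact: (integral_Z_lty (pos_ge0 _) (pos_lip pL)).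
    by apply: integral_ge0 => w _; rewrite lee_fin.
  - rewrite ge0_fin_numE; first exact: (integral_Z_lty (pos_ge0 _) (pos_lip nL)).
    by apply: integral_ge0 => w _; rewrite lee_fin.
  - exact: (kernel_mean_le_mean (pos_ge0 _) (pos_lip pL)).
  - exact: (mean_le_kernel_mean (pos_ge0 _) (pos_lip pL)).
  - exact: (kernel_mean_le_mean (pos_ge0 _) (pos_lip nL)).
  - exact: (mean_le_kernel_mean (pos_ge0 _) (pos_lip nL)).
have l0 : lipschitz1 (@dist_real R) (cst 0%R).
  by move=> x y; rewrite subrr normr0 normr_ge0.
(* Each conditional expectation is almost surely a function of [S], so the essential supremum is the
   pointwise one. *)
have hsup : is_ess_sup P
    [set (fun w => `|cond_exp P G (g \o (f \o Z)) w - 'E_P[g \o (f \o Z)]|)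
       | g in lipschitz1 (@dist_real R)]
    (fun w => ereal_sup [set h g (S w) | g in lipschitz1 (@dist_real R)]).
  apply: (is_ess_sup_discrete (h := h)); [exact: dS|by exists (cst 0%R)|].
  move=> g gL; have := cond_exp_ae mV (versionP (phiL g gL)).
  by apply: filterS => w; rewrite /h => <-.
pose U w := ereal_sup [set h g (S w) | g in lipschitz1 (@dist_real R)].
have mU : measurable_fun setT U.
  exact: (measurable_comp_discrete S
    (fun x => ereal_sup [set h g x | g in lipschitz1 (@dist_real R)]) dS).
have -> : \int[P]_w dependence P G (f \o Z) w = \int[P]_w U w.
  apply: ae_eq_integral => //.
    by have [mE _ _] := ess_sup_familyP hsup.
  by apply: filterS (ess_sup_family_ae hsup) => w e _; exact: e.
rewrite -ge0_integralZl//; first last.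
- by move=> w _; exact: B0.
- exact: (measurable_comp_discrete S B dS).
apply: ge0_le_integral => //.
- move=> w _; apply: le_trans (_ : 0 <= h (cst 0%R) (S w)) _; first exact: abse_ge0.
  by apply: ereal_sup_ubound; exists (cst 0%R).
- exact: (measurable_comp_discrete S (fun x => 2%:E * B x) dS).
- by move=> w _; apply: ge_ereal_sup => _ [g gL <-]; exact: hle.
Qed.

End dependence_bound.

(** * Total variation and weak convergence *)

Lemma initial_cvg (S : choiceType) (T : topologicalType) (f : S -> T)
    (F : set_system S) (s : S) :
  Filter F -> f @ F --> f s -> F --> (s : initial_topology f).
Proof.
move=> FF h A; rewrite nbhsE => -[B [[C oC <-] /= Cs] BA].
by apply: filterS BA _; apply: h; exact: open_nbhs_nbhs.
Qed.

Lemma ptws_cvg (I : Type) (V : topologicalType) (F : set_system (I -> V)) (t : I -> V) :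
  Filter F -> (forall i, (fun g => g i) @ F --> t i) -> F --> (t : {ptws I -> V}).
Proof. by move=> FF h; apply/cvg_sup => i; exact: initial_cvg. Qed.

Lemma ptws_eval_continuous (I : Type) (V : topologicalType) (i : I) :
  continuous (fun g : {ptws I -> V} => g i).
Proof.
move=> t; have /cvg_sup/(_ i) h : nbhs (t : {ptws I -> V}) --> (t : {ptws I -> V}) by [].
apply: cvg_trans (@initial_continuous _ _ (fun g : I -> V => g i) t).
exact: cvg_app h.
Qed.

Section weak_metric.
Context d (E : measurableType d) (R : realType) (dist : E -> E -> R).
Context (dE : discrete E) (dist0 : forall x y, 0 <= dist x y)
  (dist1 : forall x y, x <> y -> 1 <= dist x y).
Implicit Types mu nu la : probability E R.

Local Notation weak := (weak_convergence dist).
Local Notation Iexp mu f := (fine (\int[mu]_x (f x)%:E)%E).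

Definition unit_valued (f : E -> R) : Prop := forall x, 0 <= f x <= 1.

(* The total variation distance: it metrizes weak convergence on a countable
   space whose points are at distance at least 1 (Scheffe's lemma). *)
Definition theta mu nu : R :=
  sup [set `|Iexp mu f - Iexp nu f| | f in unit_valued].

Lemma Iexp_fin mu f : unit_valued f -> (Iexp mu f)%:E = (\int[mu]_x (f x)%:E)%E.
Proof.
move=> f01; rewrite fineK// ge0_fin_numE; last first.
  by apply: integral_ge0 => x _; rewrite lee_fin; case/andP: (f01 x).
apply: le_lt_trans (ltry 1); rewrite -(integral_probability_cst mu 1%E).
by apply: discrete_ge0_le_integral => // x; rewrite lee_fin; case/andP: (f01 x).
Qed.

Lemma Iexp_le mu nu f e : unit_valued f -> 0 <= e ->
  (\int[mu]_x (f x)%:E <= \int[nu]_x (f x)%:E + e%:E)%E ->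
  Iexp mu f <= Iexp nu f + e.
Proof. by move=> f01 e0 h; rewrite -lee_fin EFinD !Iexp_fin. Qed.

Lemma Iexp_ge0 mu f : unit_valued f -> 0 <= Iexp mu f.
Proof.
move=> f01; rewrite fine_ge0// integral_ge0// => x _.
by rewrite lee_fin; case/andP: (f01 x).
Qed.

Lemma Iexp_affine mu f (A B : R) : unit_valued f ->
  Iexp mu (fun x => A * f x + B) = A * Iexp mu f + B.
Proof.
move=> f01.
have mf (g : E -> \bar R) : measurable_fun setT g.
  by apply: measurable_fun_discrete; exact: dE.2.
have if1 : mu.-integrable setT (fun x => (f x)%:E).
  apply/integrableP; split => //.
  rewrite (eq_integral (fun x => (f x)%:E)); first by rewrite -Iexp_fin// ltry.
  by move=> x _; rewrite gee0_abs// lee_fin; case/andP: (f01 x).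
have E1 : (\int[mu]_x (A * f x + B)%:E = A%:E * \int[mu]_x (f x)%:E + B%:E)%E.
  under eq_integral do rewrite EFinD EFinM.
  rewrite integralD//; last 2 first.
  - exact: integrableZl.
  - exact: finite_measure_integrable_cst.
  by rewrite integralZl// integral_probability_cst.
by rewrite E1 -(Iexp_fin mu f01).
Qed.

Lemma unit_valued_compl f : unit_valued f -> unit_valued (fun x => -1 * f x + 1).
Proof. by move=> f01 x; have /andP[? ?] := f01 x; apply/andP; split; lra. Qed.

Lemma unit_valued0 : unit_valued (cst 0).
Proof. by move=> x /=; rewrite lexx ler01. Qed.

Let nonempty mu nu :
  [set `|Iexp mu f - Iexp nu f| | f in unit_valued] !=set0.
Proof. by eexists; exists (cst 0); first exact: unit_valued0. Qed.

Lemma Iexp_le1 mu f : unit_valued f -> Iexp mu f <= 1.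
Proof.
move=> f01; have := Iexp_ge0 mu (unit_valued_compl f01).
by rewrite Iexp_affine//; lra.
Qed.

Lemma theta_ub mu nu f : unit_valued f -> `|Iexp mu f - Iexp nu f| <= theta mu nu.
Proof.
move=> f01; apply: ub_le_sup; last by exists f.
exists 1 => _ [g g01 <-].
have := Iexp_ge0 mu g01; have := Iexp_ge0 nu g01.
have := Iexp_le1 mu g01; have := Iexp_le1 nu g01.
by rewrite ler_norml => *; apply/andP; split; lra.
Qed.

(* Applying the one-sided bound to 1 - f gives the two-sided one. *)
Lemma theta_le mu nu e : 0 <= e ->
  (forall f, unit_valued f ->
     (\int[mu]_x (f x)%:E <= \int[nu]_x (f x)%:E + e%:E)%E) ->
  theta mu nu <= e.
Proof.
move=> e0 h; apply: ge_sup; first exact: nonempty.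
move=> _ [f f01 <-]; have f01' := unit_valued_compl f01.
have := Iexp_le f01 e0 (h _ f01); have := Iexp_le f01' e0 (h _ f01').
by rewrite !Iexp_affine// ler_norml => *; apply/andP; split; lra.
Qed.

Lemma theta_coupled mu nu c : 0 <= c -> coupled dist mu nu c -> theta mu nu <= c.
Proof.
move=> c0 cc; apply: theta_le => // f f01; rewrite -[c]mul1r.
apply: (coupled_lipschitz dE dist0 cc) => // [x|x y]; first by case/andP: (f01 x).
rewrite mul1r; have [->|/eqP/dist1 xy] := eqVneq x y; first by rewrite lerDl.
by have /andP[? ?] := f01 x; have /andP[? ?] := f01 y; lra.
Qed.

Lemma theta_metric : is_metric theta.
Proof.
split.
- move=> mu nu; apply: le_trans (theta_ub mu nu unit_valued0); exact: normr_ge0.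
- move=> mu nu; split => [t0 A mA|h].
    have uA : unit_valued \1_A by move=> x; rewrite indicE; case: (_ \in _); rewrite ?lexx ler01.
    have := theta_ub mu nu uA; rewrite t0 normr_le0 subr_eq0 => /eqP e.
    have eA (m : probability E R) : (m A = (Iexp m \1_A)%:E).
      by rewrite Iexp_fin// integral_indic// setIT.
    exact: (etrans (eA mu) (etrans (congr1 EFin e) (esym (eA nu)))).
  apply/eqP; rewrite eq_le; apply/andP; split.
    apply: theta_le => // f f01; rewrite adde0.
    by rewrite (integral_eq_measure (fun x => (f x)%:E) h).
  by apply: le_trans (theta_ub mu nu unit_valued0); exact: normr_ge0.
- move=> mu nu; congr sup; apply/seteqP.
  by split=> _ [f f01 <-]; exists f => //; rewrite distrC.
move=> mu nu la; apply: ge_sup; first exact: nonempty.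
move=> _ [f f01 <-]; apply: le_trans (lerD (theta_ub mu nu f01) (theta_ub nu la f01)).
by apply: le_trans (ler_normD _ _); rewrite subrKA.
Qed.

(** Open balls of radius 1 are singletons, so continuity is automatic. *)
Lemma bounded_continuous_bounded (f : E -> R) M : (forall x, `|f x| <= M) ->
  bounded_continuous dist f.
Proof.
move=> fM; split; first by exists M.
move=> x e e0; exists 1 => // y xy.
have [->|/eqP/dist1] := eqVneq x y; first by rewrite subrr normr0.
by rewrite leNgt xy.
Qed.

Lemma theta_bounded mu nu (f : E -> R) M : 0 < M -> (forall x, `|f x| <= M) ->
  `|Iexp mu f - Iexp nu f| <= 2 * M * theta mu nu.
Proof.
move=> M0 fM; pose g x := (f x + M) / (2 * M).
have M20 : 0 < 2 * M by rewrite mulr_gt0.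
have g01 : unit_valued g.
  move=> x; have := fM x; rewrite ler_norml => /andP[h1 h2].
  by rewrite /g divr_ge0 ?(ltW M20)//=; [rewrite ler_pdivrMr// mul1r; lra|lra].
have fE : f = (fun x => 2 * M * g x + (- M)).
  by apply/funext => x; rewrite /g; field; rewrite gt_eqF.
rewrite fE !Iexp_affine// opprD opprK addrACA addNr addr0 -mulrBr normrM gtr0_norm//.
by rewrite ler_pM2l// theta_ub.
Qed.

(** Metrization means that this filter is the weak neighbourhood filter: [ball_cvg] and [ball_nbhs]
    are the two inclusions. *)
Let ball mu : set_system (probability E R) :=
  filter_from [set e : R | 0 < e] (fun e => [set nu | theta mu nu < e]).

Let ball_filter mu : Filter (ball mu).
Proof.
apply: filter_from_filter; first by exists 1 => /=.
move=> e e' /= e0 e'0; exists (Num.min e e'); first by rewrite /= lt_min e0.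
by move=> nu /=; rewrite lt_min => /andP.
Qed.

Let ball_cvg mu : ball mu --> (mu : weak).
Proof.
have FF := ball_filter mu.
apply: initial_cvg; apply: ptws_cvg => -[f [[M fM] fc]].
apply/cvgrPdist_lt => e e0.
have M0 : 0 < `|M| + 1 by rewrite ltr_wpDl.
have fM' x : `|f x| <= `|M| + 1.
  by rewrite (le_trans (fM x))// (le_trans (ler_norm M))// lerDl.
exists (e / (2 * (`|M| + 1))) => /=; first by rewrite divr_gt0// mulr_gt0.
move=> nu /= h; apply: le_lt_trans (theta_bounded mu nu M0 fM') _.
by rewrite mulrC -ltr_pdivlMr// mulr_gt0.
Qed.

(** Indicators are continuous here, so a weak neighbourhood keeps the mass of a set from dropping.
    This one-sided control is all that [theta_le] asks for. *)
Let weak_eval mu (A : set E) (e : R) : 0 < e ->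
  nbhs (mu : weak) [set nu : probability E R | fine (mu A) < fine (nu A) + e].
Proof.
move=> e0.
have bA : bounded_continuous dist \1_A.
  apply: (@bounded_continuous_bounded _ 1) => x; rewrite indicE.
  by case: (_ \in _); rewrite /= ?normr1 ?normr0.
have eA (m : probability E R) : Iexp m \1_A = fine (m A).
  by rewrite integral_indic ?setIT//; exact: dE.2.
have c1 := @initial_continuous _ _ (integrals (dist := dist)) mu.
have c2 := @ptws_eval_continuous _ R (exist _ _ bA : {f | bounded_continuous dist f})
  (integrals (dist := dist) mu).
have /cvgrPdist_lt/(_ _ e0) hh := cvg_comp _ _ c1 c2.
have sub : [set nu : weak | `|fine (mu A) - fine (nu A)| < e] `<=`
    [set nu : weak | fine (mu A) < fine (nu A) + e].
  by move=> nu /=; rewrite ltr_norml => /andP[_]; lra.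
apply: (filterS sub).
pose fA := exist _ _ bA : {f | bounded_continuous dist f}.
have hh' : nbhs (mu : weak) [set nu : weak |
    `|integrals (dist := dist) mu fA - integrals (dist := dist) nu fA| < e] :=
  hh (@fmap_filter _ _ _ (nbhs (mu : weak)) (nbhs_filter (mu : weak))).
suff <- : [set nu : weak | `|integrals (dist := dist) mu fA - integrals (dist := dist) nu fA| < e]
  = [set nu : weak | `|fine (mu A) - fine (nu A)| < e] by [].
by apply/funext => nu; rewrite /integrals /= /Rintegral !eA.
Qed.

(** Scheffe's argument: finitely many atoms carry [mu] up to a tail of mass e/4; if each of them
    loses less than [del], every integral of a [0, 1]-valued function drops by at most e/2. *)
Let ball_nbhs mu (e : R) : 0 < e ->
  nbhs (mu : weak) [set nu : probability E R | theta mu nu < e].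
Proof.
move=> e0.
have [F [tF UF Ff]] := discrete_enumeration R dE.
have mE := dE.2.
have e20 : 0 < e / 2 / 2 by rewrite !divr_gt0.
have sum1 : (\sum_(n <oo) mu (F n) < +oo)%E.
  rewrite -(measure_semi_bigcup (mu : probability E R))//.
  by apply: le_lt_trans (probability_le1 (mu : probability E R) (mE _)) (ltry 1).
have tail := nneseries_tail_cvg sum1 (fun _ _ => measure_ge0 _ _).
have [N hN] : exists N, (\sum_(N <= n <oo) mu (F n) <= (e / 2 / 2)%:E)%E.
  have /fine_cvgP[fin_tail] := tail.
  move=> /cvgrPdist_le/(_ _ e20) ft.
  have [N _ /(_ N (leqnn N)) [h1 h2]] := filterI fin_tail ft.
  exists N; rewrite -[leLHS]fineK// lee_fin.
  by move: h2; rewrite /= sub0r normrN; apply: le_trans; exact: ler_norm.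
(* The [N] atoms together lose at most e/4; [N.+1] keeps the denominator positive. *)
pose del := e / 2 / 2 / N.+1%:R.
have del0 : 0 < del by rewrite divr_gt0.
have near_N : nbhs (mu : weak)
    [set nu : probability E R | forall n, (n < N)%N -> fine (mu (F n)) < fine (nu (F n)) + del].
  elim: N {hN} del del0 => [|N IH] del del0; first exact: filterE.
  apply: filterS2 (IH _ del0) (weak_eval mu (F N) del0) => nu h1 h2 n.
  by rewrite ltnS leq_eqVlt => /orP[/eqP ->//|/h1].
apply: filterS near_N => nu h /=.
apply: (@le_lt_trans _ _ (e / 2)); last by rewrite ltr_pdivrMr// ltr_pMr// ltr1n.
apply: theta_le; first by rewrite ltW// divr_gt0.
move=> f f01; have [//|c [c0 cf fE]] := Ff (fun x => (f x)%:E).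
  by move=> x; rewrite lee_fin; case/andP: (f01 x).
have c1 n : (c n <= 1)%E.
  have [->|[x ->]] := cf n; first exact: lee01.
  by rewrite lee_fin; case/andP: (f01 x).
rewrite fE (nneseries_split 0 N)//; last by move=> k _; rewrite mule_ge0.
rewrite add0n (splitr (e / 2)) EFinD addeA leeD//; last first.
  apply: le_trans hN; apply: lee_nneseries => [k _ _|k _].
    exact: mule_ge0.
  rewrite -[leRHS]mul1e; exact: lee_wpmul2r.
apply: (@le_trans _ _ (\sum_(0 <= n < N) (c n * nu (F n) + del%:E))%E).
  rewrite big_nat [leRHS]big_nat; apply: lee_sum => n /andP[_ nN].
  have finE (m : probability E R) : exists x, m (F n) = x%:E.
    by exists (fine (m (F n))); rewrite fineK// fin_num_measure//; exact: mE.
  have [x1 e1] := finE mu; have [x2 e2] := finE nu.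
  have := h n nN; rewrite /= e1 e2 /= => hn.
  move: (c0 n) (c1 n); case: (c n) => [r||]; last 2 first.
  - by rewrite leye_eq.
  - by rewrite leeNy_eq.
  rewrite !lee_fin => r0 r1.
  by have := del0; nra.
rewrite big_split/= leeD//.
  rewrite fE; apply: nneseries_lim_ge => k *; rewrite mule_ge0//.
rewrite sumEFin big_const_nat subn0 iter_addr_0 lee_fin -[leLHS]mulr_natl.
by rewrite /del mulrCA ger_pMr// ler_pdivrMr// mul1r ler_nat.
Qed.

Lemma theta_metrizes : metrizes_weak dist theta.
Proof.
move=> mu U; split; first by move=> /(ball_cvg (mu := mu))[e e0 eU]; exists e.
by move=> [e e0 eU]; exact: filterS eU (ball_nbhs mu e0).
Qed.

End weak_metric.

(** * Subadditive powers and geometric decay *)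

Section powers.
Context (R : realType).
Implicit Types x y k : R.

(** A power below 1 can only increase the fraction z / (x + y) of [0, 1]; multiply by (x + y)^k and
    add the cases z = x and z = y. *)
Lemma powR_le_sub x y k : 0 < k < 1 -> 0 <= x -> 0 <= y ->
  (x + y) `^ k <= x `^ k + y `^ k.
Proof.
move=> /andP[k0 k1] x0 y0.
have [s0|s0] := eqVneq (x + y) 0.
  by rewrite s0 powR0 ?gt_eqF// addr_ge0 ?powR_ge0.
have {}s0 : 0 < x + y by rewrite lt_neqAle eq_sym s0 addr_ge0.
have frac z : 0 <= z -> z <= x + y -> z / (x + y) * (x + y) `^ k <= z `^ k.
  move=> z0 zs; have [->|zn0] := eqVneq z 0; first by rewrite mul0r mul0r powR_ge0.
  have {}zn0 : 0 < z by rewrite lt_neqAle eq_sym zn0.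
  have zE : z = z / (x + y) * (x + y) by rewrite divfK// gt_eqF.
  have q0 : 0 <= z / (x + y) by rewrite divr_ge0// ltW.
  rewrite [in leRHS]zE powRM//; last exact: ltW.
  rewrite ler_wpM2r ?powR_ge0//; apply: ger1_powR; last exact: ltW.
  by rewrite divr_gt0//= ler_pdivrMr// mul1r.
apply: le_trans (lerD (frac x x0 _) (frac y y0 _)); rewrite ?lerDl ?lerDr//.
by rewrite -!mulrDl divff ?gt_eqF// mul1r.
Qed.

Lemma powR_nat_le (p : nat) k : 0 < k < 1 -> p%:R `^ k <= p%:R :> R.
Proof.
move=> /andP[k0 k1]; case: p => [|p]; first by rewrite powR0 ?gt_eqF.
by apply: ler1_powR; [rewrite ler1n|exact: ltW].
Qed.

(** Linear in the number [p] of steps back, as the perturbation term of [vcoupled_drift]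
    requires. *)
Lemma powR_div_nat (p n : nat) k : 0 < k < 1 ->
  (p%:R / n%:R) `^ k <= p%:R * (1 / n%:R `^ k) :> R.
Proof.
move=> k01; rewrite powRM ?invr_ge0// -powR_inv1// powRAC powR_inv1 ?powR_ge0//.
by rewrite div1r ler_wpM2r ?invr_ge0 ?powR_ge0// powR_nat_le.
Qed.

Lemma powR_inv_cvg0 k : 0 < k -> (fun n : nat => 1 / n%:R `^ k) @ \oo --> (0 : R).
Proof.
move=> k0; apply/cvgrPdist_le => e e0.
exists (Num.truncn ((e^-1) `^ k^-1)).+1 => // n /= hn.
have n0 : 0 < n%:R :> R by rewrite ltr0n (leq_trans _ hn).
rewrite sub0r normrN div1r ger0_norm ?invr_ge0 ?powR_ge0//.
rewrite invf_ple ?posrE// ?powR_gt0//.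
have -> : e^-1 = (e^-1 `^ k^-1) `^ k.
  by rewrite -powRrM mulVf ?gt_eqF// powRr1// invr_ge0 ltW.
rewrite ge0_ler_powR ?nnegrE ?powR_ge0 ?(ltW k0)//.
by apply: le_trans (ltW (truncnS_gt _)) _; rewrite ler_nat.
Qed.

Lemma geometric_small (C rho e : R) (N : nat) : 0 < rho < 1 -> 0 < e ->
  exists2 m, (N <= m)%N & C * rho ^+ m <= e.
Proof.
move=> /andP[r0 r1] e0.
have := @cvg_geometric R C rho; rewrite ger0_norm ?(ltW r0)// => /(_ r1).
move=> /cvgrPdist_le/(_ _ e0)[m _ hm]; exists (maxn N m); first exact: leq_maxl.
have := hm (maxn N m) (leq_maxr _ _); rewrite /= sub0r normrN.
by apply: le_trans; exact: ler_norm.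
Qed.

End powers.

Lemma frozen_id (R : realType) (u : R) : 0 <= u -> frozen u = u.
Proof. by move=> u0; rewrite /frozen; exact/max_idPr. Qed.

Lemma frozen01 (R : realType) (u : R) : u <= 1 -> 0 <= frozen u <= 1.
Proof. by move=> u1; rewrite /frozen le_max lexx/= ge_max ler01. Qed.

Lemma frozenK (R : realType) (u : R) : frozen (frozen u) = frozen u.
Proof. by apply: frozen_id; rewrite /frozen le_max lexx. Qed.

Lemma frozen_dist (R : realType) (u v : R) : 0 <= v -> `|frozen u - frozen v| <= `|u - v|.
Proof.
move=> v0; rewrite [frozen v]frozen_id// /frozen; have [u0|u0] := ltP 0 u => //.
by rewrite sub0r normrN ger0_norm// distrC ger0_norm; lra.
Qed.

(** * Quantitative form of the hypotheses *)

Section regularity.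
Local Open Scope ereal_scope.
Context (R : realType) (q : nat)
    (zeta : nat -> R -> probability nat R)
    (hmean : (ereal_sup [set (\sum_(1 <= j < q.+1) mean (zeta j u))%E
                          | u in [set u : R | (0 <= u <= 1)%R]] < 1)%E)
    (himmig : forall u : R, (0 <= u <= 1)%R -> (mean (zeta q.+1 u) < +oo)%E)
    (C0 kappa : R) (hC0 : (0 < C0)%R) (hkappa : (0 < kappa < 1)%R)
    (hholder : forall (u v : R) (j : nat), (0 <= u <= 1)%R -> (0 <= v <= 1)%R ->
       (1 <= j <= q.+1)%N ->
       (W1 (@dist_nat R) (zeta j u) (zeta j v)
          <= (C0 * `|u - v| `^ kappa)%:E)%E).

(** [r] is the midpoint between the supremum and 1, hence positive even if all offspring means
    vanish. The immigration means, finite for each parameter, are bounded uniformly by the one at 0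
    plus the Hoelder bound over an interval of length 1. *)
Lemma inar_regular : exists r b a, regular q zeta kappa r b (2 * C0) a.
Proof.
pose s := ereal_sup [set (\sum_(1 <= j < q.+1) mean (zeta j u))
                          | u in [set u : R | (0 <= u <= 1)%R]].
have sum_le u : (0 <= u <= 1)%R -> \sum_(1 <= j < q.+1) mean (zeta j u) <= s.
  by move=> u01; apply: ereal_sup_ubound; exists u.
have sum_ge0 u : 0 <= \sum_(1 <= j < q.+1) mean (zeta j u).
  by apply: sume_ge0 => j _; exact: mean_ge0.
have u00 : (0 <= (0 : R) <= 1)%R by rewrite lexx ler01.
have s0 : 0 <= s := le_trans (sum_ge0 0%R) (sum_le _ u00).
have sfin : s \is a fin_num by rewrite ge0_fin_numE// (lt_trans hmean)// ltry.
have s1 : (fine s < 1)%R by rewrite -lte_fin fineK.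
have fs0 : (0 <= fine s)%R by rewrite fine_ge0.
pose a u j := fine (mean (zeta j (frozen u))).
have mean_fin u j : (u <= 1)%R -> (1 <= j <= q)%N -> mean (zeta j (frozen u)) \is a fin_num.
  move=> u1 /andP[j1 jq]; rewrite ge0_fin_numE ?mean_ge0//.
  apply: le_lt_trans (lt_trans hmean (ltry 1)).
  apply: le_trans (sum_le _ (frozen01 u1)).
  rewrite (bigD1_seq j)/= ?mem_index_iota ?j1 ?ltnS ?iota_uniq//.
  by rewrite leeDl// sume_ge0// => i _; exact: mean_ge0.
(* Doubling [C0] makes the inequality strict, which yields an actual coupling; for equal frozen
   parameters, where both bounds are 0, the diagonal coupling serves. *)
have cpl u v j : (u <= 1)%R -> (v <= 1)%R -> (1 <= j <= q.+1)%N ->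
    coupled (@dist_nat R) (zeta j (frozen u)) (zeta j (frozen v))
      (2 * C0 * omega kappa u v).
  move=> u1 v1 jq; have [uv|uv] := eqVneq (frozen u) (frozen v).
    rewrite uv; apply: (coupled_le _ (coupled_nat_refl _)).
    by rewrite mulr_ge0 ?omega_ge0// mulr_ge0// ltW.
  apply: W1_coupled; apply: le_lt_trans (hholder (frozen01 u1) (frozen01 v1) jq) _.
  rewrite lte_fin /omega ltr_pM2r ?powR_gt0 ?normr_gt0 ?subr_eq0//.
  by rewrite ltr_pMl// ltr1n.
exists ((fine s + 1) / 2)%R, (fine (mean (zeta q.+1 0%R)) + 2 * C0)%R, a; split => //.
- by apply/andP; split; lra.
- by rewrite mulr_ge0// ltW.
- by rewrite addr_ge0 ?fine_ge0 ?mean_ge0// mulr_ge0// ltW.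
- by move=> u j; rewrite fine_ge0// mean_ge0.
- by move=> u j u1 jq; rewrite fineK// mean_fin.
- move=> u u1; rewrite -lee_fin -sumEFin.
  apply: (@le_trans _ _ s); last first.
    by rewrite -(fineK sfin) lee_fin; lra.
  apply: le_trans (sum_le _ (frozen01 u1)).
  rewrite big_nat [leRHS]big_nat; apply: lee_sum => j jq.
  by rewrite fineK// mean_fin.
- move=> u u1.
  have m0 : mean (zeta q.+1 0%R) \is a fin_num by rewrite ge0_fin_numE ?mean_ge0 ?himmig.
  have f0 : @frozen R 0%R = 0%R by exact: frozen_id.
  have c0 : coupled (@dist_nat R) (zeta q.+1 0%R) (zeta q.+1 (frozen u)) (2 * C0).
    have := cpl 0%R u q.+1 ler01 u1; rewrite f0 ltnSn => /(_ isT).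
    apply: coupled_le; rewrite ler_piMr ?mulr_ge0 ?(ltW hC0)//.
    rewrite /omega f0 sub0r normrN; have /andP[h0 h1] := frozen01 u1.
    have /andP[k0 _] := hkappa.
    have <- : (1 `^ kappa = 1 :> R)%R by rewrite powR1.
    rewrite ge0_ler_powR ?nnegrE ?(ltW k0)//.
    by rewrite ger0_norm.
  by apply: le_trans (coupled_mean c0) _; rewrite EFinD fineK.
Qed.

End regularity.

(** * Local approximation of the array *)

Section time_shifts.
Context (R : realType) (q : nat) (zeta : nat -> R -> probability nat R).

Local Notation run := (@run R q zeta).
Local Notation time := (time R).
Local Notation times := (times R).

Lemma run_ext us us' mu m : (forall t, (t < m)%N -> us t = us' t) ->
  run us mu m = run us' mu m.
Proof.
elim: m => [//|m IH] h; rewrite /= (h m (ltnSn m)).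
by congr (mixture _ _ _); apply: IH => t tm; apply: h; exact: ltnW.
Qed.

(** Times beyond [n] exceed 1; clipping the parameters after the [m] steps performed makes the bound
    by 1 hold at all indices without changing the run. *)
Definition clip (us : nat -> R) m t : R := if (t < m)%N then us t else 0%R.

Lemma run_clip us mu m : run us mu m = run (clip us m) mu m.
Proof. by apply: run_ext => t tm; rewrite /clip tm. Qed.

Lemma time_le1 n (k : int) : (0 < n)%N -> (k <= n%:Z)%R -> (time n k <= 1)%R.
Proof.
move=> n0 kn; rewrite /Defs.time ler_pdivrMr ?ltr0n// mul1r.
by rewrite -[X in (_ <= X)%R]/(n%:R) pmulrn ler_int.
Qed.

Lemma clip_times_le1 n (k : int) m t : (0 < n)%N -> (k + m%:Z <= n%:Z)%R ->
  (clip (times n k) m t <= 1)%R.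
Proof.
move=> n0 km; rewrite /clip; case: ifPn => // tm; apply: time_le1 => //.
lia.
Qed.

Lemma Q_kernel_frozen (u v : R) : frozen u = frozen v -> Q_kernel (q := q) zeta u = Q_kernel zeta v.
Proof. by move=> fuv; rewrite /Q_kernel /S_law fuv. Qed.

End time_shifts.

(** * Distance of the marginals to the stationary laws *)

Section array_bounds.
Local Open Scope ereal_scope.
Context (R : realType) (q : nat) (hq : (0 < q)%N).
Context (zeta : nat -> R -> probability nat R).
Context (kappa r b L : R) (a : R -> nat -> R) (H : regular q zeta kappa r b L a).
Context (pi : R -> probability (q.-tuple nat) R).
Context (hpi : forall u, (u <= 1)%R ->
  invariant_law (Q_kernel zeta u) (pi u) /\ mean_bound (pi u) (mean_cap r b)).

Local Notation dists := (@dist_state R q).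
Local Notation st := (q.-tuple nat).
Local Notation dS := (@discrete_state q).
Local Notation Q := (Q_kernel zeta).
Local Notation run := (@run R q zeta).
Local Notation rho := (decay q r).
Local Notation cap := (mean_cap r b).
Local Notation time := (time R).
Local Notation times := (times R).

Let r01 : (0 < r < 1)%R := reg_r H.
Let rho01 : (0 < rho < 1)%R := decay01 hq H.
Let cap0 : (0 <= cap)%R := mean_cap_ge0 H.

(** The constant of [stationary_drift] at [M = cap], once a0 + B b0 is bounded by (1 + B)(a0 + b0);
    the last 1 pays for the geometric term. *)
Definition drift_const : R :=
  (q%:R * (L * (q%:R * cap + 1) / (1 - r) * (1 + (q%:R + r * q%:R / (1 - r))) + 1))%R.

Lemma drift_const_ge0 : (0 <= drift_const)%R.
Proof.
have [r0 r1] := andP r01.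
have s0 : (0 < 1 - r)%R by rewrite subr_gt0.
have e1 : (0 <= L * (q%:R * cap + 1) / (1 - r))%R.
  by rewrite divr_ge0 ?(ltW s0)// mulr_ge0 ?(reg_L H)// addr_ge0// mulr_ge0.
have e2 : (0 <= r * q%:R / (1 - r))%R.
  by rewrite divr_ge0 ?(ltW s0)// mulr_ge0// ltW.
by rewrite mulr_ge0// addr_ge0// mulr_ge0// !addr_ge0.
Qed.

(* The last hypothesis makes the geometric term negligible: the coupling has to
   start far enough in the past. *)
Lemma stationary_coupled us u mu a0 b0 m :
  (forall t, us t <= 1)%R -> (u <= 1)%R -> mean_bound mu cap ->
  (0 <= a0)%R -> (0 <= b0)%R ->
  (forall t, (t < m)%N -> omega kappa (us t) u <= a0 + (m - t.+1)%:R * b0)%R ->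
  ((cap + cap) / rho ^+ q * rho ^+ m <= a0 + b0)%R ->
  coupled dists (run us mu m) (pi u) (drift_const * (a0 + b0)).
Proof.
move=> us1 u1 muM a00 b00 hw hm; have [inv piM] := hpi u1.
apply: coupled_le (stationary_drift hq H us1 u1 inv (lexx _) muM piM a00 b00 hw).
have [r0 r1] := andP r01.
have s0 : (0 < 1 - r)%R by rewrite subr_gt0.
rewrite /drift_const -[leRHS]mulrA ler_wpM2l//.
set A := (L * _ / _)%R; set B := (q%:R + _)%R; set G := (_ * rho ^+ m)%R in hm *.
have A0 : (0 <= A)%R.
  by rewrite divr_ge0 ?(ltW s0)// mulr_ge0 ?(reg_L H)// addr_ge0// mulr_ge0.
have B0 : (0 <= B)%R by rewrite addr_ge0// divr_ge0 ?(ltW s0)// mulr_ge0// ltW.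
have : (A * (a0 + B * b0) <= A * (1 + B) * (a0 + b0))%R.
  by rewrite -mulrA ler_wpM2l//; have := mulr_ge0 B0 a00; lra.
by lra.
Qed.

(** Run the chain with parameter [v] from [pi v]: its law does not move, while the comparison with
    [pi u] has constant drift [omega kappa v u]; enough steps bring the geometric term below that
    value. *)
Lemma pi_coupled u v : (u <= 1)%R -> (v <= 1)%R ->
  coupled dists (pi v) (pi u) (drift_const * omega kappa v u).
Proof.
move=> u1 v1; have [inv pivM] := hpi v1.
have [w0|wn0] := eqVneq (omega kappa v u) 0%R.
  have fuv : frozen v = frozen u.
    move: w0; rewrite /omega => /powR_eq0_eq0/eqP.
    by rewrite normr_eq0 subr_eq0 => /eqP.
  have [inu piuM] := hpi u1.
  have inu' : invariant_law (Q v) (pi u) by rewrite (Q_kernel_frozen q zeta fuv).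
  rewrite w0 mulr0; apply: (coupled_eq (fun _ _ => erefl) (mu := pi v) (nu := pi v)).
    by move=> A mA; exact: (invariant_unique hq H v1 inu' piuM inv).
  apply: coupled_refl; [exact: dS|exact: dist_state_ge0|exact: dist_statexx].
have w0 : (0 < omega kappa v u)%R by rewrite lt_neqAle eq_sym wn0 omega_ge0.
have [m _ hm] := geometric_small ((cap + cap) / rho ^+ q) 0 rho01 w0.
rewrite -[omega _ _ _]addr0.
apply: (coupled_eq (mu := run (fun=> v) (pi v) m) (nu := pi u)) => //.
  by move=> A _; exact: run_invariant.
apply: stationary_coupled => //; first exact: omega_ge0.
- by move=> t _; rewrite mulr0 addr0.
- by rewrite addr0.
Qed.

Section array.
Context d (T : measurableType d) (P : probability T R).
Context (X : nat -> int -> {RV P >-> nat})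
  (Y : nat -> int -> nat -> nat -> {RV P >-> nat})
  (eta : nat -> int -> {RV P >-> nat}) (c : st).
Context (tv : tv_inar zeta (pi 0%R) X Y eta c).

Local Notation law_state := (law_state X c).

Lemma law_state_mean n (k : int) : (0 < n)%N -> (k <= n%:Z)%R ->
  mean_bound (law_state n k) cap.
Proof.
have neg (l : int) : (0 < n)%N -> (l <= 0)%R -> mean_bound (law_state n l) cap.
  move=> n0 l0 i iq; have [_ /(_ i iq)] := hpi ler01.
  apply: le_trans; rewrite le_eqVlt; apply/orP; left; apply/eqP.
  by apply: integral_eq_measure => A _; exact: (law_state_stationary hq tv).
move=> n0 kn; have [k0|k0] := leP k 0%R; first exact: neg.
have kE : k = (0 + `|k|%N%:Z)%R by lia.
rewrite kE => i iq.
have km : (0 + `|k|%N%:Z <= n%:Z)%R by rewrite -kE.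
have h : mean_bound (run (clip (times n 0) `|k|%N) (law_state n 0) `|k|%N) cap.
  apply: (mean_bound_run hq H).
  - by move=> t; exact: clip_times_le1.
  - exact: (mean_cap_le H (lexx _)).
  - exact: neg.
apply: le_trans (h i iq); rewrite le_eqVlt; apply/orP; left; apply/eqP.
apply: integral_eq_measure => A _; rewrite -run_clip.
exact: (law_state_run hq tv).
Qed.

(** Going [p] steps back from [k] changes the parameter by p/n; subadditivity of the power separates
    this from the distance at [k] and gives the affine form a0 + p b0. *)
Lemma omega_time_le n (k l : int) u (p : nat) : (0 < n)%N -> (0 <= u <= 1)%R ->
  k = (l + p%:Z)%R ->
  (omega kappa (time n l) u <= `|u - time n k| `^ kappa + p%:R * (1 / n%:R `^ kappa))%R.
Proof.
move=> n0 /andP[u0 u1] kE; have hk := reg_kappa H; have [k0 k1] := andP hk.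
have n0' : (0 < n%:R :> R)%R by rewrite ltr0n.
have tE : time n k = (time n l + p%:R / n%:R)%R.
  by rewrite /Defs.time kE intrD mulrDl.
apply: (@le_trans _ _ (`|u - time n k| `^ kappa + (p%:R / n%:R) `^ kappa)%R).
  apply: le_trans (powR_le_sub hk _ _) => //.
  rewrite /omega ge0_ler_powR ?nnegrE ?(ltW k0) ?addr_ge0 ?divr_ge0//.
  apply: le_trans (frozen_dist _ u0) _.
  have -> : (time n l - u = - (u - time n k) - p%:R / n%:R)%R by rewrite tE; ring.
  apply: le_trans (ler_normB _ _) _.
  by rewrite normrN lerD2l ger0_norm// divr_ge0.
rewrite lerD2l; exact: powR_div_nat.
Qed.

(** The array extends indefinitely into the past, so the run can start early enough for its
    geometric term to fall below 1 / n^kappa; what is left is the affine drift. *)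
Lemma law_state_coupled n (k : int) u : (0 < n)%N -> (k <= n%:Z)%R -> (0 <= u <= 1)%R ->
  coupled dists (law_state n k) (pi u)
    (drift_const * (`|u - time n k| `^ kappa + 1 / n%:R `^ kappa))%R.
Proof.
move=> n0 kn u01; have [u0 u1] := andP u01.
have b00 : (0 < 1 / n%:R `^ kappa :> R)%R by rewrite divr_gt0// powR_gt0// ltr0n.
have [m mk hm] := geometric_small ((cap + cap) / rho ^+ q) `|k|%N rho01 b00.
pose k0 : int := (k - m%:Z)%R.
have k00 : (k0 <= 0)%R by rewrite /k0; clear -mk; lia.
have kE : k = (k0 + m%:Z)%R by rewrite /k0 subrK.
have km : (k0 + m%:Z <= n%:Z)%R by rewrite -kE.
apply: (coupled_eq (mu := run (clip (times n k0) m) (law_state n k0) m) (nu := pi u)) => //.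
  by move=> A _; rewrite -run_clip kE; apply/esym/(law_state_run hq tv).
apply: stationary_coupled => //.
- by move=> t; exact: clip_times_le1.
- by apply: law_state_mean => //; exact: le_trans k00 _.
- move=> t tm; rewrite /clip tm; apply: omega_time_le => //.
  by rewrite kE; lia.
- by apply: le_trans hm _; rewrite lerDr powR_ge0.
Qed.

End array.
End array_bounds.

(** * Geometric decay of the dependence coefficients *)

Section array_dependence.
Local Open Scope ereal_scope.
Context (R : realType) (q : nat) (hq : (0 < q)%N).
Context (zeta : nat -> R -> probability nat R).
Context (kappa r b L : R) (a : R -> nat -> R) (H : regular q zeta kappa r b L a).
Context (pi : R -> probability (q.-tuple nat) R).
Context (hpi : forall u, (u <= 1)%R ->
  invariant_law (Q_kernel zeta u) (pi u) /\ mean_bound (pi u) (mean_cap r b)).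

Local Notation dists := (@dist_state R q).
Local Notation st := (q.-tuple nat).
Local Notation dS := (@discrete_state q).
Local Notation run := (@run R q zeta).
Local Notation rho := (decay q r).
Local Notation cap := (mean_cap r b).
Local Notation times := (times R).

Let rho01 : (0 < rho < 1)%R := decay01 hq H.
Let cap0 : (0 <= cap)%R := mean_cap_ge0 H.

Lemma integral_total_le (mu : probability st R) M : mean_bound mu M ->
  \int[mu]_x (total R x)%:E <= (q%:R * M)%:E.
Proof.
move=> muM; have hA (j : nat) : (0 <= (1 : R))%R by [].
have h0 (j : nat) (x : st) : (0 <= ((nth 0%N x j)%:R : R))%R by [].
have := @integral_affine R _ _ mu (fun j x => (nth 0%N x j)%:R) (fun=> 1%R) 0%R (fun=> M)
  (iota 0 q) dS h0 hA (lexx _).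
have sE (F : nat -> R) : (\sum_(j <- iota 0 q) 1 * F j + 0 = \sum_(i < q) F i)%R.
  by rewrite addr0 -[q in iota 0 q]subn0 big_mkord; apply: eq_bigr => i _; rewrite mul1r.
rewrite sE sumr_const card_ord => h; rewrite mulr_natl.
apply: (le_trans _ (h _)); last first.
  by move=> j; rewrite mem_iota add0n => /= jq; exact: muM.
rewrite le_eqVlt; apply/orP; left; apply/eqP; apply: eq_integral => x _.
by rewrite (sE (fun j => (nth 0%N x j)%:R)).
Qed.

Lemma dist_state_total (x y : st) : (dists x y <= total R x + total R y)%R.
Proof.
rewrite /total -big_split; apply: ler_sum => i _ /=; rewrite /dist_nat !(tnth_nth 0%N).
by rewrite (le_trans (ler_normB _ _))// !ger0_norm.
Qed.

Lemma integral_affine1 (mu : probability st R) (f : st -> R) (A C F : R) :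
  (forall x, 0 <= f x)%R -> (0 <= A)%R -> (0 <= C)%R ->
  \int[mu]_x (f x)%:E <= F%:E ->
  \int[mu]_x (A * f x + C)%R%:E <= (A * F + C)%R%:E.
Proof.
move=> f0 A0 C0 fF.
have := integral_affine2 dS f0 f0 A0 (lexx 0%R) C0 fF fF.
rewrite mul0r addr0; apply: le_trans; rewrite le_eqVlt; apply/orP; left; apply/eqP.
by apply: eq_integral => x _; rewrite mul0r addr0.
Qed.

Lemma integral_dist_state_le (mu : probability st R) M A : (0 <= A)%R -> (0 <= M)%R ->
  mean_bound mu M ->
  \int[mu]_x \int[mu]_y (A * dists x y)%:E <= (A * (q%:R * M) + A * (q%:R * M))%R%:E.
Proof.
move=> A0 M0 muM; have tM := integral_total_le muM.
have AM0 : (0 <= A * (q%:R * M))%R by rewrite mulr_ge0// mulr_ge0.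
apply: le_trans (integral_affine1 (@total_ge0 R q) A0 AM0 tM).
apply: discrete_ge0_le_integral; first exact: dS.
  move=> x; apply: integral_ge0 => y _; rewrite lee_fin.
  by rewrite mulr_ge0// dist_state_ge0.
move=> x; have Ax0 : (0 <= A * total R x)%R by rewrite mulr_ge0// total_ge0.
rewrite [X in _ <= X%:E]addrC.
apply: le_trans (integral_affine1 (@total_ge0 R q) A0 Ax0 tM).
apply: discrete_ge0_le_integral; first exact: dS.
  by move=> y; rewrite lee_fin mulr_ge0// dist_state_ge0.
move=> y; rewrite lee_fin -mulrDr ler_wpM2l// [leRHS]addrC.
exact: dist_state_total.
Qed.

Section array.
Context d (T : measurableType d) (P : probability T R).
Context (X : nat -> int -> {RV P >-> nat})
  (Y : nat -> int -> nat -> nat -> {RV P >-> nat})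
  (eta : nat -> int -> {RV P >-> nat}) (c : st).
Context (tv : tv_inar zeta (pi 0%R) X Y eta c).

Local Notation law_state := (law_state X c).
Local Notation state := (Defs.state X c).

Let mstate n (l : int) : measurable_fun setT (state n l).
Proof. exact: measurable_funP. Qed.

Let contraction_const : R := (q%:R * (1 / rho ^+ q))%R.

Let contraction_const_ge0 : (0 <= contraction_const)%R.
Proof.
by have [r0 _] := andP rho01; rewrite mulr_ge0// divr_ge0// exprn_ge0// ltW.
Qed.

(** By contraction, the [j]-step laws from two states differ by at most a constant times [rho ^+ j]
    times the distance of the states, and the mean distance of two independent copies of the present
    is at most 2 q cap. *)
Lemma dependence_le_decay n (i : int) (j : nat) (f : st -> R) : (0 < n)%N ->
  lipschitz1 dists f -> (i + j%:Z <= n%:Z)%R ->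
  \int[P]_w dependence P (past X c n i) (f \o state n (i + j%:Z)) w
  <= (2 * (contraction_const * (q%:R * cap) + contraction_const * (q%:R * cap))
       * rho ^+ j)%R%:E.
Proof.
move=> n0 lf ij; have [r0 _] := andP rho01.
have i_n : (i <= n%:Z)%R by apply: le_trans ij; rewrite lerDl.
pose K x : probability st R := run (clip (times n i) j) \d_x j.
pose A : R := (contraction_const * rho ^+ j)%R.
have A0 : (0 <= A)%R by rewrite mulr_ge0// exprn_ge0// ltW.
have us1 t : (clip (times n i) j t <= 1)%R by exact: (clip_times_le1 R t n0 ij).
have KM x : mean_bound (K x) (total R x + cap)%R.
  apply: (mean_bound_run hq H) => //.
    by apply: (mean_cap_le H); rewrite lerDr total_ge0.
  by apply: mean_bound_le (mean_bound_dirac R x); rewrite lerDl.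
have KA x y : coupled dists (K x) (K y) (A * dists x y)%R.
  have D0 : (0 <= dists x y)%R by exact: dist_state_ge0.
  have cxy : vcoupled (\d_x : probability st R) \d_y (fun=> dists x y).
    exists \d_(x, y) => [|l lq].
      split=> A' _; rewrite [LHS]diracE [RHS]diracE //.
    rewrite integral_diracT; last exact: discrete_pair dS dS.
    rewrite /cdist lee_fin /dist_state (bigD1 (Ordinal lq))//= !(tnth_nth 0%N) lerDl.
    by apply: sumr_ge0 => k _; exact: dist_nat_ge0.
  have := run_contraction hq H j us1 (mean_bound_dirac R y) (total_ge0 R y) D0 cxy.
  move=> /vcoupled_const_coupled; apply: coupled_le.
  by rewrite /A /contraction_const; lra.
have LM := law_state_mean hq H hpi tv n0.
have h := @dependence_le R q _ T P _ _ _ [set l | l <= i]%R (state n) (fun l _ => mstate n l)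
  (state n i) (state n (i + j%:Z)) K (@past_state R q d T P X c n i).
have h1 LE := h LE (fun x => le_lt_trans (integral_total_le (KM x)) (ltry _)).
have h2 LE Zfin b0 bC := h1 LE Zfin (fun x y => A * dists x y)%R b0 bC KA f lf.
apply: le_trans (h2 _ _ _ _) _.
- move=> A' B pA; rewrite (multi_step hq tv)//.
  by apply: eq_integral => w _; rewrite /K -run_clip.
- have t0 (x : st) : 0 <= (total R x)%:E by rewrite lee_fin total_ge0.
  rewrite -(integral_law P (state n (i + j%:Z)) dS t0).
  exact: le_lt_trans (integral_total_le (LM _ ij)) (ltry _).
- by move=> x y; rewrite mulr_ge0// dist_state_ge0.
- by move=> x y; rewrite dist_stateC.
have AD0 x y : 0 <= (A * dists x y)%:E.
  by rewrite lee_fin mulr_ge0// dist_state_ge0.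
have B0 x : 0 <= \int[law_state n i]_y (A * dists x y)%:E.
  exact: integral_ge0.
have -> : \int[P]_w \int[P]_w' (A * dists (state n i w) (state n i w'))%:E
    = \int[law_state n i]_x \int[law_state n i]_y (A * dists x y)%:E.
  transitivity (\int[P]_w \int[law_state n i]_y (A * dists (state n i w) y)%:E).
    apply: eq_integral => w _; apply/esym.
    exact: (integral_law P (state n i) dS (AD0 _)).
  exact/esym/(integral_law P (state n i) dS B0).
apply: le_trans (lee_wpmul2l _ (integral_dist_state_le A0 cap0 (LM _ i_n))) _ => //.
by rewrite -EFinM lee_fin /A; lra.
Qed.

(** The supremum in [tau] runs over all times; beyond [n] the state is the constant [c], on which
    the past has no influence. *)
Lemma dependence_le_frozen n (i k : int) (f : st -> R) : lipschitz1 dists f ->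
  (n%:Z < k)%R ->
  \int[P]_w dependence P (past X c n i) (f \o state n k) w <= 0.
Proof.
move=> lf nk.
have sc w : state n k w = c by rewrite /Defs.state leNgt nk.
pose K (x : st) : probability st R := \d_c.
have h LE := @dependence_le R q _ T P _ _ _ [set l | l <= i]%R (state n) (fun l _ => mstate n l)
  (state n i) (state n k) K (@past_state R q d T P X c n i) LE.
have Lf x : \int[K x]_y (total R y)%:E < +oo.
  rewrite /K integral_diracT ?ltry//; exact: dS.
have Zf : \int[P]_w (total R (state n k w))%:E < +oo.
  under eq_integral do rewrite sc.
  by rewrite integral_probability_cst ltry.
have KA x y : coupled dists (K x) (K y) 0%R.
  by apply: coupled_refl; [exact: dS|exact: dist_state_ge0|exact: dist_statexx].
have h1 LE := h LE Lf Zf (fun _ _ => 0%R) (fun _ _ => lexx 0%R) (fun _ _ => erefl) KA f lf.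
apply: le_trans (h1 _) _.
  move=> A B pA; have mA := past_measurable pA.
  rewrite /K; transitivity ((\d_c B : \bar R) * P A); last first.
    by rewrite -integral_cst.
  have [cB|cB] := boolP (c \in B).
    rewrite diracE cB mul1e; congr (P _); apply/seteqP; split=> [w []//|w Aw].
    by split=> //=; rewrite sc; exact: set_mem.
  rewrite diracE (negbTE cB) mul0e (_ : A `&` _ = set0) ?measure0//.
  apply/seteqP; split=> // w [_] /=; rewrite sc => /mem_set; exact/negP.
rewrite (_ : \int[P]_w _ = 0) ?mule0//.
by apply: integral0_eq => w _; exact: integral0_eq.
Qed.

Lemma tau_le : exists C : R, (0 < C)%R /\ forall n j, (0 < n)%N ->
  tau X c n j <= (C * rho ^+ j)%:E.
Proof.
have [r0 _] := andP rho01.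
pose C : R := (2 * (contraction_const * (q%:R * cap) + contraction_const * (q%:R * cap)))%R.
have C0 : (0 <= C)%R by rewrite mulr_ge0// addr_ge0// mulr_ge0// mulr_ge0.
exists (C + 1)%R; split => [|n j n0]; first by rewrite ltr_wpDl.
have rj0 : (0 <= rho ^+ j)%R by rewrite exprn_ge0// ltW.
apply: ge_ereal_sup => _ [f [i [lf ->]]].
have [ij|ij] := leP (i + j%:Z)%R n%:Z.
  apply: le_trans (dependence_le_decay n0 lf ij) _.
  by rewrite lee_fin ler_wpM2r// lerDl.
apply: le_trans (dependence_le_frozen i lf ij) _.
by rewrite lee_fin mulr_ge0// addr_ge0.
Qed.

End array.
End array_dependence.

(** * Laws of blocks and local stationarity *)

Section array_paths.
Local Open Scope ereal_scope.
Context (R : realType) (q : nat) (hq : (0 < q)%N).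
Context (zeta : nat -> R -> probability nat R).
Context (kappa r b L : R) (a : R -> nat -> R) (H : regular q zeta kappa r b L a).
Context (pi : R -> probability (q.-tuple nat) R).
Context (hpi : forall u, (u <= 1)%R ->
  invariant_law (Q_kernel zeta u) (pi u) /\ mean_bound (pi u) (mean_cap r b)).

Local Notation mS := (@measurable_state q).
Local Notation Q := (Q_kernel zeta).
Local Notation cap := (mean_cap r b).
Local Notation drift := (drift_const q r b L).
Local Notation time := (Defs.time R).
Local Notation times := (times R).

Let cap0 : (0 <= cap)%R := mean_cap_ge0 H.
Let drift0 : (0 <= drift)%R := drift_const_ge0 H.
Let kappa01 : (0 < kappa < 1)%R := reg_kappa H.
Let kappa0 : (0 < kappa)%R.
Proof. by case/andP: kappa01. Qed.

Lemma dist_path_ge1 j (x y : j.-tuple (q.-tuple nat)) : x <> y -> (1 <= @dist_path R j q x y)%R.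
Proof.
move=> xy; have [i xyi] : exists i, tnth x i <> tnth y i.
  by apply: contrapT => h; apply: xy; apply: eq_from_tnth => i;
     apply: contrapT => ?; apply: h; exists i.
rewrite /dist_path (bigD1 i)//= -[leLHS]addr0 lerD ?dist_state_ge1//.
by apply: sumr_ge0 => k _; exact: dist_state_ge0.
Qed.

Lemma stationary_law_frozen u v j : frozen u = frozen v ->
  stationary_law zeta pi u j = stationary_law zeta pi v j.
Proof. by move=> uv; rewrite /stationary_law uv (Q_kernel_frozen q zeta uv). Qed.

Lemma stationary_law_coupled j : exists2 C : R, (0 <= C)%R &
  forall u v, (0 <= u <= 1)%R -> (0 <= v <= 1)%R ->
  coupled (@dist_path R j q) (stationary_law zeta pi u j) (stationary_law zeta pi v j)
    (C * `|u - v| `^ kappa)%R.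
Proof.
have L0 := reg_L H.
have [A [B [A0 B0 h]]] := path_coupled hq H j.
exists (A * drift + L * B * (1 + cap))%R.
  by do ?[exact: ler01|by []|apply: addr_ge0|apply: mulr_ge0].
move=> u v /andP[u0 u1] /andP[v0 v1].
rewrite /stationary_law (frozen_id u0) (frozen_id v0).
rewrite !(chain_law_path mS).
have [_ pivM] := hpi v1.
have wE : omega kappa u v = (`|u - v| `^ kappa)%R by rewrite /omega !frozen_id.
have e0 : (0 <= L * omega kappa u v)%R by rewrite mulr_ge0// omega_ge0.
have D0 : (0 <= drift * omega kappa u v)%R by rewrite mulr_ge0// omega_ge0.
apply: coupled_le (h (fun=> u) (fun=> v) _ _ _ _ cap (fun _ _ => u1) (fun=> v1)
  (fun _ _ => lexx _) e0 D0 (pi_coupled hq H hpi v1 u1) pivM).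
by rewrite wE; lra.
Qed.

Section array.
Context d (T : measurableType d) (P : probability T R).
Context (X : nat -> int -> {RV P >-> nat})
  (Y : nat -> int -> nat -> nat -> {RV P >-> nat})
  (eta : nat -> int -> {RV P >-> nat}) (c : q.-tuple nat).
Context (tv : tv_inar zeta (pi 0%R) X Y eta c).

(** [path_coupled] asks for one error valid at all steps: the sum over the block bounds each of its
    terms. *)
Lemma block_coupled j : exists2 C : R, (0 <= C)%R &
  forall u n (k : int), (0 <= u <= 1)%R -> (0 < n)%N -> (k + j.+1%:Z - 1 <= n%:Z)%R ->
  coupled (@dist_path R j.+1 q) (block_law X c n k j.+1)
    (stationary_law zeta pi u j.+1)
    (C * (\sum_(s < j.+1) `|u - time n (k + (s : nat)%:Z)| `^ kappa
          + 1 / n%:R `^ kappa))%R.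
Proof.
have L0 := reg_L H.
have [A [B [A0 B0 h]]] := path_coupled hq H j.+1.
exists (A * drift + L * B * (1 + cap))%R.
  by do ?[exact: ler01|by []|apply: addr_ge0|apply: mulr_ge0].
move=> u n k u01 n0 kj; have [u0 u1] := andP u01.
set S := (\sum_(s < _) _)%R; set N := (1 / _)%R.
have N0 : (0 <= N)%R by rewrite divr_ge0// powR_ge0.
have S_ge s : (s < j.+1)%N -> (`|u - time n (k + s%:Z)| `^ kappa <= S)%R.
  move=> sj; rewrite /S (bigD1 (Ordinal sj))//= lerDl.
  by apply: sumr_ge0 => i _; exact: powR_ge0.
have S0 : (0 <= S)%R by apply: sumr_ge0 => i _; exact: powR_ge0.
have kn : (k <= n%:Z)%R by apply: le_trans kj; clear; lia.
apply: (coupled_eq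
  (mu := path_law mS (fun t => Q (times n k t)) (law_state X c n k) j.+1)
  (nu := path_law mS (fun=> Q u) (pi u) j.+1)).
- by move=> E _; apply/esym/(block_law_path hq tv).
- by move=> E _; rewrite /stationary_law frozen_id// chain_law_path.
have us1 t : (t.+1 < j.+1)%N -> (times n k t <= 1)%R.
  by move=> tj; apply: time_le1 => //; clear -tj kj; lia.
(* The parameter of step [t] is the time of entry [t.+1] of the block. *)
have we t : (t.+1 < j.+1)%N -> (L * omega kappa (times n k t) u <= L * S)%R.
  move=> tj; rewrite ler_wpM2l//; apply: le_trans (S_ge _ tj).
  have -> : (k + t.+1%:Z = k + 1 + t%:Z)%R by clear; lia.
  rewrite /omega ge0_ler_powR ?nnegrE ?(ltW kappa0)// [leRHS]distrC.
  exact: frozen_dist.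
have LS0 : (0 <= L * S)%R by rewrite mulr_ge0.
have D0 : (0 <= drift * (`|u - time n k| `^ kappa + N))%R.
  by rewrite mulr_ge0// addr_ge0// powR_ge0.
have [_ piuM] := hpi u1.
have LM := law_state_mean hq H hpi tv n0 kn.
apply: coupled_le (h (times n k) (fun=> u) _ _ _ _ cap us1 (fun=> u1)
  we LS0 D0 (law_state_coupled hq H hpi tv n0 kn u01) piuM).
have := S_ge 0%N (ltn0Sn _); rewrite addr0 => hS.
have h1 : (A * (drift * (`|u - time n k| `^ kappa + N)) <= A * drift * (S + N))%R.
  rewrite mulrA; apply: ler_wpM2l; first exact: mulr_ge0.
  by rewrite lerD2r.
have h2 : (L * S * B * (1 + cap) <= L * B * (1 + cap) * (S + N))%R.
  rewrite (_ : L * S * B * (1 + cap) = L * B * (1 + cap) * S)%R; last by ring.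
  apply: ler_wpM2l; last by rewrite lerDl.
  by do ?[exact: ler01|by []|apply: addr_ge0|apply: mulr_ge0].
by rewrite mulrDl lerD.
Qed.

Lemma W1_block_le j : (0 < j)%N -> exists C : R, (0 < C)%R /\
  forall u n (k : int), (0 <= u <= 1)%R -> (0 < n)%N -> (k + j%:Z - 1 <= n%:Z)%R ->
  W1 (@dist_path R j q) (block_law X c n k j) (stationary_law zeta pi u j)
    <= (C * (\sum_(s < j) `|u - time n (k + (s : nat)%:Z)| `^ kappa
             + 1 / n%:R `^ kappa))%:E.
Proof.
case: j => // j _; have [C C0 h] := block_coupled j.
exists (C + 1)%R; split; first by rewrite ltr_wpDl.
move=> u n k u01 n0 kj; apply: coupled_W1; apply: coupled_le (h u n k u01 n0 kj).
rewrite ler_wpM2r ?lerDl// addr_ge0 ?divr_ge0 ?powR_ge0//.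
by apply: sumr_ge0 => s _; exact: powR_ge0.
Qed.

(** [k] may be negative, but by less than [j]; truncation at 0 then stays within j/n of the times of
    the block. *)
Lemma frozen_time_dist n (k : int) s j : (0 < n)%N -> (s <= j)%N -> (0 < k + j%:Z)%R ->
  (`|frozen (time n k) - time n (k + s%:Z)| <= j%:R / n%:R)%R.
Proof.
move=> n0 sj kj; have n0' : (0 < n%:R :> R)%R by rewrite ltr0n.
have -> : frozen (time n k) = time n (Num.max 0%R k).
  rewrite /frozen /Defs.time; have [k0|k0] := leP 0%R k.
    by apply/max_idPr; rewrite divr_ge0// ler0z.
  rewrite mul0r; apply/max_idPl.
  by rewrite pmulr_lle0 ?invr_gt0// lerz0 ltW.
rewrite /Defs.time -mulrBl normrM [X in (_ * X)%R]ger0_norm ?invr_ge0 ?(ltW n0')//.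
rewrite ler_wpM2r ?invr_ge0 ?(ltW n0')// -intrB -intr_norm.
rewrite -[leRHS]/((j%:Z)%:~R) ler_int; clear -sj kj.
by have [k0|k0] := leP 0%R k; lia.
Qed.

(** A block lying entirely at times up to 0 has exactly the stationary law, so arbitrarily negative
    [k] cost nothing; any other block starts after time -j and is compared at its frozen time. *)
Lemma theta_block_le j : exists2 C : R, (0 <= C)%R &
  forall n (k : int), (0 < n)%N -> (k <= n%:Z - j.+1%:Z + 1)%R ->
  (theta (block_law X c n k j.+1) (stationary_law zeta pi (time n k) j.+1)
   <= C * (1 / n%:R `^ kappa))%R.
Proof.
have dP : discrete (j.+1.-tuple (q.-tuple nat)) by exact: discrete_path.
have [C C0 h] := block_coupled j.
exists (C * (j.+1%:R * j%:R + 1))%R.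
  by rewrite mulr_ge0// addr_ge0// mulr_ge0.
move=> n k n0 kn; have n0' : (0 < n%:R :> R)%R by rewrite ltr0n.
have N0 : (0 <= 1 / n%:R `^ kappa :> R)%R by rewrite divr_ge0// powR_ge0.
have kn' : (k <= n%:Z)%R by clear -kn; lia.
have [kj|kj] := leP (k + j%:Z)%R 0%R.
  rewrite (_ : theta _ _ = 0%R).
    by rewrite mulr_ge0// mulr_ge0// addr_ge0// mulr_ge0.
  have [_ th _ _] := theta_metric R dP.
  apply/th => A mA.
  have f0 : frozen (time n k) = frozen 0%R.
    rewrite [RHS]frozen_id//; apply/max_idPl.
    rewrite /Defs.time pmulr_lle0 ?invr_gt0// lerz0; clear -kj; lia.
  rewrite (stationary_law_frozen _ f0) /stationary_law [frozen 0%R]frozen_id//.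
  by apply: (stationary_start tv) => //; clear -kj; lia.
have u01 := frozen01 (time_le1 R n0 kn').
have kjn : (k + j.+1%:Z - 1 <= n%:Z)%R by clear -kn; lia.
rewrite (stationary_law_frozen _ (esym (frozenK (time n k)))).
apply: (@theta_coupled _ _ _ (@dist_path R j.+1 q) dP).
- exact: dist_path_ge0.
- exact: dist_path_ge1.
- by rewrite mulr_ge0// mulr_ge0// addr_ge0// mulr_ge0.
apply: coupled_le (h _ _ _ u01 n0 kjn); rewrite -mulrA ler_wpM2l//.
rewrite [leRHS]mulrDl [X in (_ <= _ + X)%R]mul1r lerD2r -[leRHS]mulrA.
apply: (@le_trans _ _ (\sum_(s < j.+1) j%:R * (1 / n%:R `^ kappa))%R).
  apply: ler_sum => s _; apply: (@le_trans _ _ ((j%:R / n%:R) `^ kappa)%R).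
    rewrite ge0_ler_powR ?nnegrE ?(ltW kappa0) ?divr_ge0//.
    by apply: frozen_time_dist => //; rewrite -ltnS ltn_ord.
  exact: powR_div_nat.
by rewrite sumr_const card_ord -[leLHS]mulr_natl.
Qed.

Lemma inar_locally_stationary : locally_stationary (block_law X c) (stationary_law zeta pi).
Proof.
case=> // j _; exists (@theta _ _ R).
have dP : discrete (j.+1.-tuple (q.-tuple nat)) by exact: discrete_path.
have met := theta_metrizes dP (@dist_path_ge1 j.+1).
have [th0 _ _ _] := theta_metric R dP.
split => //; first exact: theta_metric.
  have [C C0 h] := stationary_law_coupled j.+1.
  apply/subspace_continuousP => x /= x01 U /met[e e0 eU].
  have C1 : (0 < C + 1)%R by rewrite ltr_wpDl.
  have eC : (0 < e / (C + 1))%R by rewrite divr_gt0.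
  (* This radius ensures |x - y|^kappa < e / (C + 1); adding 1 covers the case [C = 0]. *)
  have d0 : (0 < (e / (C + 1)) `^ kappa^-1)%R by exact: powR_gt0.
  have : nbhs x (ball x ((e / (C + 1)) `^ kappa^-1)%R) by exact: nbhsx_ballx.
  apply: filterS => y; rewrite -ball_normE /= => dxy y01; apply: eU => /=.
  have : (`|x - y| `^ kappa < e / (C + 1))%R.
    have := @gt0_ltr_powR _ _ kappa0 _ _ _ _ dxy.
    rewrite -powRrM mulVf ?gt_eqF// powRr1 ?(ltW eC)//.
    by apply; rewrite nnegrE ?powR_ge0.
  rewrite ltr_pdivlMr// => hxy.
  apply: (@le_lt_trans _ _ (C * `|x - y| `^ kappa)%R).
    apply: (@theta_coupled _ _ _ (@dist_path R j.+1 q) dP).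
    - exact: dist_path_ge0.
    - exact: dist_path_ge1.
    - by rewrite mulr_ge0// powR_ge0.
    by apply: h; rewrite -?in_itv//=.
  apply: le_lt_trans hxy; rewrite mulrC.
  by apply: ler_wpM2l; rewrite ?powR_ge0// lerDl ler01.
have [C C0 h] := theta_block_le j.
have lim0 : (fun n : nat => (C * (1 / n%:R `^ kappa))%:E) @ \oo --> 0.
  apply: cvg_EFin; first by near=> n.
  rewrite -[X in _ --> X](mulr0 C).
  by apply: cvgM; [exact: cvg_cst|exact: powR_inv_cvg0].
apply: (@squeeze_cvge _ _ _ _ (cst 0) _ _ _ _ _ lim0); last exact: cvg_cst.
near=> n; have n0 : (0 < n)%N by near: n; exists 1%N.
apply/andP; split.
  (* A member of the set is exhibited because the supremum of an empty set would be -oo. *)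
  apply: (@le_trans _ _ (theta (block_law X c n (n%:Z - j.+1%:Z + 1) j.+1)
    (stationary_law zeta pi (time n (n%:Z - j.+1%:Z + 1)) j.+1))%:E).
    by rewrite lee_fin.
  by apply: ereal_sup_ubound; exists (n%:Z - j.+1%:Z + 1)%R => /=.
by apply: ge_ereal_sup => _ [k /= kn <-]; rewrite lee_fin; exact: h.
Unshelve. all: by end_near. Qed.

End array.
End array_paths.

Theorem corollary3 (R : realType) (q : nat) (hq : (1 <= q)%N)
    (zeta : nat -> R -> probability nat R)
    (hmean : (ereal_sup [set (\sum_(1 <= j < q.+1) mean (zeta j u))%E
                          | u in [set u : R | (0 <= u <= 1)%R]] < 1)%E)
    (himmig : forall u : R, 0 <= u <= 1 -> (mean (zeta q.+1 u) < +oo)%E)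
    (C0 kappa : R) (hC0 : 0 < C0) (hkappa : 0 < kappa < 1)
    (hholder : forall (u v : R) (j : nat), 0 <= u <= 1 -> 0 <= v <= 1 ->
       (1 <= j <= q.+1)%N ->
       (W1 (@dist_nat R) (zeta j u) (zeta j v)
          <= (C0 * `|u - v| `^ kappa)%:E)%E) :
  exists pi : R -> probability (q.-tuple nat) R,
    (forall u : R, 0 <= u <= 1 ->
       invariant_law (Q_kernel zeta u) (pi u) /\
       forall mu : probability (q.-tuple nat) R,
         invariant_law (Q_kernel zeta u) mu -> mu ≡μ pi u) /\
    forall (d : measure_display) (T : measurableType d) (P : probability T R)
      (X : nat -> int -> {RV P >-> nat})
      (Y : nat -> int -> nat -> nat -> {RV P >-> nat})
      (eta : nat -> int -> {RV P >-> nat}) (c : q.-tuple nat),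
    tv_inar zeta (pi 0) X Y eta c ->
    [/\ locally_stationary (block_law X c) (stationary_law zeta pi),
        forall j : nat, (1 <= j)%N -> exists C : R, 0 < C /\
          forall (u : R) (n : nat) (k : int), 0 <= u <= 1 -> (1 <= n)%N ->
            k + j%:Z - 1 <= n%:Z ->
            (W1 (@dist_path R j q) (block_law X c n k j)
                (stationary_law zeta pi u j)
             <= (C * (\sum_(s < j) `|u - time R n (k + (s : nat)%:Z)| `^ kappa
                      + 1 / n%:R `^ kappa))%:E)%E &
        exists (C' rho : R), [/\ 0 < C', 0 < rho < 1 &
          forall n j : nat, (1 <= n)%N -> (1 <= j)%N ->
            (tau X c n j <= (C' * rho ^+ j)%:E)%E]].
Proof.
have [r [b [a H]]] := inar_regular hmean himmig hC0 hkappa hholder.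
(* [pi] must be total: for [u > 1] any law will do, while negative parameters are covered since
   [Q_kernel] freezes them. *)
have ex (u : R) : exists p : probability (q.-tuple nat) R, u <= 1 ->
    invariant_law (Q_kernel zeta u) p /\ mean_bound p (mean_cap r b).
  have [u1|u1] := leP u 1; last first.
    by exists (\d_[tuple of nseq q 0%N] : probability (q.-tuple nat) R).
  by have [p hp] := stationary_exists hq H u1; exists p.
have [pi hpi] := choice ex; exists pi; split => [u /andP[_ u1]|d T P X Y eta c tv].
  have [inv piM] := hpi u u1; split => // mu mu_inv A mA.
  exact: (invariant_unique hq H u1 inv piM mu_inv).
have [C [C_gt0 hC]] := tau_le hq H hpi tv.
split.
- exact: (inar_locally_stationary hq H hpi tv).
- move=> j j0; have [C1 [C1_gt0 hC1]] := W1_block_le hq H hpi tv j0.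
  by exists C1; split => // u n k u01 n0 kj; exact: hC1.
- by exists C, (decay q r); split; [|exact: (decay01 hq H)|move=> n j n0 _; exact: hC].
Qed.
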